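(* (1) Let $C$ be a near-extremal Type I code of length $n$, where $n$ is a positive integer with $n\equiv 0 \pmod 8$. Then $\delta(C)<s(C)$ if and only if $C$ is the (unique up to equivalence) near-extremal Type I $[16,8,4]$ code. In that case $C_6$ is a $2$-$(16,6,8)$ design, and $C_{10}$ is the complement design of $C_6$. (2) Let $C'$ be a near-extremal even formally self-dual code of length $16$. Then $C'_6\cup C'^{\perp}_6$ is a $2$-design, and $C'_{10}\cup C'^{\perp}_{10}$ is a $2$-design. (3) If $C''$ is a near-extremal even formally self-dual code of length $64$, then $C''_{28}\cup C''^{\perp}_{28}$ is a $2$-design, and $C''_{36}\cup C''^{\perp}_{36}$ is a $2$-design.
   Context: All codes are binary linear codes, i.e. subspaces of $\mathbb{F}_2^n$; an $[n,k,d]$ code has length $n$, dimension $k$ and minimum distance $d$; the dual $C^\perp$ is taken with respect to $(x,y)=\sum_i x_iy_i$. Two codes are equivalent if one is obtained from the other by a permutation of coordinates. A code is even if all its weights are even, and doubly even if all its weights are divisible by $4$. A Type I code is a self-dual code ($C=C^\perp$) that is not doubly even. An even formally self-dual code is an even code having the same weight distribution as its dual code. A Type I or even formally self-dual code of length $n$ is near-extremal if its minimum distance equals $2\lfloor n/8\rfloor$. It is known that there is exactly one Type I $[16,8,4]$ code up to equivalence. For a code $C$ of length $n$ and a nonzero weight $w$, the support design $C_w$ has point set $\{1,\dots,n\}$ and its blocks are the supports $\{i : c_i\neq 0\}$ of all codewords $c\in C$ of weight $w$. Unions such as $C'_w\cup C'^{\perp}_w$ are unions of block collections counted with multiplicity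 (a set that is the support of a word of $C'$ and also of a word of $C'^\perp$ is counted twice). A $t$-$(v,k,\lambda)$ design (a $t$-design) consists of a set of $v$ points and a collection (multiset) of $k$-element subsets called blocks such that any $t$ points are contained in exactly $\lambda$ blocks (with multiplicity); the empty collection is regarded as a $t$-design with $\lambda=0$. The complement design is obtained by replacing each block by its complement in the point set. Define $$\delta(C)=\max\{t\in\mathbb{N} : \text{for all } w,\ C_w \text{ is a } t\text{-design}\},\qquad s(C)=\max\{t\in\mathbb{N} : \text{there exists } w \text{ such that } C_w \text{ is a } t\text{-design}\},$$ where $w$ ranges over the weights $0<w<n$ for which $C$ has at least one codeword of weight $w$. *)

(* Defs.v *)
From HB Require Import structures.
From mathcomp Require Import all_boot all_algebra all_fingroup.

Set Implicit Arguments.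
Unset Strict Implicit.
Unset Printing Implicit Defensive.

Import GRing.Theory.
Local Open Scope nat_scope.

Section Designs.

Variable T : finType.
Implicit Types (t v k lambda : nat) (B : seq {set T}).

(* A multiset of blocks is a sequence of blocks, considered up to [perm_eq];
   the union with multiplicity is [++].
   The usual convention t <= k is imposed: without it any collection of
   k-subsets would be a t-design with lambda = 0 for every t > k.  The empty
   collection is a t-(v, k, 0) design for all k >= t. *)
Definition is_design t v k lambda B : bool :=
  [&& #|T| == v, t <= k, all (fun b : {set T} => #|b| == k) B &
      [forall A : {set T}, (#|A| == t) ==>
         (count (fun b : {set T} => A \subset b) B == lambda)]].

(* The bounds on k and lambda only serve decidability, see [t_designP]. *)
Definition t_design t B : bool :=
  [exists k : 'I_(maxn t #|T|).+1, exists lambda : 'I_(size B).+1,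
     is_design t #|T| k lambda B].

Definition complement_design B : seq {set T} := [seq ~: b | b : {set T} <- B].

Lemma t_designP t B :
  reflect (exists k lambda, is_design t #|T| k lambda B) (t_design t B).
Proof.
apply: (iffP existsP) => [[k /existsP[l dB]]|[k [l]]]; first by exists k, l.
case: B => [_|b B dB].
  exists (inord t); apply/existsP; exists ord0.
  rewrite /is_design eqxx /= inordK ?ltnS ?leq_maxl // leqnn /=.
  by apply/forallP => A; apply/implyP.
have /and4P[_ le_tk /= /andP[/eqP bk _] /forallP dl] := dB.
have le_kT : k <= #|T| by rewrite -bk max_card.
have /card_gt0P[A] : 0 < #|[set A : {set T} | A \subset b & #|A| == t]|.
  by rewrite cards_draws bin_gt0 bk.
rewrite inE => /andP[_ At]; have /implyP/(_ At)/eqP lE := dl A.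
have lek : k < (maxn t #|T|).+1 by rewrite ltnS leq_max le_kT orbT.
have lel : l < (size (b :: B)).+1 by rewrite ltnS -lE; apply: count_size.
by exists (Ordinal lek); apply/existsP; exists (Ordinal lel).
Qed.

Lemma t_design_le t B : B != [::] -> t_design t B -> t <= #|T|.
Proof.
case: B => // b B _ /t_designP[k [l /and4P[_ le_tk /= /andP[/eqP bk _] _]]].
by rewrite (leq_trans le_tk) // -bk max_card.
Qed.

End Designs.

Definition code (n : nat) := {vspace 'rV['F_2]_n}.

Section Codes.

Variable n : nat.
Implicit Types (C D : code n) (c x y : 'rV['F_2]_n) (w : nat).

Definition supp c : {set 'I_n} := [set i | c ord0 i != 0%R].

Definition wt c : nat := #|supp c|.

Definition inner x y : 'F_2 := (\sum_i x ord0 i * y ord0 i)%R.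

Definition dual C : code n :=
  (\bigcap_(c : 'rV['F_2]_n | c \in C) lker (linfun (mulmxr c^T)))%VS.

Lemma dualP C x : reflect (forall c, c \in C -> inner x c = 0%R) (x \in dual C).
Proof.
have kerE c : (x \in lker (linfun (mulmxr c^T))) = (inner x c == 0%R).
  rewrite memv_ker lfunE /= -[inner x c]/(\sum_i x ord0 i * c ord0 i)%R.
  have xcE : ((x *m c^T) ord0 ord0 = \sum_i x ord0 i * c ord0 i)%R.
    by rewrite mxE; apply: eq_bigr => i _; rewrite mxE.
  rewrite -xcE; apply/eqP/eqP => [-> | xc0]; first by rewrite mxE.
  by apply/matrixP => i j; rewrite !ord1 xc0 mxE.
have -> : (x \in dual C) = (<[x]> <= dual C)%VS by rewrite memvE.
apply: (iffP subv_bigcapP) => h c /h; rewrite -memvE kerE.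
  by move/eqP.
by move=> ->.
Qed.

Definition self_dual C : Prop := C = dual C.

Definition even_code C : Prop := forall c, c \in C -> 2 %| wt c.

Definition doubly_even C : Prop := forall c, c \in C -> 4 %| wt c.

Definition codewords C w : {set 'rV['F_2]_n} :=
  [set c | (c \in C) && (wt c == w)].

Definition formally_self_dual C : Prop :=
  forall w, #|codewords C w| = #|codewords (dual C) w|.

Definition min_distance C (d : nat) : Prop :=
  (exists x y, [/\ x \in C, y \in C, x != y & wt (x - y)%R = d]) /\
  (forall x y, x \in C -> y \in C -> x != y -> d <= wt (x - y)%R).

Definition is_nkd C (n' k d : nat) : Prop :=
  [/\ n = n', \dim C = k & min_distance C d].

Definition type_I C : Prop := self_dual C /\ ~ doubly_even C.

Definition near_extremal C : Prop := min_distance C (2 * (n %/ 8)).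

Definition near_extremal_type_I C : Prop := type_I C /\ near_extremal C.

Definition near_extremal_even_fsd C : Prop :=
  [/\ even_code C, formally_self_dual C & near_extremal C].

Definition equivalent C D : Prop :=
  exists s : 'S_n, forall c, (col_perm s c \in D) = (c \in C).

Definition support_design C w : seq {set 'I_n} :=
  [seq supp c | c in codewords C w].

(* w < n is enforced below by letting w range over 'I_n. *)
Definition is_weight C w : bool := (0 < w) && (codewords C w != set0).

(* The maxima are over t <= n, which is no restriction when there is at least
   one weight 0 < w < n: see [design_deltaP] and [design_sP]. *)
Definition design_delta C : nat :=
  \max_(t < n.+1 | [forall w : 'I_n,
     is_weight C w ==> t_design t (support_design C w)]) t.

Definition design_s C : nat :=
  \max_(t < n.+1 | [exists w : 'I_n,
     is_weight C w && t_design t (support_design C w)]) t.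

Lemma t_design0 C w : t_design 0 (support_design C w).
Proof.
apply/t_designP; exists w, (size (support_design C w)).
rewrite /is_design eqxx leq0n /=; apply/andP; split.
  apply/allP => b /imageP[c]; rewrite inE => /andP[_ /eqP <-] -> //.
apply/forallP => A; apply/implyP; rewrite cards_eq0 => /eqP ->.
by apply/eqP/eqP; rewrite -all_count; apply/allP => b _; rewrite sub0set.
Qed.

Lemma weight_t_design_le C t w :
  is_weight C w -> t_design t (support_design C w) -> t <= n.
Proof.
move=> /andP[_ /set0Pn[c Cc]] /t_design_le; rewrite card_ord; apply.
by rewrite -size_eq0 size_image -lt0n; apply/card_gt0P; exists c.
Qed.

Lemma design_deltaP C : (exists w : 'I_n, is_weight C w) ->
  let P t := forall w, w < n -> is_weight C w ->
               t_design t (support_design C w) in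
  P (design_delta C) /\ forall t, P t -> t <= design_delta C.
Proof.
move=> [w0 Cw0] P.
have PE t : reflect (P t) [forall w : 'I_n,
    is_weight C w ==> t_design t (support_design C w)].
  apply: (iffP forallP) => [h w lt_wn Cw|h w].
    by move: (h (Ordinal lt_wn)); rewrite Cw.
  by apply/implyP; apply: h.
split=> [|t Pt]; last first.
  have le_tn : t < n.+1 by rewrite ltnS (weight_t_design_le Cw0) //; apply: Pt.
  by apply: (bigmax_sup (Ordinal le_tn)) => //; apply/PE.
apply/PE; rewrite /design_delta (bigop.bigmax_eq_arg ord0) => [|]; last first.
  by apply/PE => w _ _; apply: t_design0.
by case: arg_maxnP => [|t //]; apply/PE => w _ _; apply: t_design0.
Qed.

Lemma design_sP C : (exists w : 'I_n, is_weight C w) ->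
  let P t := exists w, [/\ w < n, is_weight C w &
               t_design t (support_design C w)] in
  P (design_s C) /\ forall t, P t -> t <= design_s C.
Proof.
move=> [w0 Cw0] P.
have PE t : reflect (P t) [exists w : 'I_n,
    is_weight C w && t_design t (support_design C w)].
  apply: (iffP existsP) => [[w /andP[Cw h]]|[w [lt_wn Cw h]]].
    by exists w.
  by exists (Ordinal lt_wn); rewrite /= Cw.
have P0 : P 0 by exists w0; split=> //; apply: t_design0.
split=> [|t Pt]; last first.
  have le_tn : t < n.+1.
    by have [w [_ Cw]] := Pt; rewrite ltnS; apply: weight_t_design_le.
  by apply: (bigmax_sup (Ordinal le_tn)) => //; apply/PE.
apply/PE; rewrite /design_s (bigop.bigmax_eq_arg ord0) => [|]; last by apply/PE.
by case: arg_maxnP => [|t //]; apply/PE.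
Qed.

(* "C is the (unique up to equivalence) near-extremal Type I [16,8,4] code",
   read as a definite description: C has the property, and every code with
   the property is equivalent to C. *)
Definition is_type_I_16_8_4 C : Prop :=
  near_extremal_type_I C /\ is_nkd C 16 8 4.

Definition is_the_type_I_16_8_4 C : Prop :=
  is_type_I_16_8_4 C /\ forall D, is_type_I_16_8_4 D -> equivalent C D.

End Codes.

(* Main.v *)
From HB Require Import structures.
Require Import Defs.
From mathcomp Require Import all_boot all_order all_algebra all_fingroup finfield.
From mathcomp Require Import ring lra zify.

Set Implicit Arguments.
Unset Strict Implicit.
Unset Printing Implicit Defensive.
Import Order.TTheory GRing.Theory Num.Theory.
Local Open Scope ring_scope.

(** Write n = 8m, and let C be near-extremal and even, either formally
    self-dual or of Type I.  A 1-design or 2-design is detected by sums over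
    its blocks of products of differences of point indicators: the differences
    [x in b] - [y in b] for 1-designs, the products
    ([x in b] - [y in b]) * ([z in b] - [u in b]) over disjoint pairs for
    2-designs ([design1_criterion], [design2_criterion]).  On the binary space
    a product of k such differences is an eigenfunction of the Fourier
    transform, with eigenvalue (-2)^k, relative to the remaining coordinates
    ([fourier_pairprod]).  Poisson summation therefore gives a MacWilliams
    identity for the enumerators W = sum_c harmonic(c) X^(wt c)
    ([macwilliams]), and the sum of W over C and over its dual is mapped to
    itself.  For k > 0 the zero word and the all-one word do not contribute, so
    this sum has only the exponents 2m, ..., 6m.  Divisibility by X^(2m)
    becomes, through t -> (1 - t)/(1 + t), divisibility by (1 - X^2)^(2m - k),
    and only a cofactor of degree at most 2k remains ([enumerator_shape]).  For
    k = 1 the functional equation forces this cofactor to vanish, hence every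
    weight gives a 1-design.  For k = 2 it is a multiple of (1 + X^2)^2, so the
    sum at weight 2m + 2r is a multiple of the coefficient of z^r in
    (1 - z)^(2m - 2) (1 + z)^2 ([fsd_deg2]).  Whenever this coefficient
    vanishes the words of weight 2m + 2r of C and its dual together form a
    2-design; this happens for m = 2, r = 1, 3 and for m = 8, r = 6, 10.

    Let now C be of Type I.  All its support designs are 1-designs.  If a
    weight with non-zero coefficient gave a 2-design, the multiple above would
    be zero and the words of minimum weight would give one as well
    ([typeI_design2_min]).  The number of these words follows from Gleason's
    theorem ([gleason]) and from the shadow, i.e. the coset of the vectors w with
    (-1)^(w, c) = (-1)^(wt c / 2) for all c in C: the shadow omits 0, which kills
    the last coefficient in Gleason's expansion ([gleason_top]).  For m <= 4
    that number violates the divisibility condition for 2-designs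
    ([min_not_design2]).  Hence both strengths are 1 for m = 1, 3, 4, where no
    coefficient vanishes, whereas for m = 2 weight 4 does not and weight 6 does
    give a 2-design.

    For m >= 5 there is no such code ([no_near_extremal_type_I]).  Lagrange
    inversion expresses the last but one Gleason coefficient, hence the number
    B of shadow vectors of weight 4, by a coefficient of the power series
    (1 + z)^(-5) (1 - z)^(-(2m - 2)), which is positive and large.  This makes
    B negative for odd m and at least 2 for even m, but two shadow vectors of
    weight 4 differ by a word of weight at most 8 < 2m.

    Finally, in a Type I [16,8,4] code each point lies on three words of weight
    4.  They share two points, and so cut eight points into four pairs any two
    of which form a word ([star_exists]).  Two disjoint configurations of this
    kind exhaust the coordinates, and after a suitable choice of the order
    inside each pair the code is spanned by eight fixed words
    ([standard_frame], [standard_code]), which determines it up to equivalence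
    ([type_I_16_unique]). *)

(** * Poisson summation and products of coordinate differences *)

Lemma F2_cases (a : 'F_2) : a = 0 \/ a = 1.
Proof. by case: a => [[|[|//]] ?]; [left | right]; apply/val_inj. Qed.

Lemma F2_addrr (a : 'F_2) : a + a = 0.
Proof. by case: (F2_cases a) => ->; apply/val_inj. Qed.

Lemma big_F2 (F : 'F_2 -> rat) : \sum_a F a = F 0 + F 1.
Proof.
rewrite (bigD1 0) //= (bigD1 1) //= big1 ?addr0 // => a /andP[a0 a1].
by case: (F2_cases a) a0 a1 => ->.
Qed.

(** The non-trivial additive character of the field with two elements. *)
Definition sgn (a : 'F_2) : rat := (-1) ^+ (a != 0).

Lemma sgn0 : sgn 0 = 1. Proof. by []. Qed.
Lemma sgn1 : sgn 1 = -1. Proof. by []. Qed.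

Lemma sgnD : {morph sgn : a b / a + b >-> a * b}.
Proof.
by move=> a b; case: (F2_cases a) (F2_cases b) => -> [] -> //=;
  rewrite ?F2_addrr ?addr0 ?add0r ?sgn0 ?sgn1 ?mul1r ?mulr1 // mulrNN mulr1.
Qed.

Section Fourier.
Variable n : nat.
Implicit Types (C : code n) (u v c w : 'rV['F_2]_n) (s : seq ('I_n * 'I_n)).
Implicit Types (g : 'I_n -> 'F_2 -> rat).

Lemma innerC u v : inner u v = inner v u.
Proof. by apply: eq_bigr => i _; rewrite mulrC. Qed.

Lemma innerDl u v w : inner (u + v) w = inner u w + inner v w.
Proof. by rewrite -big_split; apply: eq_bigr => i _; rewrite mxE mulrDl. Qed.

Lemma innerDr u v w : inner u (v + w) = inner u v + inner u w.
Proof. by rewrite !(innerC u) innerDl. Qed.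

(** Orthogonality of characters: if w is outside the dual, some c0 in C has
    inner product 1 with w, and translating by c0 changes the sign of the sum. *)
Lemma sum_sgn_inner C w :
  \sum_(c in C) sgn (inner c w) = #|C|%:R * (w \in dual C)%:R.
Proof.
have [/dualP wC|wC] := boolP (w \in dual C).
  rewrite mulr1 (eq_bigr (fun=> 1)) ?sumr_const // => c cC.
  by rewrite innerC wC.
rewrite mulr0.
have [c0 c0C c0w] : exists2 c0, c0 \in C & inner c0 w = 1.
  have [/exists_inP[c cC /eqP cw]|] :=
    boolP [exists c in C, inner c w == 1]; first by exists c.
  rewrite negb_exists_in => /forall_inP h; case/negP: wC; apply/dualP => c cC.
  by rewrite innerC; case: (F2_cases (inner c w)) (h c cC) => ->.
set S := (X in X = 0); suff: S = - S by lra.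
rewrite {1}/S (reindex_inj (addrI c0)) /= -sumrN.
apply: eq_big => [c|c _]; last by rewrite innerDl sgnD c0w sgn1 mulN1r.
by rewrite rpredDl.
Qed.

(** Poisson summation over a coset of the dual code.  The translate by w is
    what makes the shadow of a self-dual code accessible; w = 0 gives the
    MacWilliams identities. *)
Lemma poisson C w (F : 'rV['F_2]_n -> rat) :
  #|C|%:R * \sum_(u | u + w \in dual C) F u =
  \sum_(c in C) sgn (inner c w) * \sum_u sgn (inner u c) * F u.
Proof.
transitivity (\sum_u F u * \sum_(c in C) sgn (inner c (u + w))).
  rewrite mulr_sumr big_mkcond /=; apply: eq_bigr => u _.
  by rewrite sum_sgn_inner; case: (_ \in _) => /=; ring.
under eq_bigr do rewrite mulr_sumr.
rewrite exchange_big; apply: eq_bigr => c _ /=.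
rewrite mulr_sumr; apply: eq_bigr => u _.
by rewrite innerDr sgnD (innerC u c); ring.
Qed.

(** The Fourier transform of each factor of a product function. *)
Definition fourier1 g : 'I_n -> 'F_2 -> rat := fun l a => g l 0 + sgn a * g l 1.

Lemma fourier_prod g v :
  \sum_u sgn (inner u v) * \prod_l g l (u ord0 l) = \prod_l fourier1 g l (v ord0 l).
Proof.
transitivity (\prod_l \sum_b sgn (b * v ord0 l) * g l b); last first.
  by apply: eq_bigr => l _; rewrite big_F2 mul0r sgn0 !mul1r.
rewrite bigA_distr_bigA /= (reindex (fun f : {ffun 'I_n -> 'F_2} => \row_l f l)).
  apply: eq_bigr => f _; rewrite /inner (big_morph _ sgnD sgn0) -big_split /=.
  by apply: eq_bigr => l _; rewrite !mxE.
exists (fun u : 'rV_n => [ffun l => u ord0 l]) => [f _|u _].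
  by apply/ffunP => l; rewrite ffunE mxE.
by apply/rowP => l; rewrite mxE ffunE.
Qed.

Definition points_of s : seq 'I_n := flatten [seq [:: e.1; e.2] | e <- s].

(** A basic discrete harmonic function: its degree is the number of pairs, and
    it is meant for lists of pairwise disjoint pairs of coordinates. *)
Definition harmonic s u : rat :=
  \prod_(e <- s) ((u ord0 e.1 != 0)%:R - (u ord0 e.2 != 0)%:R).

(** Admitting an arbitrary factor at each remaining coordinate makes the class
    stable under the Fourier transform and under splitting off a pair. *)
Definition pairprod g s u : rat :=
  harmonic s u * \prod_(l | l \notin points_of s) g l (u ord0 l).

Definition override g i (h : 'F_2 -> rat) : 'I_n -> 'F_2 -> rat :=
  fun l => if l == i then h else g l.

Lemma pairprod_override g i j h h' s u : uniq (points_of ((i, j) :: s)) ->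
  pairprod (override (override g i h) j h') s u =
  harmonic s u * (h (u ord0 i) * h' (u ord0 j) *
              \prod_(l | l \notin points_of ((i, j) :: s)) g l (u ord0 l)).
Proof.
rewrite /= !inE negb_or => /and3P[/andP[ij iS] jS _].
rewrite /pairprod (bigD1 i) //= (bigD1 j) /= ?jS 1?eq_sym //.
rewrite /override eqxx (negPf ij) eqxx mulrA; do 2!congr (_ * _).
apply: eq_big => l; first by rewrite !inE !negb_or; case: (l == i); case: (l == j); rewrite ?andbF ?andbT.
by rewrite -andbA => /and3P[_ /negPf-> /negPf->].
Qed.

(** On a single pair of coordinates, the difference of the point indicators is
    d1(a) d0(b) - d0(a) d1(b), with d0, d1 the indicators of 0 and non-zero.
    Its transform is sgn a - sgn b, which is -2 times the difference itself.
    Hence each pair contributes a factor -2 and the other coordinates are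
    transformed one by one.  The induction peels off one pair by writing its
    difference as two product functions with fewer pairs. *)
Lemma fourier_pairprod s g v : uniq (points_of s) ->
  \sum_u sgn (inner u v) * pairprod g s u =
  (-2) ^+ size s * pairprod (fourier1 g) s v.
Proof.
elim: s g => [|[i j] s IH] g Us.
  rewrite expr0 mul1r /pairprod /harmonic big_nil mul1r /=.
  under eq_bigr do rewrite big_nil mul1r.
  exact: fourier_prod.
pose d0 (a : 'F_2) : rat := (a == 0)%:R; pose d1 (a : 'F_2) : rat := (a != 0)%:R.
have Us' : uniq (points_of s) by case/and3P: Us.
have pE u : pairprod g ((i, j) :: s) u =
    pairprod (override (override g i d1) j d0) s u - pairprod (override (override g i d0) j d1) s u.
  rewrite !pairprod_override // {1}/pairprod {1}/harmonic big_cons -/(harmonic s u) /= /d0 /d1.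
  by do 2![case: eqP => _] => /=; ring.
under eq_bigr do rewrite pE mulrBr.
rewrite sumrB !IH //.
have hatE h h' l a : fourier1 (override (override g i h) j h') l a =
    override (override (fourier1 g) i (fun a => h 0 + sgn a * h 1)) j
        (fun a => h' 0 + sgn a * h' 1) l a.
  by rewrite /fourier1 /override; case: (l == j); case: (l == i).
have ext g1 g2 : (forall l a, g1 l a = g2 l a) ->
    pairprod g1 s v = pairprod g2 s v.
  by move=> e; congr (_ * _); apply: eq_bigr => l _.
rewrite !(ext _ _ (hatE _ _)) !pairprod_override //.
rewrite /pairprod [harmonic (_ :: _) _]big_cons -/(harmonic s v) /d0 /d1 /= exprS.
case: (F2_cases (v ord0 i)) (F2_cases (v ord0 j)) => -> [] ->;
  rewrite ?sgn0 ?sgn1 ?eqxx ?oner_eq0 /=; ring.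
Qed.

(** Where the harmonic function does not vanish, each pair has exactly one
    non-zero coordinate, so it accounts for one factor x and one factor y. *)
Lemma pairprod_const x y s u : uniq (points_of s) ->
  (x * y) ^+ size s * pairprod (fun _ a => if a == 0 then x else y) s u =
  harmonic s u * x ^+ (n - wt u) * y ^+ wt u.
Proof.
move=> Us; have -> : harmonic s u * x ^+ (n - wt u) * y ^+ wt u =
    harmonic s u * \prod_l (if u ord0 l == 0 then x else y).
  rewrite -mulrA; congr (_ * _); symmetry.
  rewrite (bigID (fun l => l \in supp u)) /= mulrC; congr (_ * _).
    rewrite (eq_bigr (fun=> x)) => [|l]; last by rewrite inE negbK => ->.
    rewrite prodr_const; congr (_ ^+ _).
    have := cardC (mem (supp u)); rewrite card_ord => nE.
    by rewrite -[RHS](congr1 (subn^~ (wt u)) nE) addKn.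
  rewrite (eq_bigr (fun=> y)) => [|l]; last by rewrite inE => /negPf ->.
  by rewrite prodr_const.
rewrite (bigID (fun l => l \in points_of s)) /= /pairprod !mulrA.
congr (_ * _); rewrite -big_uniq //= mulrC {Us}.
elim: s => [|e s IH]; first by rewrite /= big_nil expr0.
have -> : points_of (e :: s) = [:: e.1, e.2 & points_of s] by [].
rewrite [harmonic _ _]big_cons -/(harmonic s u) !big_cons exprS mulrACA {}IH.
set P := \prod_(_ <- _) _.
by do 2!case: eqP => _ /=; ring.
Qed.

End Fourier.

(** * Harmonic weight enumerators and the MacWilliams identity *)

Section WeightEnumerators.
Variable n : nat.
Implicit Types (C D : code n) (u v c w : 'rV['F_2]_n) (s : seq ('I_n * 'I_n)).

Lemma wt0 : wt (0 : 'rV['F_2]_n) = 0%N.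
Proof. by apply/eqP; rewrite cards_eq0; apply/eqP/setP => i; rewrite !inE mxE eqxx. Qed.

Lemma wt_eq0 c : (wt c == 0%N) = (c == 0).
Proof.
apply/eqP/eqP => [/eqP|->]; last exact: wt0.
rewrite cards_eq0 => /eqP/setP c0; apply/rowP => i; rewrite mxE.
by move: (c0 i); rewrite !inE => /negbFE/eqP.
Qed.

Lemma wt_le c : (wt c <= n)%N.
Proof. by rewrite -[n in (_ <= n)%N]card_ord max_card. Qed.

Definition wpoly C s : {poly rat} := \sum_(c in C) harmonic s c *: 'X^(wt c).

Lemma coef_wpoly C s k : (wpoly C s)`_k = \sum_(c in codewords C k) harmonic s c.
Proof.
rewrite coef_sum [RHS](eq_bigl (fun c => (c \in C) && (wt c == k))); last first.
  by move=> c; rewrite inE.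
rewrite big_mkcondr; apply: eq_bigr => c _.
by rewrite coefZ coefXn eq_sym; case: eqP; rewrite ?mulr1 ?mulr0.
Qed.

Lemma horner_wpoly C s t : (wpoly C s).[t] = \sum_(c in C) harmonic s c * t ^+ wt c.
Proof. by rewrite horner_sum; apply: eq_bigr => c _; rewrite !hornerE. Qed.

(** Poisson summation for u |-> harmonic(u) t^(wt u).  The powers of 1 - t^2 and
    t come from the pairs, whose weight is constant on the support of the
    harmonic function: it is t before and (1 + t)(1 - t) after the transform.
    They are cross-multiplied so that no division is needed. *)
Lemma poisson_wt C w s t : uniq (points_of s) ->
  #|C|%:R * (1 - t ^+ 2) ^+ size s *
    (\sum_(u | u + w \in dual C) harmonic s u * t ^+ wt u) =
  (-2 * t) ^+ size s * \sum_(c in C)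
     sgn (inner c w) * (harmonic s c * ((1 + t) ^+ (n - wt c) * (1 - t) ^+ wt c)).
Proof.
move=> Us; pose g (_ : 'I_n) (a : 'F_2) := if a == 0 then 1 else t.
transitivity ((t * (1 - t ^+ 2)) ^+ size s *
    (#|C|%:R * \sum_(u | u + w \in dual C) pairprod g s u)).
  have -> : \sum_(u | u + w \in dual C) harmonic s u * t ^+ wt u =
      t ^+ size s * \sum_(u | u + w \in dual C) pairprod g s u.
    rewrite mulr_sumr; apply: eq_bigr => u _; rewrite -{2}(mul1r t).
    by rewrite pairprod_const // expr1n mulr1.
  by rewrite exprMn; ring.
rewrite poisson exprMn [(-2 * t) ^+ _]exprMn mulrC !mulr_suml !mulr_sumr.
apply: eq_bigr => c _; rewrite fourier_pairprod //.
have -> : pairprod (fourier1 g) s c =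
    pairprod (fun _ a => if a == 0 then 1 + t else 1 - t) s c.
  congr (_ * _); apply: eq_bigr => l _; rewrite /fourier1 /g eqxx oner_eq0.
  by case: (F2_cases (c ord0 l)) => ->; rewrite ?sgn0 ?sgn1 ?eqxx ?oner_eq0; ring.
rewrite (mulrA (harmonic s c)) -pairprod_const //.
have -> : (1 + t) * (1 - t) = 1 - t ^+ 2 by ring.
by ring.
Qed.

Lemma expr_cayley (t : rat) a b : 1 < t -> (b <= a)%N ->
  (1 + t) ^+ (a - b) * (1 - t) ^+ b = (1 + t) ^+ a * ((1 - t) / (1 + t)) ^+ b.
Proof.
move=> t1 ba; have tn0 : 1 + t != 0 by lra.
rewrite -[in RHS](subnK ba) exprD expr_div_n -!mulrA; congr (_ * _).
by rewrite mulrCA divff ?mulr1 // expf_neq0.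
Qed.

Lemma macwilliams C s (t : rat) : uniq (points_of s) -> 1 < t ->
  #|C|%:R * (1 - t ^+ 2) ^+ size s * (wpoly (dual C) s).[t] =
  (-2 * t) ^+ size s * (1 + t) ^+ n * (wpoly C s).[(1 - t) / (1 + t)].
Proof.
move=> Us t1; have := poisson_wt C 0 t Us.
rewrite !horner_wpoly; under eq_bigl do rewrite addr0.
move=> ->; rewrite -!mulrA; congr (_ * _); rewrite mulr_sumr; apply: eq_bigr => c _.
have -> : inner c 0 = 0 by rewrite /inner big1 // => i _; rewrite mxE mulr0.
by rewrite expr_cayley ?wt_le // sgn0 mul1r; ring.
Qed.

(** Poisson summation at t = 1, where only the zero word survives on the right. *)
Lemma card_dual C : (#|C| * #|dual C| = 2 ^ n)%N.
Proof.
apply/eqP; rewrite -(eqr_nat rat) natrM natrX; apply/eqP.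
have := @poisson_wt C 0 [::] 1 isT.
under eq_bigl do rewrite addr0.
rewrite /= !expr0 mulr1 mul1r subrr => h.
transitivity (#|C|%:R * (\sum_(u in dual C) harmonic [::] u * 1 ^+ wt u)).
  congr (_ * _); rewrite -sumr_const; apply: eq_bigr => u _.
  by rewrite /harmonic big_nil expr1n mulr1.
rewrite h (bigD1 0) ?mem0v //= big1 ?addr0.
  rewrite /inner big1 ?sgn0 => [|i _]; last by rewrite mxE mulr0.
  by rewrite /harmonic big_nil wt0 subn0 expr0 !mul1r mulr1.
by move=> c /andP[_ c0]; rewrite expr0n wt_eq0 (negPf c0) !mulr0.
Qed.

(** The inclusion is clear, and both sides have the same cardinality by
    [card_dual]. *)
Lemma dual_dual C : dual (dual C) = C.
Proof.
have sub : (C <= dual (dual C))%VS.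
  apply/subvP => c cC; apply/dualP => x /dualP xd; rewrite innerC; exact: xd.
apply/esym/vspaceP => c.
have c0 : (0 < #|dual C|)%N by apply/card_gt0P; exists 0; rewrite mem0v.
have cE : #|C| = #|dual (dual C)|.
  by apply/eqP; rewrite -(eqn_pmul2l c0) card_dual mulnC card_dual.
exact: (subset_cardP cE (introT subsetP (elimT subvP sub))).
Qed.

End WeightEnumerators.

(** * Polynomials invariant under the Cayley substitution *)

(** The substitution of the MacWilliams identities; it is an involution. *)
Definition cayley (t : rat) : rat := (1 - t) / (1 + t).

(** Functional equations are stated at points t > 1, away from the zeros of t,
    1 + t and 1 - t^2; infinitely many points suffice to identify polynomials. *)
Lemma poly_eq_gt1 (p q : {poly rat}) :
  (forall t, 1 < t -> p.[t] = q.[t]) -> p = q.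
Proof.
move=> pq; apply/eqP; rewrite -subr_eq0; apply/negP => /negP d0.
pose ts := [seq (i.+2)%:R | i <- iota 0 (size (p - q))] : seq rat.
have := max_poly_roots d0 (_ : all (root (p - q)) ts) (_ : uniq ts).
rewrite size_map size_iota ltnn => h; apply: notF; apply: h.
  apply/allP => _ /mapP[i _ ->]; rewrite /root hornerD hornerN pq ?subrr //.
  by rewrite ltr1n.
by rewrite map_inj_uniq ?iota_uniq // => i j /eqP; rewrite eqr_nat => /eqP[].
Qed.

Lemma gt1_neq0 (t : rat) : 1 < t -> [/\ t != 0, 1 + t != 0 & 1 - t ^+ 2 != 0].
Proof. by move=> t1; split; nra. Qed.

Lemma one_plus_cayley2 t : 1 < t -> (1 + t) ^+ 2 * (1 + cayley t ^+ 2) = 2 * (1 + t ^+ 2).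
Proof. by move=> t1; rewrite /cayley; field; lra. Qed.

Lemma one_minus_cayley2 t : 1 < t -> (1 + t) ^+ 2 * (1 - cayley t ^+ 2) = 4 * t.
Proof. by move=> t1; rewrite /cayley; field; lra. Qed.

Lemma horner_1pX2 (x : rat) : (1 + 'X^2).[x] = 1 + x ^+ 2.
Proof. by rewrite hornerD hornerXn -polyC1 hornerC. Qed.

Lemma horner_1mX2 (x : rat) : (1 - 'X^2).[x] = 1 - x ^+ 2.
Proof. by rewrite hornerD hornerN hornerXn -polyC1 hornerC. Qed.

(** The polynomial (1 + X)^D V((1 - X)/(1 + X)), see [horner_cayley_poly]. *)
Definition cayley_poly D (V : {poly rat}) : {poly rat} :=
  \sum_(i < D.+1) V`_i *: ((1 + 'X) ^+ (D - i) * (1 - 'X) ^+ i).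

Lemma horner_cayley_poly D (V : {poly rat}) t : (size V <= D.+1)%N -> 1 < t ->
  (cayley_poly D V).[t] = (1 + t) ^+ D * V.[cayley t].
Proof.
move=> sV t1; rewrite horner_sum (horner_coef_wide _ sV) mulr_sumr.
apply: eq_bigr => i _.
have [pE mE] : (1 + 'X).[t] = 1 + t /\ (1 - 'X).[t] = 1 - t by rewrite !hornerE.
by rewrite hornerZ hornerM !horner_exp pE mE expr_cayley 1?mulrCA // -ltnS.
Qed.

Lemma coprime_X_1mX2 a b :
  coprimep ('X^a : {poly rat}) ((1 - 'X^2) ^+ b).
Proof.
apply/coprimep_expl/coprimep_expr/Bezout_coprimepP; exists ('X, 1) => /=.
rewrite mul1r (_ : 'X * 'X + _ = 1) ?eqpxx //; ring.
Qed.

(** The functional equation says that k X^a V is (1 - X^2)^b times a polynomial,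
    and X is coprime to 1 - X^2. *)
Lemma cayley_dvd D a b (k : rat) (V : {poly rat}) : (size V <= D.+1)%N -> k != 0 ->
  (forall t, 1 < t ->
     k * t ^+ a * V.[t] = (1 - t ^+ 2) ^+ b * ((1 + t) ^+ D * V.[cayley t])) ->
  exists R, V = (1 - 'X^2) ^+ b * R.
Proof.
move=> sV k0 h; have e : k *: ('X^a * V) = (1 - 'X^2) ^+ b * cayley_poly D V.
  apply: poly_eq_gt1 => t t1.
  by rewrite hornerZ !hornerM hornerXn horner_exp horner_1mX2 horner_cayley_poly // mulrA h.
have : (1 - 'X^2) ^+ b %| 'X^a * V.
  by rewrite -(dvdpZr _ _ k0) e dvdp_mulr.
rewrite Gauss_dvdpr; last by rewrite coprimep_sym coprime_X_1mX2.
case/dvdpP=> R ->.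
by exists R; rewrite mulrC.
Qed.

(** Evenness as invariance under X |-> -X, a form that passes to cofactors. *)
Definition evenp (p : {poly rat}) : Prop := p \Po (- 'X) = p.

Lemma coef_compN (p : {poly rat}) i : (p \Po (- 'X))`_i = (-1) ^+ i * p`_i.
Proof.
elim/poly_ind: p i => [|p c IH] i; first by rewrite comp_poly0 !coef0 mulr0.
rewrite comp_polyD comp_polyM comp_polyX comp_polyC !coefD !coefC mulrN coefN.
rewrite !coefMX; case: i => [|i]; rewrite ?oppr0 ?mul1r //= IH exprS; ring.
Qed.

Lemma evenpP p : evenp p <-> (forall i, odd i -> p`_i = 0).
Proof.
split=> [pe i oi|h].
  by have := coef_compN p i; rewrite pe -signr_odd oi expr1; lra.
apply/polyP => i; rewrite coef_compN -signr_odd.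
by case: (boolP (odd i)) => [/h->|_]; rewrite ?mulr0 ?mul1r.
Qed.

Lemma evenp_mulKl p q : p != 0 -> evenp p -> evenp (p * q) -> evenp q.
Proof. by rewrite /evenp comp_polyM => p0 -> /(mulfI p0). Qed.

Lemma evenpX2 : evenp 'X^2.
Proof. by rewrite /evenp comp_Xn_poly sqrrN. Qed.

Lemma evenp_exp p k : evenp p -> evenp (p ^+ k).
Proof. by rewrite /evenp rmorphXn /= => ->. Qed.

Lemma size_1mX2 k : size ((1 - 'X^2 : {poly rat}) ^+ k) = (2 * k).+1.
Proof.
have s1 : size (1 - 'X^2 : {poly rat}) = 3.
  by rewrite -opprB size_polyN size_XnsubC.
have n0 : (1 - 'X^2 : {poly rat}) ^+ k != 0.
  by rewrite expf_neq0 // -size_poly_gt0 s1.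
have := size_exp (1 - 'X^2 : {poly rat}) k; rewrite s1.
by move: n0; rewrite -size_poly_gt0; case: (size _) => // ? _ /= ->.
Qed.

Lemma one_mX2_neq0 k : (1 - 'X^2 : {poly rat}) ^+ k != 0.
Proof. by rewrite -size_poly_gt0 size_1mX2. Qed.

Lemma evenp_1mX2 k : evenp ((1 - 'X^2) ^+ k).
Proof. by apply: evenp_exp; rewrite /evenp rmorphB rmorph1 /= evenpX2. Qed.

Lemma size_cofactor_1mX2 b N (R : {poly rat}) :
  (size (((1 - 'X^2) ^+ b)%R * R)%R <= 2 * b + N)%N -> (size R <= N)%N.
Proof.
have [->|R0] := eqVneq R 0; first by rewrite size_poly0.
by rewrite size_mul ?one_mX2_neq0 // size_1mX2 addSn /= leq_add2l.
Qed.

Lemma low_coefs_split a (p : {poly rat}) : (forall i, (i < a)%N -> p`_i = 0) ->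
  exists2 V, p = 'X^a * V & forall i, V`_i = p`_(i + a).
Proof.
move=> low; exists (drop_poly a p); last by move=> i; rewrite coef_drop_poly.
rewrite mulrC -[LHS](poly_take_drop a); rewrite (_ : take_poly a p = 0) ?add0r //.
by apply/polyP => i; rewrite coef_take_poly coef0; case: ltnP => // /low.
Qed.

(** The functional equation exchanges divisibility by X with divisibility by
    1 - X^2: writing p = X^(2m) V turns the factor t^(2m) on the right into
    (1 - t)^(2m) (1 + t)^(-2m), so by [cayley_dvd] the polynomial V of degree at
    most 4m is divisible by (1 - X^2)^(2m - k).  The cofactor R then has degree
    at most 2k and inherits a functional equation of its own. *)
Lemma enumerator_shape m k (p : {poly rat}) : (k <= 2 * m)%N ->
  (forall i, (i < 2 * m)%N -> p`_i = 0) -> (size p <= (6 * m).+1)%N -> evenp p ->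
  (forall t, 1 < t -> 2 ^+ (4 * m) * (1 - t ^+ 2) ^+ k * p.[t] =
     (-2 * t) ^+ k * (1 + t) ^+ (8 * m) * p.[cayley t]) ->
  exists R, [/\ p = 'X^(2 * m) * (1 - 'X^2) ^+ (2 * m - k) * R,
     (size R <= (2 * k).+1)%N, evenp R &
     forall t, 1 < t -> (-2) ^+ k * R.[t] = (1 + t) ^+ (2 * k) * R.[cayley t]].
Proof.
move=> k2m low sp ep h; have [V pE VE] := low_coefs_split low.
have sV : (size V <= (4 * m).+1)%N.
  apply/leq_sizeP => i li; rewrite VE; move/leq_sizeP: sp; apply; lia.
have eV : evenp V.
  apply: evenp_mulKl (_ : evenp ('X^(2 * m) * V)); rewrite -?pE ?monic_neq0 ?monicXn //.
  by rewrite exprM; apply/evenp_exp/evenpX2.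
have hV t : 1 < t -> 2 ^+ (4 * m) * t ^+ (2 * m - k) * V.[t] =
    (-2) ^+ k * ((1 - t ^+ 2) ^+ (2 * m - k) * ((1 + t) ^+ (4 * m) * V.[cayley t])).
  move=> t1; have [tn0 t1n0 mn0] := gt1_neq0 t1.
  have nz : t ^+ k * (1 - t ^+ 2) ^+ k != 0 by rewrite mulf_neq0 // expf_neq0.
  apply: (mulfI nz); have := h t t1; rewrite pE !hornerM !hornerXn => ht.
  transitivity (2 ^+ (4 * m) * (1 - t ^+ 2) ^+ k * (t ^+ (2 * m) * V.[t])).
    by rewrite -[in RHS](subnK k2m) exprD; ring.
  have split2m (x : rat) : x ^+ (2 * m) = x ^+ (2 * m - k) * x ^+ k.
    by rewrite -exprD subnK.
  have e8 : (1 + t) ^+ (8 * m) =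
      (1 + t) ^+ (4 * m) * (1 + t) ^+ (2 * m) * (1 + t) ^+ (2 * m).
    by rewrite -!exprD; congr (_ ^+ _); lia.
  have et : (1 + t) ^+ (2 * m) * cayley t ^+ (2 * m) = (1 - t) ^+ (2 * m).
    by rewrite -exprMn; congr (_ ^+ _); rewrite /cayley; field.
  have e2 j : (1 - t ^+ 2) ^+ j = (1 + t) ^+ j * (1 - t) ^+ j.
    by rewrite -exprMn; congr (_ ^+ _); ring.
  transitivity ((-2 * t) ^+ k * (1 + t) ^+ (4 * m) * (1 + t) ^+ (2 * m) *
     ((1 + t) ^+ (2 * m) * cayley t ^+ (2 * m)) * V.[cayley t]).
    by rewrite ht e8; ring.
  by rewrite et !e2 !split2m exprMn; ring.
have [||R VR] := @cayley_dvd (4 * m) (2 * m - k) (2 * m - k) (2 ^+ (4 * m) / (-2) ^+ k) V sV.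
  by rewrite mulf_neq0 ?invr_eq0 ?expf_neq0.
  move=> t t1; have n2 : (-2) ^+ k != 0 :> rat by rewrite expf_neq0.
  by apply: (mulfI n2); rewrite -hV //; field.
have eR : evenp R by apply: evenp_mulKl (one_mX2_neq0 (2 * m - k)) (evenp_1mX2 _) _; rewrite -VR.
exists R; split => //; first by rewrite pE {1}VR mulrA.
  apply: (@size_cofactor_1mX2 (2 * m - k)); rewrite -VR (leq_trans sV) //; lia.
move=> t t1; have := hV t t1; rewrite {}VR !hornerM !horner_exp.
rewrite !horner_1mX2 => {}hV.
have [tn0 t1n0 mn0] := gt1_neq0 t1.
have nz : 2 ^+ (4 * m) * t ^+ (2 * m - k) * (1 - t ^+ 2) ^+ (2 * m - k) != 0.
  by rewrite !mulf_neq0 // expf_neq0.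
apply: (mulfI nz); rewrite mulrCA -(mulrA _ _ R.[t]) [in LHS]hV.
have two : 2 ^+ (4 * m) = 4 ^+ k * 4 ^+ (2 * m - k) :> rat.
  by rewrite -exprD subnKC // (_ : 4 = 2 ^+ 2 :> rat) // -exprM; congr (_ ^+ _); lia.
rewrite (_ : (4 * m = 2 * (2 * m - k) + 2 * k)%N); last by lia.
transitivity ((-2) ^+ k * (-2) ^+ k * (1 - t ^+ 2) ^+ (2 * m - k) *
   ((1 + t) ^+ 2 * (1 - cayley t ^+ 2)) ^+ (2 * m - k) * (1 + t) ^+ (2 * k) * R.[cayley t]).
  by rewrite [((1 + t) ^+ 2 * _) ^+ _]exprMn -exprM exprD; ring.
have e4 : (-2) ^+ k * (-2) ^+ k = 4 ^+ k :> rat by rewrite -exprMn.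
rewrite one_minus_cayley2 // e4 [(4 * t) ^+ _]exprMn.
rewrite -(_ : (4 * m = 2 * (2 * m - k) + 2 * k)%N) ?two; last by lia.
by ring.
Qed.

Lemma cayley2 : cayley 2 = - 1 / 3. Proof. by rewrite /cayley; field. Qed.
Lemma cayley3 : cayley 3 = - 1 / 2. Proof. by rewrite /cayley; field. Qed.

Lemma horner_evenp (R : {poly rat}) x : (size R <= 5)%N -> evenp R ->
  R.[x] = R`_0 + R`_2 * x ^+ 2 + R`_4 * x ^+ 4.
Proof.
move=> sR /evenpP eR; rewrite (horner_coef_wide _ sR) !big_ord_recr big_ord0 /=.
by rewrite (eR 1%N) // (eR 3%N) //; ring.
Qed.

(** Here R = r0 + r2 X^2, and its functional equation at two points already
    forces r0 = r2 = 0. *)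
Lemma enumerator_deg1 m (p : {poly rat}) : (0 < m)%N ->
  (forall i, (i < 2 * m)%N -> p`_i = 0) -> (size p <= (6 * m).+1)%N -> evenp p ->
  (forall t, 1 < t -> 2 ^+ (4 * m) * (1 - t ^+ 2) ^+ 1 * p.[t] =
     (-2 * t) ^+ 1 * (1 + t) ^+ (8 * m) * p.[cayley t]) ->
  p = 0.
Proof.
move=> m0 low sp ep h; have [|R [-> sR eR hR]] := enumerator_shape _ low sp ep h.
  lia.
have sR5 : (size R <= 5)%N by apply: leq_trans sR _.
suff -> : R = 0 by rewrite mulr0.
have R4 : R`_4 = 0 by move/leq_sizeP: sR; apply.
have := hR 2 isT; have := hR 3 isT; rewrite !(horner_evenp _ sR5 eR).
rewrite R4 cayley3 cayley2 => h3 h2.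
have [R0 R2] : R`_0 = 0 /\ R`_2 = 0 by clear -h2 h3; move: (R`_0) (R`_2) h2 h3 => a b h2 h3; split; lra.
apply: poly_eq_gt1 => t _.
by rewrite (horner_evenp _ sR5 eR) R0 R2 R4 horner0; ring.
Qed.

(** Here R has the three coefficients r0, r2, r4, and its functional equation at
    two points forces r2 = 2 r0 and r4 = r0, that is R = r0 (1 + X^2)^2. *)
Lemma enumerator_deg2 m (p : {poly rat}) : (0 < m)%N ->
  (forall i, (i < 2 * m)%N -> p`_i = 0) -> (size p <= (6 * m).+1)%N -> evenp p ->
  (forall t, 1 < t -> 2 ^+ (4 * m) * (1 - t ^+ 2) ^+ 2 * p.[t] =
     (-2 * t) ^+ 2 * (1 + t) ^+ (8 * m) * p.[cayley t]) ->
  exists a, p = a *: ('X^(2 * m) * (((1 - 'X) ^+ (2 * m - 2) * (1 + 'X) ^+ 2) \Po 'X^2)).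
Proof.
move=> m0 low sp ep h; have [|R [-> sR eR hR]] := enumerator_shape _ low sp ep h.
  lia.
have sR5 : (size R <= 5)%N := sR.
exists R`_0; have := hR 2 isT; have := hR 3 isT; rewrite !(horner_evenp _ sR5 eR).
rewrite cayley3 cayley2 => h3 h2.
have [R2 R4] : R`_2 = 2 * R`_0 /\ R`_4 = R`_0 by clear -h2 h3; move: (R`_0) (R`_2) (R`_4) h2 h3 => a b c h2 h3; split; lra.
rewrite -mulrA scalerAr; congr (_ * _).
rewrite rmorphM !rmorphXn /= raddfB raddfD /= rmorph1 comp_polyX scalerAr; congr (_ * _).
apply: poly_eq_gt1 => t _.
rewrite (horner_evenp _ sR eR) R2 R4 hornerZ horner_exp horner_1pX2; ring.
Qed.

(** Gleason's theorem for even self-dual codes, in the non-homogeneous form of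
    length 8m.  Subtracting p(0) (1 + X^2)^(4m) leaves an invariant polynomial q
    with q(0) = 0.  Since the constant and the leading coefficient of its Cayley
    transform are q(1) and q(-1), which agree by evenness, the coefficient of
    X^(8m) vanishes as well.  Hence q = X^2 V with deg V at most 8m - 4, the
    functional equation makes V divisible by (1 - X^2)^2, and the cofactor is
    invariant for length 8(m - 1). *)
Lemma gleason m (p : {poly rat}) : (size p <= (8 * m).+1)%N -> evenp p ->
  (forall t, 1 < t -> 2 ^+ (4 * m) * p.[t] = (1 + t) ^+ (8 * m) * p.[cayley t]) ->
  exists a : nat -> rat, p =
   \sum_(i < m.+1) a i *: ((1 + 'X^2) ^+ (4 * (m - i)) *
                          ('X^2 ^+ i * (1 - 'X^2) ^+ (2 * i))).
Proof.
elim: m p => [|m IH] p sp ep h.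
  exists (fun=> p`_0); rewrite big_ord1 /= !expr0 !mulr1.
  by rewrite [LHS](size1_polyC sp) alg_polyC.
pose f : {poly rat} := (1 + 'X^2) ^+ (4 * m.+1).
pose q := p - p`_0 *: f.
have fE x : f.[x] = (1 + x ^+ 2) ^+ (4 * m.+1).
  by rewrite /f horner_exp horner_1pX2.
have sf : (size f <= (8 * m.+1).+1)%N.
  rewrite (leq_trans (size_poly_exp_leq _ _)) //.
  by rewrite addrC size_XnaddC // ; lia.
have sq : (size q <= (8 * m.+1).+1)%N.
  by rewrite (leq_trans (size_polyD _ _)) // geq_max sp size_polyN (leq_trans (size_scale_leq _ _)).
have ef : evenp f by apply: evenp_exp; rewrite /evenp raddfD /= rmorph1 evenpX2.
have eq : evenp q by rewrite /evenp raddfB /= linearZ /= ep ef.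
have qv x : q.[x] = p.[x] - p`_0 * (1 + x ^+ 2) ^+ (4 * m.+1).
  by rewrite hornerD hornerN hornerZ fE.
have hq t : 1 < t -> 2 ^+ (4 * m.+1) * q.[t] = (1 + t) ^+ (8 * m.+1) * q.[cayley t].
  move=> t1; rewrite !qv !mulrBr h //; congr (_ - _).
  rewrite mulrCA [RHS]mulrCA; congr (_ * _).
  rewrite -exprMn -one_plus_cayley2 // exprMn -exprM; congr (_ ^+ _ * _); lia.
have q0 : q`_0 = 0.
  by rewrite -horner_coef0 qv horner_coef0 expr0n /= addr0 expr1n mulr1 subrr.
(* The leading coefficient, read off the Cayley transform at -1 and 1. *)
have qtop : q`_(8 * m.+1) = 0.
  have e : 2 ^+ (4 * m.+1) *: q = cayley_poly (8 * m.+1) q.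
    by apply: poly_eq_gt1 => t t1; rewrite horner_cayley_poly // hornerZ hq.
  have q1 : q.[-1] = q.[1].
    by rewrite -[in LHS]eq horner_comp hornerN hornerX opprK.
  have bot : (cayley_poly (8 * m.+1) q)`_0 = q.[1].
    rewrite -horner_coef0 horner_sum (horner_coef_wide _ sq).
    apply: eq_bigr => i _; rewrite hornerZ hornerM !horner_exp !(hornerD, hornerN, hornerX) -polyC1 !hornerC.
    by rewrite oppr0 addr0 !expr1n mulr1.
  have top : (cayley_poly (8 * m.+1) q)`_(8 * m.+1) = q.[-1].
    rewrite coef_sum (horner_coef_wide _ sq); apply: eq_bigr => i _.
    rewrite coefZ; congr (_ * _).
    have -> : (1 - 'X : {poly rat}) = (-1) *: ('X - 1%:P).
      by rewrite scaleN1r opprB.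
    rewrite exprZn -scalerAr coefZ -[RHS]mulr1; congr (_ * _).
    have -> : 1 + 'X = 'X - (-1)%:P :> {poly rat} by rewrite polyCN opprK addrC.
    set g := _ * _; have gm : g \is monic by rewrite monicMl ?monic_exp ?monicXsubC.
    suff sg : size g = (8 * m.+1).+1 by have := monicP gm; rewrite lead_coefE sg.
    rewrite size_Mmonic ?monic_exp ?monicXsubC // -?size_poly_eq0 !size_exp_XsubC //.
    by rewrite addnS /= addSn subnK // -ltnS.
  have := congr1 (fun r : {poly rat} => (r`_(8 * m.+1), r`_0)) e.
  rewrite top bot q1 !coefZ q0 mulr0 => -[+ e1].
  by rewrite -e1 => /eqP; rewrite mulf_eq0 expf_eq0 => /eqP.
have [|V qE VE] := @low_coefs_split 2 q.
  by case=> [|[|//]] // _; move/evenpP: eq; apply.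
have sV : (size V <= (8 * m).+1 + 4)%N.
  apply/leq_sizeP => i li; rewrite VE.
  have [le|gt] := leqP (i + 2) (8 * m.+1); last by move/leq_sizeP: sq; apply.
  have [->|] := eqVneq (i + 2)%N (8 * m.+1)%N; first exact: qtop.
  by move/evenpP: eq => eq ne; apply: eq; lia.
have eV : evenp V.
  apply: evenp_mulKl (_ : evenp ('X^2 * V)); rewrite -?qE ?monic_neq0 ?monicXn //.
  exact: evenpX2.
have hV t : 1 < t -> 2 ^+ (4 * m.+1) * t ^+ 2 * V.[t] =
    (1 - t ^+ 2) ^+ 2 * ((1 + t) ^+ (8 * m + 4) * V.[cayley t]).
  have qV x : q.[x] = x ^+ 2 * V.[x] by rewrite qE hornerM hornerXn.
  move=> t1; rewrite -mulrA -qV hq // qV /cayley.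
  rewrite (_ : (8 * m.+1 = 8 * m + 4 + 4)%N); last by lia.
  by rewrite exprD; field; have [_ ->] := gt1_neq0 t1.
have n0 : 2 ^+ (4 * m.+1) != 0 :> rat by apply: expf_neq0.
have sV' : (size V <= (8 * m + 4).+1)%N by rewrite -addSn.
have [R VR] := cayley_dvd sV' n0 hV.
have eR : evenp R.
  by apply: evenp_mulKl (one_mX2_neq0 2) (evenp_1mX2 _) _; rewrite -VR.
have sR : (size R <= (8 * m).+1)%N.
  by apply: (@size_cofactor_1mX2 2); rewrite -VR addnC.
have [t t1|a aE] := IH R sR eR.
  have [tn0 t1n0 mn0] := gt1_neq0 t1.
  have Vv x : V.[x] = (1 - x ^+ 2) ^+ 2 * R.[x].
    by rewrite VR hornerM horner_exp horner_1mX2.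
  have := hV t t1; rewrite !Vv => hRt.
  have nz : 16 * (t ^+ 2 * (1 - t ^+ 2) ^+ 2) != 0 by rewrite !mulf_neq0 // expf_neq0.
  apply: (mulfI nz); transitivity (2 ^+ (4 * m.+1) * t ^+ 2 * ((1 - t ^+ 2) ^+ 2 * R.[t])).
    by rewrite (_ : (4 * m.+1 = 4 + 4 * m)%N) ?exprD; [ring | lia].
  rewrite hRt exprD; transitivity ((1 - t ^+ 2) ^+ 2 * (1 + t) ^+ (8 * m) *
    ((1 + t) ^+ 2 * (1 - cayley t ^+ 2)) ^+ 2 * R.[cayley t]); first by ring.
  by rewrite one_minus_cayley2 //; ring.
exists (fun i => if i is j.+1 then a j else p`_0).
rewrite big_ord_recl /= subn0 !expr0 !mulr1 -/f -[LHS](subrK (p`_0 *: f)) -/q addrC.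
congr (_ + _); rewrite qE VR aE !mulr_sumr; apply: eq_bigr => i _.
rewrite /= subSS -!scalerAr; congr (_ *: _).
by rewrite mulnS exprD [X in _ = _ * (X * _)]exprS; ring.
Qed.

(** * Near-extremal even formally self-dual codes *)

Section Words.
Variable n : nat.
Implicit Types (C : code n) (c : 'rV['F_2]_n) (s : seq ('I_n * 'I_n)).

Definition ones : 'rV['F_2]_n := const_mx 1.

Lemma wt_ones : wt ones = n.
Proof.
rewrite -[RHS]card_ord /wt; apply: eq_card => i.
by rewrite !inE mxE oner_eq0.
Qed.

Lemma wt_addones c : wt (c + ones) = (n - wt c)%N.
Proof.
have := cardsC (supp c); rewrite -/(wt c) card_ord => e.
have -> : wt (c + ones) = #|~: supp c|; last lia.
apply: eq_card => i; rewrite !inE !mxE.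
by case: (F2_cases (c ord0 i)) => ->; rewrite ?add0r ?F2_addrr eqxx oner_eq0.
Qed.

Lemma F2_nat_eq0 k : (k%:R == 0 :> 'F_2) = ~~ odd k.
Proof.
elim: k => //= k; rewrite -natr1 negbK.
by case: (F2_cases k%:R) => -> e; rewrite ?add0r ?F2_addrr; case: (odd k) e.
Qed.

Lemma inner_ones c : inner ones c = (wt c)%:R.
Proof.
rewrite /inner (bigID (mem (supp c))) /= addrC big1 => [|i]; last first.
  by rewrite inE negbK => /eqP->; rewrite mulr0.
rewrite add0r (eq_bigr (fun=> 1)) ?sumr_const // => i; rewrite inE !mxE mul1r.
by case: (F2_cases (c ord0 i)) => ->.
Qed.

Lemma ones_in_dual C : even_code C -> ones \in dual C.
Proof.
move=> eC; apply/dualP => c /eC; rewrite inner_ones dvdn2.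
by rewrite -F2_nat_eq0 => /eqP.
Qed.

(** The inner product of a word with itself is the parity of its weight. *)
Lemma self_dual_even C : self_dual C -> even_code C.
Proof.
move=> sd c cC; rewrite dvdn2 -F2_nat_eq0; apply/eqP.
have /dualP/(_ c cC) : c \in dual C by rewrite -sd.
rewrite -inner_ones => <-; apply: eq_bigr => i _; rewrite mxE mul1r.
by case: (F2_cases (c ord0 i)) => ->; rewrite ?mulr0 ?mulr1.
Qed.

Lemma min_distance_le C d c : min_distance C d -> c \in C -> c != 0 -> (d <= wt c)%N.
Proof. by move=> [_ h] cC c0; have := h c 0 cC (mem0v _) c0; rewrite subr0. Qed.

Lemma min_distance_word C d : min_distance C d -> exists c, c \in codewords C d.
Proof. by move=> [[x [y [xC yC _ <-]]] _]; exists (x - y); rewrite inE rpredB ?eqxx. Qed.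

Lemma harmonic0 s : s != [::] -> harmonic s 0 = 0.
Proof. by case: s => // e s _; rewrite /harmonic big_cons !mxE eqxx subrr mul0r. Qed.

Lemma harmonic_ones s : s != [::] -> harmonic s ones = 0.
Proof. by case: s => // e s _; rewrite /harmonic big_cons !mxE subrr mul0r. Qed.

Lemma harmonic_nil c : harmonic [::] c = 1.
Proof. by rewrite /harmonic big_nil. Qed.

Lemma coef_wpoly_nil C k : (wpoly C [::])`_k = #|codewords C k|%:R.
Proof. by rewrite coef_wpoly -sumr_const; apply: eq_bigr => c _; rewrite harmonic_nil. Qed.

Lemma wpoly_nil1 C : (wpoly C [::]).[1] = #|C|%:R.
Proof.
rewrite horner_wpoly -sumr_const; apply: eq_bigr => c _.
by rewrite harmonic_nil mul1r expr1n.
Qed.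

Lemma formally_self_dual_card C : formally_self_dual C -> #|C| = #|dual C|.
Proof.
move=> fsd; apply/eqP; rewrite -(eqr_nat rat) -!wpoly_nil1; apply/eqP; congr (_.[1]).
by apply/polyP => k; rewrite !coef_wpoly_nil fsd.
Qed.

Lemma size_wpoly C s : (size (wpoly C s) <= n.+1)%N.
Proof.
apply/leq_sizeP => k nk; rewrite coef_wpoly big1 // => c; rewrite inE => /andP[_ /eqP wk].
by have := wt_le c; rewrite wk; lia.
Qed.

Lemma evenp_wpoly C s : even_code C -> evenp (wpoly C s).
Proof.
move=> eC; apply/evenpP => k ok; rewrite coef_wpoly big1 // => c.
by rewrite inE => /andP[/eC + /eqP wk]; rewrite wk dvdn2 ok.
Qed.

End Words.

Section FSD.
Variables (n m : nat) (C : code n).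
Hypotheses (nE : n = (8 * m)%N) (m0 : (0 < m)%N) (neC : near_extremal_even_fsd C).
Implicit Types (D : code n) (c : 'rV['F_2]_n) (s : seq ('I_n * 'I_n)).

Let evC : even_code C. Proof. by case: neC. Qed.
Let fsd : formally_self_dual C. Proof. by case: neC. Qed.

Lemma fsd_card : #|C| = (2 ^ (4 * m))%N.
Proof.
have e : (2 ^ n = (2 ^ (4 * m)) ^ 2)%N by rewrite -expnM nE; congr (_ ^ _)%N; lia.
have := card_dual C; rewrite -formally_self_dual_card // e mulnn => /eqP.
by rewrite eqn_exp2r // => /eqP.
Qed.

Lemma fsd_dual_even : even_code (dual C).
Proof.
move=> c cD; have : (0 < #|codewords (dual C) (wt c)|)%N.
  by apply/card_gt0P; exists c; rewrite inE cD eqxx.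
rewrite -fsd => /card_gt0P[x]; rewrite inE => /andP[xC /eqP <-]; exact: evC.
Qed.

(** What is left of near-extremality for a code and its dual alike: by symmetry
    under complementation the weights other than 0 and n lie in [2m, 6m]. *)
Definition gapped D := [/\ even_code D, ones n \in D &
  forall c, c \in D -> c != 0 -> (2 * m <= wt c)%N].

Lemma fsd_gapped : gapped C.
Proof.
have [_ _ ne] := neC; split=> // [|c].
  by rewrite -[C]dual_dual; apply/ones_in_dual/fsd_dual_even.
have e : (n %/ 8 = m)%N by rewrite nE mulKn.
by have := @min_distance_le _ C _ c ne; rewrite e.
Qed.

Lemma fsd_dual_gapped : gapped (dual C).
Proof.
have [_ _ ne] := fsd_gapped; split; [exact: fsd_dual_even|exact: ones_in_dual|].
move=> c cD c0; have : (0 < #|codewords (dual C) (wt c)|)%N.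
  by apply/card_gt0P; exists c; rewrite inE cD eqxx.
rewrite -fsd => /card_gt0P[x]; rewrite inE => /andP[xC /eqP wx].
by rewrite -wx; apply: ne => //; rewrite -wt_eq0 wx wt_eq0.
Qed.

Lemma gapped_range D c : gapped D -> c \in D -> c != 0 -> c != ones n ->
  (2 * m <= wt c <= 6 * m)%N.
Proof.
move=> [_ oD ne] cD c0 c1; rewrite ne //=.
have := ne (c + ones n) (rpredD cD oD).
rewrite wt_addones => h; suff : (2 * m <= n - wt c)%N by move: nE; lia.
apply: h; apply: contraNneq c1 => /eqP; rewrite addr_eq0 => /eqP->.
by apply/eqP/rowP => i; rewrite !mxE; apply/val_inj.
Qed.

Lemma gapped_coef D s k : gapped D -> s != [::] -> (k < 2 * m)%N || (6 * m < k)%N ->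
  (wpoly D s)`_k = 0.
Proof.
move=> nD sn hk; rewrite coef_wpoly big1 // => c; rewrite inE => /andP[cD /eqP wk].
have [->|c0] := eqVneq c 0; first exact: harmonic0.
have [->|c1] := eqVneq c (ones n); first exact: harmonic_ones.
by have := gapped_range nD cD c0 c1; lia.
Qed.

(** The sum over the code and its dual is what the MacWilliams identity maps to
    itself when the code is only formally self-dual. *)
Definition union_wpoly s : {poly rat} := wpoly C s + wpoly (dual C) s.

Lemma union_wpoly_even s : evenp (union_wpoly s).
Proof.
apply/evenpP => i oi; rewrite coefD; have /evenpP -> // := evenp_wpoly s evC.
by have /evenpP -> // := evenp_wpoly s fsd_dual_even; rewrite addr0.
Qed.

Lemma union_wpoly_low s k : s != [::] -> (k < 2 * m)%N -> (union_wpoly s)`_k = 0.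
Proof.
move=> sn hk; rewrite coefD (gapped_coef fsd_gapped) ?hk //.
by rewrite (gapped_coef fsd_dual_gapped) ?hk ?addr0.
Qed.

Lemma union_wpoly_size s : s != [::] -> (size (union_wpoly s) <= (6 * m).+1)%N.
Proof.
move=> sn; apply/leq_sizeP => k hk; rewrite coefD (gapped_coef fsd_gapped) ?hk ?orbT //.
by rewrite (gapped_coef fsd_dual_gapped) ?hk ?orbT ?addr0.
Qed.

(** The identities of [macwilliams] for C and for its dual are exchanged. *)
Lemma union_wpoly_cayley s t : uniq (points_of s) -> 1 < t ->
  2 ^+ (4 * m) * (1 - t ^+ 2) ^+ size s * (union_wpoly s).[t] =
     (-2 * t) ^+ size s * (1 + t) ^+ (8 * m) * (union_wpoly s).[cayley t].
Proof.
move=> Us t1; have := macwilliams C Us t1; have := macwilliams (dual C) Us t1.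
have e : (1 + t) ^+ n = (1 + t) ^+ (8 * m) by congr (_ ^+ _).
rewrite dual_dual -formally_self_dual_card // fsd_card natrX e !hornerD !mulrDr.
by move=> -> ->; rewrite addrC.
Qed.

Definition union_sum s k : rat :=
  \sum_(c in codewords C k) harmonic s c + \sum_(c in codewords (dual C) k) harmonic s c.

Lemma union_sumE s k : union_sum s k = (union_wpoly s)`_k.
Proof. by rewrite coefD !coef_wpoly. Qed.

Lemma fsd_deg1 i j k : i != j -> union_sum [:: (i, j)] k = 0.
Proof.
move=> ij; rewrite union_sumE; have Us : uniq (points_of [:: (i, j)]) by rewrite /= inE ij.
rewrite (@enumerator_deg1 m (union_wpoly [:: (i, j)])) ?coef0 //.
- by move=> l; apply: union_wpoly_low.
- exact: union_wpoly_size.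
- exact: union_wpoly_even.
- by move=> t; apply: union_wpoly_cayley.
Qed.

(** The value at 2m - 2 of the Krawtchouk polynomial of degree j for length 2m. *)
Definition kraw2 j : rat := ((1 - 'X) ^+ (2 * m - 2) * (1 + 'X) ^+ 2 : {poly rat})`_j.

(** The multiplier a depends on the two pairs only, not on the weight; this is
    what lets one weight inform about another. *)
Lemma fsd_deg2 i j k l : uniq [:: i; j; k; l] ->
  exists a, forall r, union_sum [:: (i, j); (k, l)] (2 * m + 2 * r) = a * kraw2 r.
Proof.
move=> Us; have [||||a h] := @enumerator_deg2 m (union_wpoly [:: (i, j); (k, l)]) m0.
- by move=> r; apply: union_wpoly_low.
- exact: union_wpoly_size.
- exact: union_wpoly_even.
- by move=> t; apply: union_wpoly_cayley.
exists a => r; rewrite union_sumE h coefZ coefXnM ltnNge leq_addr /= addKn.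
by rewrite coef_comp_poly_Xn // dvdn_mulr // mulKn.
Qed.

End FSD.

(** * Designs and differences of point indicators *)

Section DesignCriteria.
Variable T : finType.
Implicit Types (B : seq {set T}) (A b : {set T}) (t k : nat).

Definition cover_count B A : nat := count (fun b : {set T} => A \subset b) B.

Lemma cover_countE B A : (cover_count B A)%:R = \sum_(b <- B) (A \subset b)%:R :> rat.
Proof. by rewrite /cover_count -sum1_count natr_sum big_mkcond; apply: eq_bigr => b _; case: ifP. Qed.

(** Double counting of the pairs (x, b) with b a block through A and x in b
    outside A. *)
Lemma count_extensions B A k : all (fun b : {set T} => #|b| == k) B ->
  (\sum_(x | x \notin A) cover_count B (x |: A) = (k - #|A|) * cover_count B A)%N.
Proof.
move=> Bk; rewrite /cover_count -sum1_count big_distrr /=.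
transitivity (\sum_(x | x \notin A) \sum_(b <- B | (x |: A) \subset b) 1)%N.
  by apply: eq_bigr => x _; rewrite sum1_count.
rewrite (exchange_big_dep (fun b : {set T} => A \subset b)) /=; last first.
  by move=> x b _; rewrite subUset => /andP[].
rewrite big_seq_cond [RHS]big_seq_cond; apply: eq_bigr => b /andP[bB Ab].
rewrite muln1 sum1_card -(eqP (allP Bk b bB)).
have -> : (#|b| - #|A| = #|b :\: A|)%N by rewrite cardsDS.
by apply: eq_card => x; rewrite [LHS]unfold_in /= subUset sub1set Ab !inE andbT.
Qed.

Lemma is_design_pred t v k l B : is_design t.+1 v k l B ->
  is_design t v k ((v - t) * l %/ (k - t)) B.
Proof.
case/and4P=> /eqP Tv tk Bk /forallP h; apply/and4P; split=> //; try lia.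
apply/forallP => A; apply/implyP => /eqP At; have := count_extensions A Bk.
rewrite (eq_bigr (fun=> l)) => [|x xA]; last first.
  by have /implyP/(_ _)/eqP := h (x |: A); apply; rewrite cardsU1 xA At.
rewrite sum_nat_const (_ : #|_| = v - t)%N => [|]; last first.
  have := cardsC A; rewrite -Tv At => e; have -> : #|(fun x => x \notin A)| = #|~: A|.
    by apply: eq_card => x; rewrite !inE.
  lia.
by rewrite At => ->; rewrite mulKn ?subn_gt0.
Qed.

Lemma t_design_mono t t' B : (t' <= t)%N -> t_design t B -> t_design t' B.
Proof.
elim: t => [|t IH]; first by rewrite leqn0 => /eqP->.
rewrite leq_eqVlt => /predU1P[-> //|]; rewrite ltnS => /IH{}IH.
by case/t_designP=> k [l /is_design_pred d]; apply/IH/t_designP; exists k; eexists; exact: d.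
Qed.

Definition bdiff (x y : T) b : rat := (x \in b)%:R - (y \in b)%:R.

(** The sum of differences is the difference of the numbers of blocks through x
    and through y. *)
Lemma design1_criterion B k : (0 < k)%N -> all (fun b : {set T} => #|b| == k) B ->
  (forall x y, x != y -> \sum_(b <- B) bdiff x y b = 0) -> t_design 1 B.
Proof.
move=> k0 Bk h; apply/t_designP; exists k.
have [x0 _|T0] := pickP (mem T); last first.
  exists 0%N; apply/and4P; split=> //; apply/forallP => A; apply/implyP => /cards1P[x].
  by have := T0 x.
exists (cover_count B [set x0]); apply/and4P; split=> //.
apply/forallP => A; apply/implyP => /cards1P[x ->{A}].
have [->//|xx] := eqVneq x x0.
rewrite -/(cover_count _ _) -(eqr_nat rat) -subr_eq0 !cover_countE -sumrB.
by rewrite -[X in _ == X](h x x0 xx); apply/eqP/eq_bigr => b _; rewrite !sub1set.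
Qed.

Lemma cover_count_pair B x y :
  (cover_count B [set x; y])%:R = \sum_(b <- B) (x \in b)%:R * (y \in b)%:R :> rat.
Proof.
rewrite cover_countE; apply: eq_bigr => b _.
by rewrite subUset !sub1set; do 2!case: (_ \in b); rewrite ?mulr1 ?mulr0.
Qed.

Lemma sum_bdiff2 B x y z u :
  \sum_(b <- B) bdiff x y b * bdiff z u b =
  (cover_count B [set x; z])%:R - (cover_count B [set x; u])%:R
  - (cover_count B [set y; z])%:R + (cover_count B [set y; u])%:R.
Proof.
rewrite !cover_count_pair -!sumrB -big_split /=; apply: eq_bigr => b _.
by rewrite /bdiff; ring.
Qed.

Lemma pair_sum B x k : all (fun b : {set T} => #|b| == k) B ->
  (\sum_(y | y != x) cover_count B [set x; y] = (k - 1) * cover_count B [set x])%N.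
Proof.
move=> Bk; have := count_extensions [set x] Bk; rewrite cards1 => <-.
apply: eq_big => y; first by rewrite inE.
by move=> _; rewrite setUC.
Qed.

(** Let N x y be the number of blocks through x and y.  The second hypothesis
    says N x z - N y z = N x u - N y u for all z, u outside {x, y}, so this
    difference is a constant depending on x and y only.  Summed over all such z
    it vanishes, because in a 1-design the sum of N x z over z != x is the same
    for all x.  Hence N x z = N y z, and N is constant on pairs. *)
Lemma design2_criterion B k : (1 < k)%N -> (3 < #|T|)%N ->
  all (fun b : {set T} => #|b| == k) B ->
  (forall x y, x != y -> \sum_(b <- B) bdiff x y b = 0) ->
  (forall x y z u, uniq [:: x; y; z; u] ->
     \sum_(b <- B) bdiff x y b * bdiff z u b = 0) -> t_design 2 B.
Proof.
move=> k1 T4 Bk h1 h2; pose N x y : rat := (cover_count B [set x; y])%:R.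
have NC x y : N x y = N y x by rewrite /N setUC.
have Nx x y : x != y -> \sum_(z | z != x) N x z = \sum_(z | z != y) N y z.
  move=> xy; rewrite -!natr_sum !(pair_sum _ Bk) !natrM; congr (_ * _).
  apply/eqP; rewrite -subr_eq0 !cover_countE -sumrB -[X in _ == X](h1 x y xy).
  by apply/eqP/eq_bigr => b _; rewrite !sub1set.
have step x y z : uniq [:: x; y; z] -> N x z = N y z.
  rewrite /= !inE negb_or andbT => /andP[/andP[xy xz] yz].
  have cst u : u != x -> u != y -> N x u - N y u = N x z - N y z.
    move=> ux uy; have [->//|uz] := eqVneq u z.
    have := h2 x y z u; rewrite sum_bdiff2 -/(N x z) -/(N x u) -/(N y z) -/(N y u).
    rewrite /= !inE !negb_or xy xz yz !(eq_sym _ u) ux uy uz => /(_ isT); lra.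
  have e : (#|[pred u | (u != x) && (u != y)]|)%:R * (N x z - N y z) = 0.
    rewrite -sumr_const mulr_suml.
    transitivity (\sum_(u | (u != x) && (u != y)) (N x u - N y u)).
      by apply: eq_bigr => u /andP[ux uy]; rewrite mul1r cst.
    have := Nx x y xy; rewrite (bigD1 y) 1?eq_sym //= [RHS](bigD1 x) //= (NC y x).
    move=> /addrI e; rewrite sumrB e; apply/eqP; rewrite subr_eq0; apply/eqP.
    by apply: eq_bigl => u; rewrite andbC.
  move/eqP: e; rewrite mulf_eq0 pnatr_eq0 => /orP[/eqP e|]; last by rewrite subr_eq0 => /eqP.
  have := cardC (pred2 x y); have -> : #|predC (pred2 x y)| = 0%N.
    by rewrite -e; apply: eq_card => u; rewrite !inE negb_or.
  by rewrite card2 xy; lia.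
have all_eq x y z u : x != y -> z != u -> N x y = N z u.
  move=> xy zu.
  have exch p q r : p != q -> r != p -> N p q = N p r.
    move=> pq rp; have [->//|qr] := eqVneq q r.
    rewrite !(NC p); apply: step.
    by rewrite /= !inE negb_or qr rp eq_sym pq.
  have [zx|zx] := eqVneq z x; first by subst z; apply: exch => //; rewrite eq_sym.
  have [yz|yz] := eqVneq y z.
    by subst z; rewrite NC; apply: exch; rewrite eq_sym.
  by rewrite (exch x y z) // NC; apply: exch => //; rewrite eq_sym.
have [x [y xy]] : exists x y : T, x != y.
  have /card_gt1P[x [y [_ _ xy]]] : (1 < #|T|)%N by lia.
  by exists x, y.
apply/t_designP; exists k, (cover_count B [set x; y]); apply/and4P; split=> //.
apply/forallP => A; apply/implyP => /cards2P[z [u [zu ->]]].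
by rewrite -/(cover_count _ _) -(eqr_nat rat); apply/eqP/all_eq.
Qed.

(** The four numbers of blocks in [sum_bdiff2] are equal and cancel. *)
Lemma design2_sum0 B x y z u : t_design 2 B -> uniq [:: x; y; z; u] ->
  \sum_(b <- B) bdiff x y b * bdiff z u b = 0.
Proof.
case/t_designP=> k [l /and4P[_ _ _ /forallP h]].
have {}h p q : p != q -> cover_count B [set p; q] = l.
  by move=> pq; have /implyP/(_ _)/eqP := h [set p; q]; apply; rewrite cards2 pq.
rewrite sum_bdiff2 /= !inE !negb_or => /and4P[/and3P[_ xz xu] /andP[yz yu] _ _].
by rewrite !h //; ring.
Qed.

(** Double counting of the ordered pairs of distinct points inside blocks. *)
Lemma design2_count B k l : is_design 2 #|T| k l B -> (0 < #|T|)%N ->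
  (l * (#|T| * (#|T| - 1)) = size B * (k * (k - 1)))%N.
Proof.
move=> d T0; have /and4P[_ k1 Bk /forallP h] := d.
have hl x : ((#|T| - 1) * l = (k - 1) * cover_count B [set x])%N.
  rewrite -(pair_sum x Bk) (eq_bigr (fun=> l)) => [|y yx].
    rewrite sum_nat_const; congr (_ * _)%N.
    have := cardC1 x; rewrite -subn1 => <-; apply: eq_card => y; by rewrite !inE.
  by have /implyP/(_ _)/eqP := h [set x; y]; apply; rewrite cards2 (eq_sym x) yx.
have e : (\sum_x cover_count B [set x] = k * size B)%N.
  have := count_extensions set0 Bk; rewrite cards0 subn0 => e.
  rewrite (_ : size B = cover_count B set0); last first.
    by apply/eqP; rewrite eq_sym -all_count; apply/allP => b _; rewrite sub0set.
  by rewrite -e; apply: eq_big => x; rewrite ?inE // setU0.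
transitivity (\sum_(x : T) (#|T| - 1) * l)%N.
  by rewrite sum_nat_const mulnC -mulnA.
rewrite (eq_bigr (fun x => (k - 1) * cover_count B [set x])%N) => [|x _]; last exact: hl.
by rewrite -big_distrr /= e; lia.
Qed.

End DesignCriteria.

Lemma coef_1mX_exp M j : ((1 - 'X) ^+ M : {poly rat})`_j = (-1) ^+ j * 'C(M, j)%:R.
Proof.
elim: M j => [|M IH] j.
  by rewrite expr0 coef1 bin0n; case: j => [|j]; rewrite ?mulr0 ?mulr1.
rewrite exprSr mulrBr mulr1 coefB coefMX; case: j => [|j] /=.
  by rewrite IH !bin0 subr0.
by rewrite !IH binS natrD exprS; ring.
Qed.

(** The coefficient of z^j in z^i (1 + z)^M. *)
Definition bin_shift M j i : nat := if (i <= j)%N then 'C(M, j - i) else 0.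

Lemma kraw2E m j : kraw2 m j = (-1) ^+ j *
  ('C(2 * m - 2, j)%:R + (bin_shift (2 * m - 2) j 2)%:R
   - 2 * (bin_shift (2 * m - 2) j 1)%:R).
Proof.
rewrite /kraw2; set M := (2 * m - 2)%N.
have -> : (1 - 'X) ^+ M * (1 + 'X) ^+ 2 = (1 - 'X) ^+ M +
    ((1 - 'X) ^+ M * 'X) *+ 2 + (1 - 'X) ^+ M * 'X * 'X :> {poly rat} by ring.
rewrite !(coefD, coefMn, coefMX) /bin_shift.
by case: j => [|[|j]] /=; rewrite ?coef_1mX_exp ?subn0 ?subn1 ?subn2 /= ?exprS; ring.
Qed.

(** Turns the vanishing of the coefficient into a computation on naturals. *)
Lemma kraw2_eq0 m j : (kraw2 m j == 0) =
  ('C(2 * m - 2, j) + bin_shift (2 * m - 2) j 2 == 2 * bin_shift (2 * m - 2) j 1)%N.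
Proof.
by rewrite kraw2E mulf_eq0 signr_eq0 /= subr_eq0 -natrD -natrM eqr_nat.
Qed.

Section Blocks.
Variables (n m : nat) (C : code n).
Implicit Types (s : seq ('I_n * 'I_n)).

Lemma harmonic_bdiff s c : harmonic s c = \prod_(e <- s) bdiff e.1 e.2 (supp c).
Proof. by apply: eq_bigr => e _; rewrite /bdiff !inE. Qed.

Lemma sum_support_design (D : code n) w (F : {set 'I_n} -> rat) :
  \sum_(b <- support_design D w) F b = \sum_(c in codewords D w) F (supp c).
Proof. by rewrite /support_design big_map big_enum. Qed.

Lemma support_design_card (D : code n) w :
  all (fun b : {set 'I_n} => #|b| == w) (support_design D w).
Proof. by apply/allP => b /imageP[c]; rewrite inE => /andP[_ cw] ->. Qed.

Lemma union_sum_blocks s w : union_sum C s w =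
  \sum_(b <- support_design C w ++ support_design (dual C) w)
     \prod_(e <- s) bdiff e.1 e.2 b.
Proof.
rewrite big_cat !sum_support_design.
by congr (_ + _); apply: eq_bigr => c _; rewrite harmonic_bdiff.
Qed.

Hypotheses (nE : n = (8 * m)%N) (m0 : (0 < m)%N) (neC : near_extremal_even_fsd C).

Let B w := support_design C w ++ support_design (dual C) w.

Let Bcard w : all (fun b : {set 'I_n} => #|b| == w) (B w).
Proof. by rewrite all_cat !support_design_card. Qed.

Let Bdeg1 w x y : x != y -> \sum_(b <- B w) bdiff x y b = 0.
Proof.
move=> xy; apply: etrans (fsd_deg1 nE m0 neC w xy); rewrite union_sum_blocks.
by apply: eq_bigr => b _; rewrite big_seq1.
Qed.

Lemma fsd_design1 w : (0 < w)%N -> t_design 1 (B w).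
Proof. by move=> w0; apply: design1_criterion w0 _ _ => // x y; apply: Bdeg1. Qed.

Lemma fsd_design2 r : kraw2 m r = 0 -> t_design 2 (B (2 * m + 2 * r)).
Proof.
move=> k0; apply: (@design2_criterion _ _ (2 * m + 2 * r)) => //; rewrite ?card_ord.
- lia.
- by move: nE; lia.
- exact: Bdeg1.
move=> x y z u Us; have [a h] := fsd_deg2 nE m0 neC Us.
apply: etrans (_ : a * kraw2 m r = 0); last by rewrite k0 mulr0.
rewrite -h union_sum_blocks.
by apply: eq_bigr => b _; rewrite big_cons big_seq1.
Qed.

End Blocks.

(** * Gleason polynomials and shadows of Type I codes *)

Section Supports.
Variable n : nat.
Implicit Types (u v c : 'rV['F_2]_n).

Lemma wt_add u v : (wt (u + v) + 2 * #|supp u :&: supp v| = wt u + wt v)%N.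
Proof.
rewrite /wt -(cardsID (supp v) (supp u)) -[in RHS](cardsID (supp u) (supp v)).
rewrite (setIC (supp v)).
have -> : #|supp (u + v)| = (#|supp u :\: supp v| + #|supp v :\: supp u|)%N.
  rewrite -cardsUI (_ : (_ :&: _) = set0) ?cards0 ?addn0.
    apply: eq_card => i; rewrite !inE !mxE.
    by case: (F2_cases (u ord0 i)) (F2_cases (v ord0 i)) => -> [] ->;
      rewrite ?F2_addrr ?addr0 ?add0r ?eqxx ?oner_eq0.
  by apply/setP => i; rewrite !inE; case: (u ord0 i == 0); case: (v ord0 i == 0).
by lia.
Qed.

Lemma inner_supp u v : inner u v = #|supp u :&: supp v|%:R.
Proof.
rewrite /inner (bigID (fun i => i \in supp u :&: supp v)) /= addrC big1 ?add0r.
  rewrite (eq_bigr (fun=> 1)) ?sumr_const // => i; rewrite !inE => /andP[].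
  by case: (F2_cases (u ord0 i)) (F2_cases (v ord0 i)) => -> [] -> //; rewrite mulr1.
by move=> i; rewrite !inE negb_and !negbK => /orP[]/eqP->; rewrite ?mulr0 ?mul0r.
Qed.

(** The sum over w factors as a product over the coordinates of c. *)
Lemma sum_sgn_all c : \sum_(w : 'rV['F_2]_n) sgn (inner c w) = 2 ^+ n * (c == 0)%:R.
Proof.
have e w : sgn (inner c w) = sgn (inner w c) * \prod_(l < n) 1.
  by rewrite big1 // mulr1 innerC.
rewrite (eq_bigr _ (fun w _ => e w)) (fourier_prod (fun=> fun=> 1)) /fourier1; have [->|] := eqVneq c 0.
  rewrite (eq_bigr (fun=> 2)) => [|i _]; last by rewrite mxE sgn0.
  by rewrite prodr_const card_ord mulr1.
rewrite -wt_eq0 -lt0n mulr0 => /card_gt0P[i]; rewrite inE => ci.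
rewrite (bigD1 i) //=; case: (F2_cases (c ord0 i)) ci => -> //.
by rewrite sgn1 mulr1 subrr mul0r.
Qed.

End Supports.

Section TypeI.
Variables (n m : nat) (C : code n).
Hypotheses (nE : n = (8 * m)%N) (m0 : (0 < m)%N) (neC : near_extremal_type_I C).
Implicit Types (u v c w : 'rV['F_2]_n).

Lemma typeI_sd : dual C = C. Proof. by case: neC => [[sd _] _]; rewrite -sd. Qed.

Lemma typeI_fsd : near_extremal_even_fsd C.
Proof.
have [[sd _] ne] := neC; split=> //; first exact: self_dual_even.
by move=> w; rewrite typeI_sd.
Qed.

Lemma typeI_even : even_code C. Proof. by case: typeI_fsd. Qed.

Lemma typeI_card : #|C| = (2 ^ (4 * m))%N.
Proof. exact: (fsd_card nE m0 typeI_fsd). Qed.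

(** The right-hand side of [gleason] in the variable z = X^2. *)
Definition gleason_poly (a : nat -> rat) : {poly rat} :=
  \sum_(i < m.+1) a i *: ((1 + 'X) ^+ (4 * (m - i)) * ('X^i * (1 - 'X) ^+ (2 * i))).

Lemma typeI_gleason : exists a, wpoly C [::] = gleason_poly a \Po 'X^2.
Proof.
have [|||a e] := @gleason m (wpoly C [::]).
- by rewrite -nE; apply: size_wpoly.
- exact/evenp_wpoly/typeI_even.
- move=> t t1; have := macwilliams C (isT : uniq (points_of [::])) t1.
  rewrite /= !expr0 mulr1 mul1r typeI_sd typeI_card natrX -/(cayley t) => ->.
  by congr (_ ^+ _ * _).
exists a; rewrite e /gleason_poly rmorph_sum /=; apply: eq_bigr => i _.
rewrite linearZ /= !rmorphM /= !rmorphXn /= rmorphD rmorphB rmorph1 /= comp_polyX.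
by rewrite -exprM.
Qed.

Lemma gleason_coef a j : wpoly C [::] = gleason_poly a \Po 'X^2 ->
  (gleason_poly a)`_j = #|codewords C (2 * j)|%:R.
Proof.
move=> e; rewrite -coef_wpoly_nil e coef_comp_poly_Xn // dvdn_mulr //.
by rewrite mulKn.
Qed.

Lemma gleason_sum a x : wpoly C [::] = gleason_poly a \Po 'X^2 ->
  (gleason_poly a).[x] = \sum_(c in C) x ^+ (wt c)./2.
Proof.
move=> e; suff -> : gleason_poly a = \sum_(c in C) 'X^((wt c)./2).
  by rewrite horner_sum; apply: eq_bigr => c _; rewrite hornerXn.
apply/polyP => j; rewrite gleason_coef // coef_sum -sumr_const.
rewrite (eq_bigl (fun c => (c \in C) && (wt c == 2 * j)%N)); last by move=> c; rewrite inE.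
rewrite big_mkcondr; apply: eq_bigr => c /typeI_even; rewrite dvdn2 => ev.
rewrite coefXn; have := odd_double_half (wt c); rewrite (negPf ev) => h.
have -> : (wt c == 2 * j)%N = (j == (wt c)./2) by apply/eqP/eqP; lia.
by case: eqP.
Qed.

(** There are no words of weight strictly between 0 and 2m. *)
Lemma gleason_low a j : wpoly C [::] = gleason_poly a \Po 'X^2 ->
  (j < m)%N -> (gleason_poly a)`_j = (j == 0)%:R.
Proof.
move=> aE jm; rewrite (gleason_coef _ aE); case: j jm => [|j] jm.
  rewrite muln0 (_ : codewords C 0 = [set 0]) ?cards1 //.
  apply/setP => c; rewrite !inE wt_eq0; case: eqP => [->|]; rewrite ?mem0v ?andbF //.
rewrite (_ : codewords C (2 * j.+1) = set0) ?cards0 //.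
apply/setP => c; rewrite !inE; apply/negP => /andP[cC /eqP wc].
have c0 : c != 0 by rewrite -wt_eq0 wc; lia.
have [_ _ /(_ c cC c0)] := fsd_gapped nE typeI_fsd; lia.
Qed.

Definition half_weight_sign c : rat := (-1) ^+ (wt c)./2.

(** wt (u + v) = wt u + wt v - 2 |supp u & supp v|, and in a self-dual code the
    supports meet in an even number of points. *)
Lemma half_weight_signD u v : u \in C -> v \in C -> half_weight_sign (u + v) = half_weight_sign u * half_weight_sign v.
Proof.
move=> uC vC; have := wt_add u v; rewrite /half_weight_sign -exprD.
have : ~~ odd #|supp u :&: supp v|.
  rewrite -F2_nat_eq0 -inner_supp; move: vC; rewrite -typeI_sd.
  by move=> /dualP/(_ u uC); rewrite innerC => ->.
have := typeI_even uC; have := typeI_even vC; have := typeI_even (rpredD uC vC).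
rewrite !dvdn2 => h1 h2 h3 h4 e; rewrite -signr_odd -[RHS]signr_odd; congr (_ ^+ _).
by rewrite -(odd_double_half (wt u)) in e *; lia.
Qed.

(** The sign (-1)^(wt c / 2) is a character of C by [half_weight_signD].  If it
    differed from every character c |-> sgn (inner c w), it would be orthogonal
    to all of them; but summing these orthogonality relations over all w singles
    out c = 0 and gives 2^n = 0. *)
Lemma shadow_vector : exists w, forall c, c \in C -> sgn (inner c w) = half_weight_sign c.
Proof.
have [/existsP[w /forall_inP h]|no] :=
    boolP [exists w, [forall (c | c \in C), sgn (inner c w) == half_weight_sign c]].
  by exists w => c /h/eqP.
have z w : \sum_(c in C) half_weight_sign c * sgn (inner c w) = 0.
  move: no; rewrite negb_exists => /forallP/(_ w); rewrite negb_forall_in.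
  case/exists_inP=> c0 c0C ne; set S := (X in X = 0).
  have e : S = half_weight_sign c0 * sgn (inner c0 w) * S.
    rewrite {1}/S (reindex_inj (addrI c0)) /= mulr_sumr.
    apply: eq_big => [c|c]; first by rewrite rpredDl.
    by rewrite rpredDl // => cC; rewrite half_weight_signD // innerDl sgnD; ring.
  move: ne e; rewrite /half_weight_sign /sgn.
  have pm k : (-1) ^+ k = 1 :> rat \/ (-1) ^+ k = -1 :> rat.
    by elim: k => [|k [] e]; [left | right | left]; rewrite ?exprS ?e ?mulrNN ?mulr1.
  case: (pm (wt c0)./2) => ->; case: (pm (inner c0 w != 0)) => ->;
    rewrite ?eqxx // => _ e; lra.
have : \sum_w \sum_(c in C) half_weight_sign c * sgn (inner c w) = 0.
  by apply: big1 => w _; exact: z.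
rewrite exchange_big /= (bigD1 0) ?mem0v //= -mulr_sumr sum_sgn_all eqxx big1.
  rewrite addr0 mulr1 /half_weight_sign wt0 expr0 mul1r => /eqP.
  by rewrite expf_eq0 /= pnatr_eq0 andbF.
by move=> c /andP[_ c0]; rewrite -mulr_sumr sum_sgn_all (negPf c0) !mulr0.
Qed.

Section Shadow.
Variables (a : nat -> rat) (w : 'rV['F_2]_n).
Hypotheses (aE : wpoly C [::] = gleason_poly a \Po 'X^2)
           (wE : forall c, c \in C -> sgn (inner c w) = half_weight_sign c).

(** For w as in [shadow_vector], the vectors of weight k in Conway and Sloane's
    shadow of C. *)
Definition shadow k : {set 'rV['F_2]_n} := [set u | (u + w \in C) && (wt u == k)].

Definition shadow_poly : {poly rat} := \sum_(u | u + w \in C) 'X^(wt u).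

Lemma coef_shadow k : shadow_poly`_k = #|shadow k|%:R.
Proof.
rewrite coef_sum -sumr_const [RHS](eq_bigl (fun u => (u + w \in C) && (wt u == k))).
  by rewrite big_mkcondr; apply: eq_bigr => u _; rewrite coefXn eq_sym; case: eqP.
by move=> u; rewrite inE.
Qed.

(** By Poisson summation over the coset of w, the shadow enumerator at t is the
    Gleason polynomial at z = - cayley(t)^2, since wE replaces the sign of
    inner c w by (-1)^(wt c / 2).  At this point 1 + z and 1 - z are proportional
    to t and to 1 + t^2, up to powers of 1 + t, which gives the closed form. *)
Lemma shadow_polyE : 2 ^+ (4 * m) *: shadow_poly =
  \sum_(i < m.+1) (a i * 4 ^+ (4 * (m - i)) * (-4) ^+ i) *:
     ('X^(4 * (m - i)) * (1 - 'X^4) ^+ (2 * i)).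
Proof.
apply: poly_eq_gt1 => t t1.
have := poisson_wt C w t (isT : uniq (points_of [::])); rewrite /= !expr0 mulr1 mul1r.
rewrite typeI_sd typeI_card natrX => e.
rewrite hornerZ horner_sum; transitivity (2 ^+ (4 * m) *
    \sum_(u | u + w \in C) harmonic [::] u * t ^+ wt u).
  by congr (_ * _); apply: eq_bigr => u _; rewrite hornerXn harmonic_nil mul1r.
rewrite {}e; transitivity ((1 + t) ^+ (8 * m) * (gleason_poly a).[- cayley t ^+ 2]).
  rewrite (gleason_sum _ aE) mulr_sumr; apply: eq_bigr => c cC.
  have e8 : (1 + t) ^+ n = (1 + t) ^+ (8 * m) by congr (_ ^+ _).
  rewrite wE // harmonic_nil mul1r expr_cayley ?wt_le // e8 mulrCA; congr (_ * _).
  rewrite /half_weight_sign [RHS]exprNn -exprM; congr (_ * _ ^+ _).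
  have := typeI_even cC; rewrite dvdn2 => ev.
  by rewrite -[LHS]odd_double_half (negPf ev) mul2n.
rewrite horner_sum mulr_sumr horner_sum; apply: eq_bigr => i _.
have im : (i <= m)%N by rewrite -ltnS.
have [tn0 t1n0 mn0] := gt1_neq0 t1.
rewrite !hornerZ !hornerM !horner_exp !hornerX.
have -> : (1 + 'X).[- cayley t ^+ 2] = 1 - cayley t ^+ 2 :> rat by rewrite hornerD hornerX -polyC1 hornerC.
have -> : (1 - 'X).[- cayley t ^+ 2] = 1 + cayley t ^+ 2 :> rat.
  by rewrite hornerD hornerN hornerX -polyC1 hornerC opprK.
have -> : (1 - 'X^4).[t] = 1 - t ^+ 4 :> rat by rewrite hornerD hornerN hornerXn -polyC1 hornerC.
rewrite (_ : (8 * m = 2 * (4 * (m - i)) + 4 * i + 4 * i)%N); last by lia.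
have e1 : (1 - t ^+ 4) ^+ (2 * i) = ((1 - t) * (1 + t)) ^+ (2 * i) * (1 + t ^+ 2) ^+ (2 * i).
  by rewrite -exprMn; congr (_ ^+ _); ring.
have e2 : (1 + t) ^+ (4 * i) * (1 + cayley t ^+ 2) ^+ (2 * i) = 4 ^+ i * (1 + t ^+ 2) ^+ (2 * i).
  have -> : (4 * i = 2 * (2 * i))%N by lia.
  by rewrite exprM -exprMn one_plus_cayley2 // exprMn [2 ^+ (2 * i)]exprM.
have e3 : (1 + t) ^+ (4 * i) * (- cayley t ^+ 2) ^+ i = (-1) ^+ i * ((1 - t) * (1 + t)) ^+ (2 * i).
  rewrite !exprM -exprMn -exprMn; congr (_ ^+ _); rewrite /cayley; field.
  by [].
have e4 : (1 + t) ^+ (2 * (4 * (m - i))) * (1 - cayley t ^+ 2) ^+ (4 * (m - i)) =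
    4 ^+ (4 * (m - i)) * t ^+ (4 * (m - i)).
  by rewrite exprM -exprMn one_minus_cayley2 // exprMn.
transitivity (a i * ((1 + t) ^+ (2 * (4 * (m - i))) * (1 - cayley t ^+ 2) ^+ (4 * (m - i))) *
  ((1 + t) ^+ (4 * i) * (- cayley t ^+ 2) ^+ i) *
  ((1 + t) ^+ (4 * i) * (1 + cayley t ^+ 2) ^+ (2 * i))).
  by rewrite !exprD; ring.
rewrite e4 e3 e2 e1 (_ : -4 = -1 * 4) ?[(-1 * 4) ^+ i]exprMn; last by ring.
by ring.
Qed.

(** If 0 were in the shadow, then w would be in C, the sign character would be
    trivial, and C would be doubly even. *)
Lemma shadow0 : shadow 0 = set0.
Proof.
apply/setP => u; rewrite !inE wt_eq0; apply/negP => /andP[+ /eqP u0].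
rewrite u0 add0r => wC; have [[_ nde] _] := neC; case: nde => c cC.
have := wE cC; move: wC; rewrite -{1}typeI_sd => /dualP/(_ c cC).
rewrite innerC => ->; rewrite sgn0 /half_weight_sign -signr_odd.
have := typeI_even cC; rewrite dvdn2; have := odd_double_half (wt c).
by case: (odd (wt c)./2) (odd_double_half (wt c)./2) => //= ? ? ? _; lia.
Qed.

(** Only the term i = m of [shadow_polyE] has a constant coefficient. *)
Lemma gleason_top : a m = 0.
Proof.
have := congr1 (fun p : {poly rat} => p.[0]) shadow_polyE.
rewrite hornerZ horner_coef0 coef_shadow shadow0 cards0 mulr0 horner_sum.
rewrite big_ord_recr big1 /= => [|i _]; last first.
  have k0 : (0 < 4 * (m - i))%N by have := ltn_ord i; lia.
  by rewrite hornerZ hornerM hornerXn expr0n eqn0Ngt k0 mul0r mulr0.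
rewrite subnn muln0 expr0 mul1r mulr1 hornerZ horner_exp add0r.
have -> : (1 - 'X^4).[0] = 1 :> rat by rewrite hornerD hornerN hornerXn -polyC1 hornerC expr0n subr0.
by rewrite expr1n mulr1 => /esym/eqP; rewrite mulf_eq0 expf_eq0 andbF orbF => /eqP.
Qed.

(** After [gleason_top], only the term i = m - 1 of [shadow_polyE] reaches the
    exponent 4. *)
Lemma shadow4_count : 16 ^+ m * #|shadow 4|%:R = 256 * (-4) ^+ m.-1 * a m.-1.
Proof.
have := congr1 (fun p : {poly rat} => p`_4) shadow_polyE.
rewrite coefZ coef_shadow coef_sum exprM => ->.
rewrite big_ord_recr /= gleason_top !mul0r scale0r coef0 addr0.
have : (m.-1 < m)%N by lia.
move=> lt; rewrite (bigD1 (Ordinal lt)) //= big1 ?addr0 => [|i ne].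
  have -> : (m - m.-1 = 1)%N by lia.
  rewrite coefZ coefXnM /= -horner_coef0 horner_exp.
  have -> : (1 - 'X^4).[0] = 1 :> rat by rewrite hornerD hornerN hornerXn -polyC1 hornerC expr0n subr0.
  by rewrite expr1n; ring.
rewrite coefZ coefXnM; have -> : (4 < 4 * (m - i))%N; last by rewrite mulr0.
have := ltn_ord i; have : (i != m.-1 :> nat) by [].
by lia.
Qed.

(** Two such vectors differ by a word of C of weight at most 8 < 2m. *)
Lemma shadow4_le1 : (5 <= m)%N -> (#|shadow 4| <= 1)%N.
Proof.
move=> m5; rewrite leqNgt; apply/negP => /card_gt1P[u [v [+ + uv]]].
rewrite !inE => /andP[uC /eqP u4] /andP[vC /eqP v4].
have uvC : u + v \in C.
  have := rpredB uC vC; rewrite opprD addrACA subrr addr0.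
  suff -> : - v = v by [].
  by apply/rowP => i; rewrite mxE; case: (F2_cases (v ord0 i)) => ->; apply/val_inj.
have uv0 : u + v != 0.
  apply: contraNneq uv => /eqP; rewrite addr_eq0 => /eqP ->.
  by apply/eqP/rowP => i; rewrite mxE; case: (F2_cases (v ord0 i)) => ->; apply/val_inj.
have [_ _ /(_ _ uvC uv0)] := fsd_gapped nE typeI_fsd.
have w8 : (wt (u + v) <= 8)%N by have := leq_addr (2 * #|supp u :&: supp v|) (wt (u + v)); rewrite wt_add u4 v4.
by move/leq_trans/(_ w8); lia.
Qed.

End Shadow.
End TypeI.

(** * Lagrange inversion and non-existence from length 40 on *)

Lemma dvdXnP N (p : {poly rat}) :
  reflect (forall j, (j < N)%N -> p`_j = 0) ('X^N %| p).
Proof.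
apply: (iffP idP) => [/dvdpP[q ->] j jN|/low_coefs_split[V -> _]]; last exact: dvdp_mulr.
by rewrite coefMXn jN.
Qed.

Lemma coprime_Xn_horner0 N (p : {poly rat}) : p.[0] != 0 -> coprimep 'X^N p.
Proof.
move=> p0; apply/coprimep_expl; rewrite coprimep_sym -[X in coprimep _ X]subr0 -[0]/(0%:P).
by rewrite coprimep_XsubC.
Qed.

Lemma deriv_1pX_exp A :
  (1 + 'X) * ((1 + 'X : {poly rat}) ^+ A)^`() = A%:R * (1 + 'X) ^+ A.
Proof.
have d : (1 + 'X : {poly rat})^`() = 1 by rewrite derivD derivX -polyC1 derivC add0r.
rewrite deriv_exp d mul1r mulr_natl.
by case: A => [|A]; rewrite ?mulr0n ?mulr0 // mulrnAr -exprS.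
Qed.

Lemma deriv_1mX_exp A :
  (1 - 'X) * ((1 - 'X : {poly rat}) ^+ A)^`() = - (A%:R * (1 - 'X) ^+ A).
Proof.
have d : (1 - 'X : {poly rat})^`() = -1 by rewrite derivB derivX -polyC1 derivC sub0r.
rewrite deriv_exp d mulN1r mulr_natl.
by case: A => [|A]; rewrite ?mulr0n ?mulr0 ?oppr0 // mulrnAr mulrN -exprS mulNrn.
Qed.

(** The product rule for E = (1 + X)^(4r) (1 - X)^(-2r) e, with denominators
    cleared. *)
Lemma deriv_ratio r (E e : {poly rat}) :
  (1 - 'X) ^+ (2 * r) * E = (1 + 'X) ^+ (4 * r) * e ->
  (1 + 'X) * (1 - 'X) ^+ (2 * r).+1 * E^`() =
    2%:R * r%:R * (1 + 'X) * ((1 - 'X) ^+ (2 * r) * E)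
    + (1 - 'X) * (4%:R * r%:R * (1 + 'X) ^+ (4 * r) * e
                  + (1 + 'X) * (1 + 'X) ^+ (4 * r) * e^`()).
Proof.
move=> eE; have := congr1 (fun p : {poly rat} => (1 - 'X) * (1 + 'X) * p^`()) eE.
rewrite !derivM => h.
have h1 := deriv_1mX_exp (2 * r); have h2 := deriv_1pX_exp (4 * r).
rewrite !natrM in h1 h2.
move: h h1 h2; have -> : (1 - 'X) ^+ (2 * r).+1 = (1 - 'X) * (1 - 'X) ^+ (2 * r) :> {poly rat}.
  exact: exprS.
set A := ((1 - 'X) ^+ (2 * r)); set B := ((1 + 'X) ^+ (4 * r)).
move: A^`() B^`() e^`() E^`() => A' B' e' E' h h1 h2.
have -> : (1 + 'X) * ((1 - 'X) * A) * E' =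
  (1 - 'X) * (1 + 'X) * (A' * E + A * E') - (1 + 'X) * ((1 - 'X) * A') * E by ring.
rewrite h h1.
have -> : (1 - 'X) * (1 + 'X) * (B' * e + B * e') =
  (1 - 'X) * ((1 + 'X) * B') * e + (1 - 'X) * (1 + 'X) * B * e' by ring.
by rewrite h2; ring.
Qed.

(** With phi = z (1 - z)^2 / (1 + z)^4 the Gleason polynomial is
    (1 + z)^(4m) * sum_i a_i phi^i.  If it is 1 modulo z^m, then Buermann's
    formula gives
    i a_i = residue of ((1 + z)^(-4m))' phi^(-i), and for i = m - 1 this residue
    is -4m times the coefficient of z^(m - 2) in
    (1 + z)^(-5) (1 - z)^(-(2m - 2)).  The series is represented by a polynomial
    H modulo z^m, so that the argument stays within polynomials.  The polynomial
    q is the numerator of phi': phi' = (1 - z) q / (1 + z)^5. *)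
Section Lagrange.
Variables (m : nat) (H : {poly rat}).
Hypothesis m1 : (1 < m)%N.
Hypothesis HE : 'X^m %| H * ((1 + 'X) ^+ 5 * (1 - 'X) ^+ (2 * m - 2)) - 1.

Let q : {poly rat} := 1 - 6%:R * 'X + 'X^2.

(** The residue of phi^j phi' / phi^(m - 1), that is of phi' phi^(-(r + 1)).  For
    r > 0 it is the residue of a derivative, hence zero.  In terms of power
    series: E = z^r phi^(-r) up to the truncation, z E' - r E = - r K, and
    the coefficient of z^r in z E' - r E is zero. *)
Lemma lagrange_orthogonality r j : (j + r = m - 2)%N ->
  ((1 + 'X) ^+ (4 * r.+1) * (1 - 'X) ^+ (2 * j).+1 * q * H)`_r = (r == 0%N)%:R.
Proof.
move=> jr; set K := _ * H.
have h1p : (1 + 'X).[0] = 1 :> rat by rewrite hornerD hornerX -polyC1 hornerC addr0.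
have h1m : (1 - 'X).[0] = 1 :> rat by rewrite hornerD hornerN hornerX -polyC1 hornerC subr0.
have q0 : q.[0] = 1.
  by rewrite /q !hornerD hornerN hornerM hornerX hornerXn expr0n -polyC1 hornerC mulr0 subr0 addr0.
have [r0|r0] := posnP r.
  rewrite {}r0 /K -!horner_coef0 !hornerM !horner_exp h1p h1m q0 !expr1n !mul1r.
  have /dvdXnP/(_ 0%N) := HE; rewrite -horner_coef0 hornerD hornerM hornerM !horner_exp.
  rewrite h1p h1m !expr1n !mulr1 hornerN -polyC1 hornerC => h.
  by apply/eqP; rewrite -subr_eq0 h // ltnW.
pose e := H * ((1 + 'X) ^+ 5 * (1 - 'X) ^+ (2 * m - 2)).
pose E := (1 + 'X) ^+ (4 * r + 5) * (1 - 'X) ^+ (2 * j.+1) * H.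
pose R : {poly rat} := r%:R.
pose Y := 'X * E^`() - R * E + R * K.
pose U : {poly rat} := (1 + 'X) * (1 - 'X) ^+ (2 * r).+1.
have eE : (1 - 'X) ^+ (2 * r) * E = (1 + 'X) ^+ (4 * r) * e.
  rewrite /E /e (_ : (2 * m - 2 = 2 * r + 2 * j.+1)%N); last lia.
  by rewrite !exprD; ring.
have eK : U * K = (1 + 'X) ^+ (4 * r) * e * q.
  rewrite /U /K /e (_ : (2 * m - 2 = (2 * r).+1 + (2 * j).+1)%N); last lia.
  rewrite (_ : (4 * r.+1 = 4 * r + 4)%N) ?exprD; last lia.
  ring.
have dE := deriv_ratio eE.
have UY : U * Y = (1 + 'X) ^+ (4 * r) * ('X * (1 - 'X) * (1 + 'X)) * e^`().
  transitivity ('X * (U * E^`()) - R * (1 + 'X) * (1 - 'X) * ((1 - 'X) ^+ (2 * r) * E) + R * (U * K)).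
    by rewrite /Y {1 2 3}/U exprS; ring.
  by rewrite {1}/U dE eK eE /q; ring.
have e'0 : 'X^(m.-1) %| e^`().
  apply/dvdXnP => k km; rewrite coef_deriv.
  have /dvdXnP/(_ k.+1) := HE; rewrite -/e coefB coef1 subr0 => ->; rewrite ?mul0rn //.
  lia.
have : 'X^(m.-1) %| Y.
  rewrite -(@Gauss_dvdpr _ _ U) ?UY ?dvdp_mull // coprime_Xn_horner0 //.
  by rewrite /U hornerM horner_exp h1p h1m expr1n mulr1 oner_neq0.
move/dvdXnP/(_ r); rewrite /Y /R !coefD coefN coefXM eqn0Ngt r0 /= coef_deriv prednK //.
rewrite !mulr_natl !coefMn subrr add0r => h.
have {}h : K`_r *+ r = 0 by apply: h; lia.
by move/eqP: h; rewrite mulrn_eq0 eqn0Ngt r0 /= => /eqP.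
Qed.

(** The operator G |-> (1 + z) G' - 4m G differentiates G / (1 + z)^(4m), so it
    maps the term (1 + z)^(4m) phi^(j + 1) to a multiple of phi^j phi'. *)
Lemma deriv_gleason_term j A : (A + 4 * j.+1 = 4 * m)%N ->
  let G : {poly rat} := (1 + 'X) ^+ A * ('X^(j.+1) * (1 - 'X) ^+ (2 * j.+1)) in
  (1 + 'X) * G^`() - (4 * m)%:R * G =
  j.+1%:R * ((1 + 'X) ^+ A * 'X^j * (1 - 'X) ^+ (2 * j).+1 * q).
Proof.
move=> Am /=; rewrite -Am natrD natrM.
have h1 := deriv_1pX_exp A; have h2 := deriv_1mX_exp (2 * j.+1).
rewrite natrM in h2.
have e2 : (1 - 'X) ^+ (2 * j.+1) = (1 - 'X) * (1 - 'X) ^+ (2 * j).+1 :> {poly rat}.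
  by rewrite -exprS; congr (_ ^+ _); lia.
have d2 : ((1 - 'X) ^+ (2 * j.+1))^`() = - (2 * j.+1%:R * (1 - 'X) ^+ (2 * j).+1) :> {poly rat}.
  apply: (@mulfI _ (1 - 'X)); last by rewrite h2 e2; ring.
  by rewrite -opprB oppr_eq0 -polyC1 polyXsubC_eq0.
rewrite (derivM ((1 + 'X) ^+ A)) (derivM 'X^(j.+1)) derivXn /=.
move: h1 e2 d2.
set W := (1 - 'X) ^+ (2 * j).+1; set V := (1 - 'X) ^+ (2 * j.+1).
set P1 := (1 + 'X) ^+ A; move: P1^`() V^`() => P1' V' h1 e2 ->.
rewrite e2 -mulr_natr exprS; set J := j.+1%:R.
transitivity (((1 + 'X) * P1') * ('X * 'X^j * ((1 - 'X) * W)) +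
  (1 + 'X) * P1 * ('X^j * J * ((1 - 'X) * W) - 'X * 'X^j * W * (2%:R * J)) -
  (A%:R + 4%:R * J) * (P1 * ('X * 'X^j * ((1 - 'X) * W)))).
  by ring.
by rewrite h1 /q; ring.
Qed.

Lemma deriv_gleason0 : let G : {poly rat} := (1 + 'X) ^+ (4 * m) in
  (1 + 'X) * G^`() - (4 * m)%:R * G = 0.
Proof. by rewrite /= deriv_1pX_exp subrr. Qed.

Variable a : nat -> rat.
Hypothesis am : a m = 0.
Hypothesis P0 : (gleason_poly m a)`_0 = 1.
Hypothesis Plow : forall j, (0 < j < m)%N -> (gleason_poly m a)`_j = 0.

(** Apply (1 + z) P' - 4m P to P = gleason_poly m a.  As P is 1 modulo z^m, the
    result is -4m modulo z^(m - 1).  Term by term it is a combination of the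
    products in [lagrange_orthogonality], so multiplying by H and taking the
    coefficient of z^(m - 2) isolates a_(m - 1). *)
Lemma lagrange : m.-1%:R * a m.-1 = - (4 * m)%:R * H`_(m - 2).
Proof.
pose P := gleason_poly m a; pose D := (1 + 'X) * P^`() - (4 * m)%:R * P.
have Dlow : 'X^(m.-1) %| D + (4 * m)%:R.
  apply/dvdXnP => k km; rewrite /D -!polyC_natr !coefD coefN coefCM coefC mulrDl mul1r.
  rewrite coefD coefXM !coef_deriv.
  rewrite (Plow (_ : 0 < k.+1 < m)%N); last by lia.
  case: k km => [|k] km /=; first by rewrite P0 mul0rn !addr0 mulr1 add0r addNr.
  by rewrite Plow ?mul0rn ?mulr0 ?subr0 ?addr0 //; lia.
have DHl : (D * H)`_(m - 2) = - (4 * m)%:R * H`_(m - 2).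
  have /dvdXnP/(_ (m - 2)%N) := dvdp_mulr H Dlow.
  rewrite mulrDl coefD -polyC_natr coefCM mulNr => h.
  by apply/eqP; rewrite -addr_eq0 h //; lia.
have DE : D = \sum_(j < m) (j.+1%:R * a j.+1) *:
    ((1 + 'X) ^+ (4 * (m - j.+1)) * 'X^j * (1 - 'X) ^+ (2 * j).+1 * q).
  rewrite /D /P /gleason_poly big_ord_recl /= subn0 !expr0 !mulr1 derivD derivZ.
  rewrite raddf_sum /= [(_ + _) * (_ + _)]mulrDr [(4 * m)%:R * _]mulrDr opprD addrACA.
  rewrite -!scalerAr -scalerBr deriv_gleason0 scaler0 add0r !mulr_sumr -sumrB.
  apply: eq_bigr => j _; rewrite /= derivZ -!scalerAr -scalerBr deriv_gleason_term.
    by rewrite mulr_natl -scaler_nat scalerA mulrC.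
  by have := ltn_ord j; rewrite /bump /=; lia.
rewrite -DHl DE mulr_suml coef_sum.
have m2 : (m - 2 < m)%N by lia.
rewrite (bigD1 (Ordinal m2)) //= big1 ?addr0 => [|j jm].
  rewrite -scalerAl coefZ -subSn // subSS.
  have -> : (m - (m - 1) = 1)%N by lia.
  have -> : 'X^(m - 2) = 'X^(m - 2) * 1 :> {poly rat} by rewrite mulr1.
  have := @lagrange_orthogonality 0 (m - 2) (addn0 _); rewrite muln1.
  set Z := (_ * _) => e; have -> : (1 + 'X) ^+ 4 * ('X^(m - 2) * 1) * (1 - 'X) ^+ (2 * (m - 2)).+1 * q * H
    = 'X^(m - 2) * Z by rewrite /Z; ring.
  by rewrite coefXnM ltnn subnn e mulr1 subn1.
rewrite -scalerAl coefZ; have [jm1|jm1] := eqVneq j.+1 m; first by rewrite jm1 am mulr0 mul0r.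
have := ltn_ord j; move: jm; rewrite -val_eqE /= => jm ltj.
have -> : (m - j.+1 = (m - 2 - j).+1)%N by lia.
have jE : (j + (m - 2 - j) = m - 2)%N by lia.
have := lagrange_orthogonality jE; set Z := (_ * H) => e.
have -> : (1 + 'X) ^+ (4 * (m - 2 - j).+1) * 'X^j * (1 - 'X) ^+ (2 * j).+1 * q * H
    = 'X^j * Z by rewrite /Z; ring.
rewrite coefXnM; have -> : (m - 2 < j)%N = false by lia.
have ne0 : (m - 2 - j == 0)%N = false by lia.
by rewrite e ne0 mulr0.
Qed.

End Lagrange.

Section TruncatedInverse.
Variable m : nat.
Implicit Types p q : {poly rat}.

Lemma dvdp_mul_sub1 d p q : d %| p - 1 -> d %| q - 1 -> d %| p * q - 1.
Proof.
move=> dp dq; have -> : p * q - 1 = (p - 1) * q + (q - 1) by ring.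
by rewrite dvdp_addr // dvdp_mulr.
Qed.

Lemma dvdp_exp_sub1 d p k : d %| p - 1 -> d %| p ^+ k - 1.
Proof.
move=> dp; elim: k => [|k IH]; first by rewrite expr0 subrr dvdp0.
by rewrite exprS dvdp_mul_sub1.
Qed.

(** The series (1 - X)^(-k) modulo X^m. *)
Definition neg_binomial k : {poly rat} := \poly_(j < m) ('C(j + k - 1, j))%:R.

Lemma neg_binomialP k : 'X^m %| (1 - 'X) ^+ k * neg_binomial k - 1.
Proof.
elim: k => [|k IH].
  apply/dvdXnP => j jm; rewrite mul1r coefB coef_poly jm coef1 addn0.
  case: j jm => [|j] _; first by rewrite bin0 subrr.
  by rewrite bin_small ?subr0 // subn1.
suff h : 'X^m %| (1 - 'X) * neg_binomial k.+1 - neg_binomial k.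
  have -> : (1 - 'X) ^+ k.+1 * neg_binomial k.+1 - 1 =
    (1 - 'X) ^+ k * ((1 - 'X) * neg_binomial k.+1 - neg_binomial k)
    + ((1 - 'X) ^+ k * neg_binomial k - 1) by rewrite exprS; ring.
  by rewrite dvdp_addr // dvdp_mull.
apply/dvdXnP => j jm; rewrite mulrBl mul1r !coefB coefXM !coef_poly jm.
case: j jm => [|j] jm /=; first by rewrite !bin0 subr0 subrr.
rewrite (ltnW jm) addnS subn1 /= addSn binS natrD (_ : (j.+1 + k - 1 = j + k)%N); last lia.
by rewrite (_ : (j + k.+1 - 1 = j + k)%N); [ring | lia].
Qed.

(** The series (1 - X^2)^(-1) modulo X^m. *)
Definition geometric2 : {poly rat} := \poly_(j < m) (~~ odd j)%:R.

Lemma geometric2P : 'X^m %| (1 - 'X^2) * geometric2 - 1.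
Proof.
apply/dvdXnP => j jm; rewrite mulrBl mul1r !coefB coefXnM !coef_poly jm coef1.
case: j jm => [|[|j]] jm /=; rewrite ?subr0 ?subrr //.
have jm2 : (j < m)%N by apply: ltn_trans jm.
by rewrite subn2 /= jm2 negbK subrr.
Qed.

(** Multiplication by a series with constant term 1 and non-negative coefficients
    does not decrease the coefficients of a non-negative series. *)
Lemma coef_geometric2_le k q j : (0 < m)%N -> (forall i, 0 <= q`_i) ->
  q`_j <= (geometric2 ^+ k * q)`_j.
Proof.
move=> m0; elim: k q => [|k IH] q q0; first by rewrite mul1r.
have ge i : 0 <= geometric2`_i by rewrite coef_poly; case: ifP.
rewrite exprSr -mulrA; apply: le_trans (IH _ _) => [|i].
  rewrite coefM big_ord_recl /= subn0 coef_poly m0 mul1r lerDl.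
  by apply: sumr_ge0 => i _; apply: mulr_ge0.
by rewrite coefM; apply: sumr_ge0 => l _; apply: mulr_ge0.
Qed.

End TruncatedInverse.

(** (1 + X)^(-5) (1 - X)^(-(2m - 2)) = (1 - X^2)^(-5) (1 - X)^(-(2m - 7)), where
    both factors have non-negative coefficients; the bound keeps only the second
    one. *)
Lemma truncated_inverse m : (5 <= m)%N -> exists H : {poly rat},
  'X^m %| H * ((1 + 'X) ^+ 5 * (1 - 'X) ^+ (2 * m - 2)) - 1 /\
  ('C(3 * m - 10, m - 2))%:R <= H`_(m - 2).
Proof.
move=> m5; exists (geometric2 m ^+ 5 * neg_binomial m (2 * m - 7)); split.
  have -> : (2 * m - 2 = 2 * m - 7 + 5)%N by lia.
  rewrite exprD; set N := neg_binomial _ _; set T := geometric2 m.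
  have -> : T ^+ 5 * N * ((1 + 'X) ^+ 5 * ((1 - 'X) ^+ (2 * m - 7) * (1 - 'X) ^+ 5)) =
     ((1 - 'X^2) * T) ^+ 5 * ((1 - 'X) ^+ (2 * m - 7) * N) by ring.
  apply: dvdp_mul_sub1; last exact: neg_binomialP.
  exact/dvdp_exp_sub1/geometric2P.
apply: le_trans (_ : (neg_binomial m (2 * m - 7))`_(m - 2) <= _); last first.
  by apply: coef_geometric2_le => [|i]; [lia | rewrite coef_poly; case: ifP].
rewrite coef_poly; have -> : (m - 2 < m)%N by lia.
by rewrite (_ : (m - 2 + (2 * m - 7) - 1 = 3 * m - 10)%N) //; lia.
Qed.

(** With m = k + 6 the claim is 4^m <= 256 C(3m - 10, m - 2), the size needed in
    [no_near_extremal_type_I].  One step multiplies the binomial by at least 4. *)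
Lemma bin_growth k : (4 ^ (k + 6) <= 256 * 'C(3 * k + 8, k + 4))%N.
Proof.
elim: k => [|k IH]; first by vm_compute.
rewrite (_ : (3 * k.+1 + 8 = (3 * k + 8).+3)%N); last by lia.
rewrite (_ : (k.+1 + 4 = (k + 4).+1)%N); last by lia.
rewrite addSn expnS; set n := (3 * k + 8)%N; set j := (k + 4)%N.
have [i jE] : exists i, j = i.+1 by exists (k + 3)%N; rewrite /j; lia.
have := mul_bin_left n i; rewrite !binS jE => h.
have nj : (n - i = 2 * k + 5)%N by rewrite /n; move: jE; rewrite /j; lia.
have {}h : ('C(n, i.+1) <= 3 * 'C(n, i))%N.
  rewrite -(leq_pmul2l (ltn0Sn i)) h nj; move: jE; rewrite /j => jE.
  by rewrite mulnA leq_mul2r; apply/orP; right; lia.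
have hs := leq_bin2l i (leqnSn n).
move: IH; rewrite -/n -/j jE (binS n.+1 i) (binS n i); lia.
Qed.

(** [shadow4_count] and [lagrange] combine to
    16^m (m - 1) B = 256 (-4)^m m h, where B counts the shadow vectors of weight
    4 and h > 0 is the coefficient bounded in [truncated_inverse].  For odd m
    the right-hand side is negative.  For even m, [bin_growth] gives
    (m - 1) B >= m, so B >= 2, against [shadow4_le1]. *)
Lemma no_near_extremal_type_I n m (C : code n) : n = (8 * m)%N -> (5 <= m)%N ->
  ~ near_extremal_type_I C.
Proof.
move=> nE m5 neC; have m0 : (0 < m)%N by lia.
have m1 : (1 < m)%N by lia.
have [a aE] := typeI_gleason nE m0 neC.
have [w wE] := shadow_vector nE m0 neC.
have [H [HE Hge]] := truncated_inverse m5.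
have am := gleason_top nE m0 neC aE wE.
have P0 : (gleason_poly m a)`_0 = 1 by rewrite (gleason_low nE m0 neC aE m0).
have Plow j : (0 < j < m)%N -> (gleason_poly m a)`_j = 0.
  by case/andP=> j0 jm; rewrite (gleason_low nE m0 neC aE jm) (gtn_eqF j0).
have L := lagrange m1 HE am P0 Plow.
have S4 := shadow4_count nE m0 neC aE wE.
have B1 := shadow4_le1 nE m0 neC w m5.
set B := #|shadow C w 4| in S4 B1.
set h := H`_(m - 2) in L Hge; set c := 'C(_, _) in Hge.
have c0 : (0 < c)%N by rewrite bin_gt0; lia.
have h0 : 0 < h by apply: lt_le_trans Hge; rewrite ltr0n.
(* Here h is the coefficient bounded below by c = C(3m - 10, m - 2). *)
have key : 16 ^+ m * (m.-1 * B)%:R = 256 * (-4) ^+ m * (m%:R * h).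
  rewrite natrM mulrCA S4 mulrCA L natrM -[in (-4) ^+ m](prednK m0) exprS; ring.
have e16 : 16 ^+ m = 4 ^+ m * 4 ^+ m :> rat by rewrite -exprMn.
have p4 : 0 < 4 ^+ m :> rat by rewrite exprn_gt0.
have mr : 0 < m%:R :> rat by rewrite ltr0n.
have mh : 0 < m%:R * h := mulr_gt0 mr h0.
have [om|em] := boolP (odd m).
  have p16 : 0 <= 16 ^+ m :> rat := exprn_ge0 m (ler0n _ 16).
  have := mulr_ge0 p16 (ler0n rat (m.-1 * B)).
  have p256 : 0 < 256 :> rat by rewrite ltr0n.
  rewrite key exprNn -signr_odd om expr1 mulN1r mulrN mulNr oppr_ge0 leNgt.
  by rewrite (mulr_gt0 (mulr_gt0 p256 p4) mh).
have m6 : m = ((m - 6) + 6)%N by clear -em m5; lia.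
move: key; rewrite exprNn -signr_odd (negPf em) expr0 mul1r e16 => key.
have {}key : 4 ^+ m * (m.-1 * B)%:R = 256 * (m%:R * h).
  by apply: (mulfI (lt0r_neq0 p4)); rewrite [LHS]mulrA key; ring.
have g := bin_growth (m - 6); rewrite -m6 in g.
have {}g : (4 ^ m <= 256 * c)%N.
  have -> : c = 'C(3 * (m - 6) + 8, m - 6 + 4); last by [].
  by rewrite /c; clear -m6; congr 'C(_, _); lia.
have : (4 ^ m * m <= 4 ^ m * (m.-1 * B))%N.
  rewrite -(ler_nat rat) [X in _ <= X]natrM natrX key.
  apply: le_trans (_ : (256 * c * m)%:R <= _); first by rewrite ler_nat leq_mul2r g orbT.
  rewrite !natrM [X in X <= _](_ : _ = 256 * (m%:R * c%:R)); last by ring.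
  apply: ler_wpM2l; first exact: ler0n.
  exact: (ler_wpM2l (ltW mr) Hge).
have e4 : (0 < 4 ^ m)%N by rewrite expn_gt0.
rewrite (leq_pmul2l e4); move: (B) B1 => b; clear -m5.
by case: b => [|[|b]]; lia.
Qed.

(** * Type I codes of length at most 32 *)

Lemma coef_1pX_exp M j : ((1 + 'X) ^+ M : {poly rat})`_j = 'C(M, j)%:R.
Proof.
elim: M j => [|M IH] j; first by rewrite expr0 coef1 bin0n.
rewrite exprSr mulrDr mulr1 coefD coefMX; case: j => [|j] /=.
  by rewrite IH !bin0 addr0.
by rewrite !IH binS natrD.
Qed.

(** The contributions to the coefficient of z^j in (1 + z)^a (1 - z)^b with l odd
    (s = true) or even, kept apart so that they can be evaluated on naturals. *)
Definition signed_conv (a b j : nat) (s : bool) : nat :=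
  sumn [seq ('C(b, l) * 'C(a, j - l))%N | l <- iota 0 j.+1 & odd l == s].

Lemma coef_1pX_1mX a b j : ((1 + 'X) ^+ a * (1 - 'X) ^+ b : {poly rat})`_j =
  (signed_conv a b j false)%:R - (signed_conv a b j true)%:R.
Proof.
have scE s : (signed_conv a b j s)%:R =
    \sum_(l < j.+1 | odd l == s) ('C(b, l) * 'C(a, j - l))%:R :> rat.
  rewrite /signed_conv sumnE big_map big_filter natr_sum.
  by rewrite -(big_mkord (fun l => odd l == s) (fun l => ('C(b, l) * 'C(a, j - l))%:R)) /index_iota subn0.
rewrite !scE mulrC coefM (bigID (fun l : 'I_j.+1 => odd l == false)) /= -sumrN.
congr (_ + _); apply: eq_big => [l|l] //; try by case: (odd l).
  by move/eqP=> ol; rewrite coef_1mX_exp coef_1pX_exp -signr_odd ol mul1r natrM.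
by move=> ol; rewrite coef_1mX_exp coef_1pX_exp -signr_odd; move: ol; case: (odd l) => // _;
   rewrite expr1 natrM; ring.
Qed.

Lemma coef_gleason m a j : (gleason_poly m a)`_j = \sum_(i < m.+1) a i *
  (if (j < i)%N then 0 else
    (signed_conv (4 * (m - i)) (2 * i) (j - i) false)%:R
    - (signed_conv (4 * (m - i)) (2 * i) (j - i) true)%:R).
Proof.
rewrite coef_sum; apply: eq_bigr => i _; rewrite coefZ mulrCA coefXnM.
by rewrite coef_1pX_1mX.
Qed.

Ltac eval_conv := repeat match goal with
  |- context [signed_conv ?a ?b ?j ?s] =>
     let v := eval vm_compute in (signed_conv a b j s) in
     change (signed_conv a b j s) with v end.

Section SmallLengths.
Variables (n m : nat) (C : code n).
Hypotheses (nE : n = (8 * m)%N) (m0 : (0 < m)%N) (neC : near_extremal_type_I C).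

(** These equations are triangular and determine the Gleason coefficients, hence
    the whole weight distribution. *)
Lemma typeI_coef : exists2 a, a m = 0 /\
   (forall j, (j < m)%N -> (gleason_poly m a)`_j = (j == 0)%:R) &
   (forall j, #|codewords C (2 * j)|%:R = (gleason_poly m a)`_j).
Proof.
have [a aE] := typeI_gleason nE m0 neC; have [w wE] := shadow_vector nE m0 neC.
exists a; last by move=> j; rewrite (gleason_coef _ aE).
by split; [exact: (gleason_top nE m0 neC aE wE) | move=> j; apply: (gleason_low nE m0 neC aE)].
Qed.

End SmallLengths.

Lemma count1 n (C : code n) : n = (8 * 1)%N -> near_extremal_type_I C -> #|codewords C 2| = 4%N.
Proof.
move=> nE neC; have [a [am low] AE] := typeI_coef nE isT neC; apply/eqP; rewrite -(eqr_nat rat) (AE 1%N).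
move: am (low 0%N); rewrite !coef_gleason !big_ord_recr !big_ord0 /=; eval_conv.
move=> a1 /(_ isT) h; apply/eqP; clear -a1 h; lra.
Qed.

Lemma count2 n (C : code n) : n = (8 * 2)%N -> near_extremal_type_I C -> #|codewords C 4| = 12%N /\ #|codewords C 6| = 64%N.
Proof.
move=> nE neC; have [a [am low] AE] := typeI_coef nE isT neC.
have h2 := AE 2%N; have h3 := AE 3%N; move: am (low 0%N) (low 1%N) h2 h3.
rewrite !coef_gleason !big_ord_recr !big_ord0 /=; eval_conv.
move=> a2 /(_ isT) h0 /(_ isT) h1 h2 h3.
split; apply/eqP; rewrite -(eqr_nat rat); apply/eqP; rewrite ?h2 ?h3; clear -a2 h0 h1; lra.
Qed.

Lemma count3 n (C : code n) : n = (8 * 3)%N -> near_extremal_type_I C -> #|codewords C 6| = 64%N.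
Proof.
move=> nE neC; have [a [am low] AE] := typeI_coef nE isT neC; apply/eqP; rewrite -(eqr_nat rat) (AE 3%N).
move: am (low 0%N) (low 1%N) (low 2%N); rewrite !coef_gleason !big_ord_recr !big_ord0 /=; eval_conv.
by move=> a1 /(_ isT) h0 /(_ isT) h1 /(_ isT) h2; apply/eqP; clear -a1 h0 h1 h2; lra.
Qed.

Lemma count4 n (C : code n) : n = (8 * 4)%N -> near_extremal_type_I C -> #|codewords C 8| = 364%N.
Proof.
move=> nE neC; have [a [am low] AE] := typeI_coef nE isT neC; apply/eqP; rewrite -(eqr_nat rat) (AE 4%N).
move: am (low 0%N) (low 1%N) (low 2%N) (low 3%N); rewrite !coef_gleason !big_ord_recr !big_ord0 /=; eval_conv.
by move=> a1 /(_ isT) h0 /(_ isT) h1 /(_ isT) h2 /(_ isT) h3; apply/eqP; clear -a1 h0 h1 h2 h3; lra.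
Qed.

(** For a self-dual code, the union of the words of C and of its dual takes each
    block twice. *)
Lemma t_design_half (T : finType) t (B : seq {set T}) : t_design t (B ++ B) -> t_design t B.
Proof.
case/t_designP=> k [l /and4P[Tv tk]]; rewrite all_cat andbb => Bk /forallP h.
apply/t_designP; exists k, l./2; apply/and4P; split=> //.
apply/forallP => A; apply/implyP => At; have /implyP/(_ At) := h A.
by rewrite count_cat addnn => /eqP <-; rewrite doubleK.
Qed.

Section TypeIDesigns.
Variables (n m : nat) (C : code n).
Hypotheses (nE : n = (8 * m)%N) (m0 : (0 < m)%N) (neC : near_extremal_type_I C).

Lemma size_support_design w : size (support_design C w) = #|codewords C w|.
Proof. by rewrite size_map -cardE. Qed.

Lemma typeI_design1 w : (0 < w)%N -> t_design 1 (support_design C w).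
Proof.
move=> w0; apply: t_design_half; rewrite -{2}(typeI_sd neC).
exact: (fsd_design1 nE m0 (typeI_fsd neC)).
Qed.

Lemma typeI_design2 r : kraw2 m r = 0 -> t_design 2 (support_design C (2 * m + 2 * r)).
Proof.
move=> k0; apply: t_design_half; rewrite -{2}(typeI_sd neC).
exact: (fsd_design2 nE m0 (typeI_fsd neC)).
Qed.

Lemma typeI_union_sum s w : union_sum C s w =
  2 * \sum_(b <- support_design C w) \prod_(e <- s) bdiff e.1 e.2 b.
Proof. by rewrite union_sum_blocks big_cat typeI_sd //= mulr_natl mulr2n. Qed.

(** By [fsd_deg2] the degree 2 sums at weight 2m + 2r are a * kraw2 m r.  If they
    vanish while kraw2 m r does not, then a = 0, and the sums vanish at the
    minimum weight too. *)
Lemma typeI_design2_min r : kraw2 m r != 0 ->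
  t_design 2 (support_design C (2 * m + 2 * r)) -> t_design 2 (support_design C (2 * m)).
Proof.
move=> kr d; have fC := typeI_fsd neC.
apply: (@design2_criterion _ _ (2 * m)); rewrite ?card_ord.
- by lia.
- by move: nE; lia.
- exact: support_design_card.
- move=> x y xy; have := fsd_deg1 nE m0 fC (2 * m) xy.
  rewrite typeI_union_sum; under eq_bigr do rewrite big_seq1.
  by move/eqP; rewrite mulf_eq0 /= => /eqP.
move=> x y z u Us; have [a h] := fsd_deg2 nE m0 fC Us.
have := h r; have := h 0%N; rewrite muln0 addn0 !typeI_union_sum.
under eq_bigr do rewrite big_cons big_seq1.
under [in X in _ -> X -> _]eq_bigr do rewrite big_cons big_seq1.
rewrite (design2_sum0 d Us) mulr0 => h0 /esym/eqP.
rewrite mulf_eq0 (negPf kr) orbF => /eqP a0; move/eqP: h0.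
by rewrite a0 mul0r mulf_eq0 /= => /eqP.
Qed.

Lemma design2_words w : t_design 2 (support_design C w) -> (0 < #|codewords C w|)%N ->
  exists2 l, is_design 2 n w l (support_design C w) &
  (l * (n * (n - 1)) = #|codewords C w| * (w * (w - 1)))%N.
Proof.
case/t_designP=> k [l d] ne; exists l.
  have /and4P[Tn k2 Bk h] := d.
  have kw : k = w.
    have := support_design_card C w; move: Bk ne; rewrite -size_support_design.
    by case: (support_design C w) => //= b B /andP[/eqP <- _] _ /andP[/eqP <-].
  by move: d; rewrite kw card_ord.
have n0 : (0 < #|'I_n|)%N by rewrite card_ord; move: nE; lia.
have := design2_count d n0; rewrite card_ord size_support_design => ->.
have /and4P[_ _ Bk _] := d.
have := support_design_card C w; move: Bk ne; rewrite -size_support_design.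
by case: (support_design C w) => //= b B /andP[/eqP <- _] _ /andP[/eqP <-].
Qed.

Lemma min_words : (0 < #|codewords C (2 * m)|)%N.
Proof.
have [_ ne] := neC; have nm : (n %/ 8 = m)%N by rewrite nE mulKn.
have [c cC] := min_distance_word ne; rewrite nm in cC.
by apply/card_gt0P; exists c.
Qed.

Lemma weight_range (w : 'I_n) : is_weight C w ->
  exists2 r, (r <= 2 * m)%N & w = (2 * m + 2 * r)%N :> nat.
Proof.
case/andP=> w0 /set0Pn[c]; rewrite inE => /andP[cC /eqP wc].
have c0 : c != 0 by rewrite -wt_eq0 wc -lt0n.
have c1 : c != ones n.
  by apply: contraTneq (ltn_ord w) => c1; rewrite -wc c1 wt_ones ltnn.
have /andP[lo hi] := gapped_range nE m0 (fsd_gapped nE (typeI_fsd neC)) cC c0 c1.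
have := typeI_even neC cC; rewrite wc dvdn2 => ew; rewrite wc in lo hi.
have := odd_double_half w; rewrite (negPf ew) => e.
by exists (w./2 - m)%N; lia.
Qed.

Lemma design_delta_ge1 : (1 <= design_delta C)%N.
Proof.
have n1 : (1 < n.+1)%N by move: nE; lia.
apply: (bigop.bigmax_sup (Ordinal n1)) => //; apply/forallP => w; apply/implyP => /andP[w0 _].
exact: typeI_design1.
Qed.

End TypeIDesigns.

(** A 2-design would have l n (n - 1) = A w (w - 1) with w = 2m and A words of
    weight w.  The right-hand side is 8, 144, 1920, 20384 for m = 1, 2, 3, 4,
    which is divisible by none of the respective n (n - 1) = 56, 240, 552, 992. *)
Lemma min_not_design2 n m (C : code n) : n = (8 * m)%N -> (0 < m <= 4)%N ->
  near_extremal_type_I C -> ~ t_design 2 (support_design C (2 * m)).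
Proof.
move=> nE /andP[m0 m4] neC d.
have [l _ e] := design2_words nE m0 d (min_words nE neC).
have [|[|[|]]] : (m = 1 \/ m = 2 \/ m = 3 \/ m = 4)%N by lia.
- by move=> mE; subst m; rewrite (count1 nE neC) in e; move: nE e; clear; lia.
- by move=> mE; subst m; rewrite (proj1 (count2 nE neC)) in e; move: nE e; clear; lia.
- by move=> mE; subst m; rewrite (count3 nE neC) in e; move: nE e; clear; lia.
- by move=> mE; subst m; rewrite (count4 nE neC) in e; move: nE e; clear; lia.
Qed.

(** For m = 1, 3, 4 the coefficients kraw2 m r with r <= 2m are all non-zero, so a
    2-design at any weight would give one at the minimum weight. *)
Lemma design_s_le1 n m (C : code n) : n = (8 * m)%N -> (0 < m <= 4)%N -> m != 2%N ->
  near_extremal_type_I C -> (design_s C <= 1)%N.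
Proof.
move=> nE m4 m2 neC; have /andP[m0 _] := m4.
apply/bigop.bigmax_leqP => t /existsP[w /andP[Cw dw]].
rewrite leqNgt; apply/negP => t2.
have [r rm wr] := weight_range nE m0 neC Cw.
have := t_design_mono t2 dw; rewrite wr => d.
apply: (min_not_design2 nE m4 neC); apply: (typeI_design2_min nE m0 neC _ d).
rewrite kraw2_eq0; move: (nat_of_ord t) => _; clear -m4 m2 rm.
pose test M r := ('C(2 * M - 2, r) + bin_shift (2 * M - 2) r 2 != 2 * bin_shift (2 * M - 2) r 1)%N.
suff /allP : all (test m) (iota 0 (2 * m).+1) by apply; rewrite mem_iota.
have [|[|[|]]] : (m = 1 \/ m = 2 \/ m = 3 \/ m = 4)%N by lia.
- by move=> ->; vm_compute.
- by move=> mE; rewrite mE in m2.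
- by move=> ->; vm_compute.
- by move=> ->; vm_compute.
Qed.

Lemma design_delta_le1 n (C : code n) : n = (8 * 2)%N -> near_extremal_type_I C ->
  (design_delta C <= 1)%N.
Proof.
move=> nE neC; apply/bigop.bigmax_leqP => t /forallP h.
rewrite leqNgt; apply/negP => t2.
apply: (min_not_design2 nE isT neC); apply: t_design_mono t2 _.
have w4 : (2 * 2 < n)%N by rewrite nE.
have /implyP := h (Ordinal w4); apply; rewrite /is_weight /=.
by rewrite -card_gt0 (min_words nE neC).
Qed.

(** The coefficient of z in (1 - z)^2 (1 + z)^2 is zero, and the 64 words of
    weight 6 give l = 64 * 30 / 240 = 8. *)
Lemma design_C6 n (C : code n) : n = (8 * 2)%N -> near_extremal_type_I C ->
  is_design 2 16 6 8 (support_design C 6).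
Proof.
move=> nE neC.
have d : t_design 2 (support_design C (2 * 2 + 2 * 1)).
  by apply: (typeI_design2 nE isT neC); apply/eqP; rewrite kraw2_eq0.
have [_ c6] := count2 nE neC.
have ne : (0 < #|codewords C 6|)%N by rewrite c6.
have [l dl e] := design2_words nE isT d ne.
have lE : l = 8%N by rewrite c6 in e; move: nE e; clear; lia.
have cast v : n = v -> is_design 2 v 6 l (support_design C 6) by move=> <-.
by rewrite -lE; apply: cast; rewrite nE lE.
Qed.

Lemma design_s_ge2 n (C : code n) : n = (8 * 2)%N -> near_extremal_type_I C ->
  (2 <= design_s C)%N.
Proof.
move=> nE neC; have [_ c6] := count2 nE neC.
have w6 : (6 < n)%N by rewrite nE.
have t2 : (2 < n.+1)%N by rewrite nE.
apply: (bigop.bigmax_sup (Ordinal t2)) => //; apply/existsP; exists (Ordinal w6).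
rewrite /is_weight /= -card_gt0 c6 /=; apply/t_designP; exists 6%N, 8%N.
have cast v : v = 16%N -> is_design 2 v 6 8 (support_design C 6).
  by move=> ->; apply: design_C6.
by apply: cast; rewrite card_ord nE.
Qed.

Lemma complement_C10 n (C : code n) : n = (8 * 2)%N -> near_extremal_type_I C ->
  perm_eq (support_design C 10) (complement_design (support_design C 6)).
Proof.
move=> nE neC; have [_ oC _] := fsd_gapped nE (typeI_fsd neC).
have compl c : supp (c + ones n) = ~: supp c.
  apply/setP => i; rewrite !inE !mxE.
  by case: (F2_cases (c ord0 i)) => ->; rewrite ?add0r ?F2_addrr eqxx oner_eq0.
have ones2 c : c + ones n + ones n = c.
  by apply/rowP => i; rewrite !mxE -addrA F2_addrr addr0.
rewrite /complement_design /support_design -map_comp.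
rewrite (eq_map (g := fun c => supp (c + ones n))) => [|c]; last by rewrite /= compl.
rewrite (map_comp (@supp n) (fun c => c + ones n)); apply: perm_map.
apply: uniq_perm; rewrite ?enum_uniq // ?map_inj_uniq ?enum_uniq //; first exact: addIr.
move=> c; rewrite mem_enum inE; apply/andP/mapP => [[cC /eqP wc]|[x]].
  exists (c + ones n); last by rewrite ones2.
  by rewrite mem_enum inE rpredD //= wt_addones wc; apply/eqP; move: nE; lia.
rewrite mem_enum inE => /andP[xC /eqP wx] ->; rewrite rpredD // wt_addones wx.
by split=> //; apply/eqP; move: nE; lia.
Qed.

Lemma typeI_16_params n (C : code n) : n = (8 * 2)%N -> near_extremal_type_I C ->
  is_type_I_16_8_4 C.
Proof.
move=> nE neC; split=> //; split; first by rewrite nE.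
  have := fsd_card nE isT (typeI_fsd neC).
  rewrite card_vspace card_Fp // => /eqP; rewrite eqn_exp2l // => /eqP ->.
  by [].
by have [_ +] := neC; rewrite /near_extremal; have -> : (n %/ 8 = 2)%N by rewrite nE.
Qed.

(** * Uniqueness of the code of length 16 *)

Section CoordinateWords.
Variable n : nat.
Implicit Types (u v c : 'rV['F_2]_n) (x : 'I_n) (S : seq 'I_n) (I J K : seq nat).

Lemma addvv v : v + v = 0.
Proof. by apply/rowP => i; rewrite !mxE F2_addrr. Qed.

Lemma addvK u v : u + v + v = u.
Proof. by rewrite -addrA addvv addr0. Qed.

Definition unit_word (i : 'I_n) : 'rV['F_2]_n := \row_j (j == i)%:R.

Lemma inner_unit c (i : 'I_n) : inner c (unit_word i) = c ord0 i.
Proof.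
rewrite /inner (bigD1 i) //= mxE eqxx mulr1 big1 ?addr0 // => j /negPf ji.
by rewrite mxE ji mulr0.
Qed.

(** The word supported by the coordinates of S at the positions I, the positions
    being counted modulo 2.  Fixing S and computing with lists of positions turns
    calculations in the code into evaluations of [same_parity]. *)
Definition word (x0 : 'I_n) S I : 'rV['F_2]_n := \sum_(i <- I) unit_word (nth x0 S i).

Lemma word_cat x0 S I J : word x0 S (I ++ J) = word x0 S I + word x0 S J.
Proof. exact: big_cat. Qed.

Lemma inner_word x0 S c I : inner c (word x0 S I) = \sum_(i <- I) c ord0 (nth x0 S i).
Proof.
rewrite /word; elim: I => [|i I IH].
  by rewrite !big_nil /inner big1 // => j _; rewrite mxE mulr0.
by rewrite !big_cons innerDr inner_unit IH.
Qed.

Definition same_parity N I J : bool :=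
  [&& all (fun i => i < N)%N I, all (fun i => i < N)%N J &
   all (fun k => odd (count_mem k I) == odd (count_mem k J)) (iota 0 N)].

Lemma word_parityE x0 S N I : all (fun i => i < N)%N I ->
  word x0 S I = \sum_(k <- iota 0 N) unit_word (nth x0 S k) *+ odd (count_mem k I).
Proof.
move=> IN; rewrite /word; elim: I IN => [_|i I IH /andP[iN /IH{}IH]].
  by rewrite big_nil big1.
rewrite big_cons {}IH /= [in RHS](bigD1_seq i) ?iota_uniq ?mem_iota //=.
rewrite (bigD1_seq i) ?iota_uniq ?mem_iota //= addrA eqxx; congr (_ + _).
  by rewrite oddD; case: (odd _) => /=; rewrite ?mulr1n ?addvv ?addr0.
by apply: eq_bigr => k /negPf ki; rewrite eq_sym ki.
Qed.

Lemma same_parity_word x0 S N I J : same_parity N I J -> word x0 S I = word x0 S J.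
Proof.
case/and3P=> IN JN /allP h; rewrite (word_parityE _ _ IN) (word_parityE _ _ JN).
by rewrite big_seq [RHS]big_seq; apply: eq_bigr => k /h/eqP ->.
Qed.

Lemma word_combine (C : code n) x0 S N I J K : word x0 S I \in C -> word x0 S J \in C ->
  same_parity N (I ++ J) K -> word x0 S K \in C.
Proof. by move=> IC JC /same_parity_word <-; rewrite word_cat rpredD. Qed.

Lemma word_coef x0 S I j : uniq S -> (j < size S)%N ->
  all (fun i => i < size S)%N I ->
  word x0 S I ord0 (nth x0 S j) = (count_mem j I)%:R.
Proof.
move=> US jS; elim: I => [|i I IH] /=; first by rewrite /word big_nil mxE.
case/andP=> iS /IH{}IH; rewrite /word big_cons mxE -/(word x0 S I) IH mxE.
by rewrite nth_uniq // natrD eq_sym.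
Qed.

Lemma word_coef_out x0 S I x : x \notin S -> all (fun i => i < size S)%N I ->
  word x0 S I ord0 x = 0.
Proof.
move=> xS; elim: I => [|i I IH] /=; first by rewrite /word big_nil mxE.
case/andP=> iS /IH{}IH; rewrite /word big_cons mxE -/(word x0 S I) IH mxE addr0.
by case: eqP => // e; rewrite e mem_nth in xS.
Qed.

Lemma supp_word x0 S I : uniq S -> uniq I -> all (fun i => i < size S)%N I ->
  supp (word x0 S I) = [set x in map (nth x0 S) I].
Proof.
move=> US UI IS; apply/setP => x; rewrite !inE.
have [xS|xS] := boolP (x \in S); last first.
  rewrite (word_coef_out _ xS) // eqxx; apply/esym/negP => /mapP[i iI xE].
  by rewrite xE mem_nth ?(allP IS) in xS.
rewrite -(nth_index x0 xS) word_coef ?index_mem // count_uniq_mem //.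
rewrite [RHS](_ : _ = (index x S \in I)); first by case: (_ \in _).
apply/mapP/idP => [[i iI]|iI]; last by exists (index x S).
by rewrite nth_index // => ->; rewrite index_uniq ?(allP IS).
Qed.

Lemma wt_word x0 S I : uniq S -> uniq I -> all (fun i => i < size S)%N I ->
  wt (word x0 S I) = size I.
Proof.
move=> US UI IS; rewrite /wt supp_word // cardsE (card_uniqP _) ?size_map //.
by rewrite map_inj_in_uniq // => i j iI jI /eqP; rewrite nth_uniq ?(allP IS) // => /eqP.
Qed.

Lemma word_expand x0 S c : uniq S -> (forall x, x \in S) ->
  c = word x0 S [seq k <- iota 0 (size S) | c ord0 (nth x0 S k) != 0].
Proof.
move=> US aS; apply/rowP => x; set I := [seq _ <- _ | _].
have IS : all (fun i => i < size S)%N I.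
  by apply/allP => i; rewrite mem_filter mem_iota => /andP[_].
have xS : (index x S < size S)%N by rewrite index_mem.
rewrite -[in RHS](nth_index x0 (aS x)) word_coef // count_uniq_mem ?filter_uniq ?iota_uniq //.
rewrite mem_filter mem_iota /= add0n xS andbT nth_index //.
by case: (F2_cases (c ord0 x)) => ->.
Qed.

Lemma notin_self_dual (C : code n) v : dual C = C -> v \notin C ->
  exists2 c, c \in C & inner v c = 1.
Proof.
move=> sd vC; have [/exists_inP[c cC /eqP e]|] := boolP [exists c in C, inner v c == 1].
  by exists c.
rewrite negb_exists_in => /forall_inP h; case/negP: vC; rewrite -sd; apply/dualP => c cC.
by have := h c cC; case: (F2_cases (inner v c)) => ->.
Qed.

End CoordinateWords.

Lemma supp_inj n : injective (@supp n).
Proof.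
move=> u v e; apply/rowP => i; have := congr1 (fun A : {set 'I_n} => i \in A) e.
by rewrite !inE; case: (F2_cases (u ord0 i)) (F2_cases (v ord0 i)) => -> [] ->.
Qed.

Lemma word_inj n (x0 : 'I_n) S I J : uniq S ->
  all (fun i => i < size S)%N I -> all (fun i => i < size S)%N J ->
  word x0 S I = word x0 S J -> same_parity (size S) I J.
Proof.
move=> US IS JS e; apply/and3P; split=> //; apply/allP => k; rewrite mem_iota add0n => /andP[_ kS].
have := congr1 (fun u : 'rV['F_2]_n => u ord0 (nth x0 S k) == 0) e.
by rewrite !word_coef // !F2_nat_eq0 => /negb_inj ->.
Qed.

Lemma set2_with (T : finType) (A : {set T}) p : p \in A -> #|A| = 2%N ->
  exists2 x, x != p & A = [set p; x].
Proof.
move=> pA A2; have : #|A :\ p| = 1%N by move: (cardsD1 p A); rewrite pA A2; lia.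
case/eqP/cards1P=> x e; exists x; last by rewrite -e setD1K.
by have : x \in A :\ p; [rewrite e set11 | rewrite !inE => /andP[]].
Qed.

Section Tetrads.
Variable C : code 16.
Hypothesis neC : near_extremal_type_I C.

Let nE : 16%N = (8 * 2)%N. Proof. by []. Qed.
Let sd : dual C = C. Proof. exact: typeI_sd neC. Qed.

Let min4 c : c \in C -> c != 0 -> (4 <= wt c)%N.
Proof. by move=> cC c0; have [_ _ ->] := fsd_gapped nE (typeI_fsd neC). Qed.

Definition tetrads x := [set c in codewords C 4 | c ord0 x != 0].

Lemma tetradsP x c : reflect [/\ c \in C, wt c = 4%N & x \in supp c] (c \in tetrads x).
Proof.
by rewrite !inE; apply: (iffP andP) => [[/andP[cC /eqP w4] cx]|[-> -> ->]].
Qed.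

(** The twelve words of weight 4 form a 1-design, with 12 * 4 / 16 = 3 blocks
    through a point. *)
Lemma card_tetrads x : #|tetrads x| = 3%N.
Proof.
have [c4 _] := count2 nE neC.
have /t_designP[k [l d]] := typeI_design1 nE isT neC (isT : 0 < 4)%N.
have /and4P[_ _ _ /forallP h] := d.
have cl y : cover_count (support_design C 4) [set y] = l.
  by have /implyP/(_ _)/eqP := h [set y]; apply; rewrite cards1.
have := count_extensions set0 (support_design_card C 4).
rewrite cards0 subn0 (_ : cover_count _ set0 = 12)%N; last first.
  apply: etrans c4; rewrite -size_support_design; apply/eqP; rewrite -all_count.
  by apply/allP => b _; apply: sub0set.
rewrite (eq_bigr (fun=> l)) => [|y _]; last by rewrite setU0 cl.
rewrite sum_nat_const => e.
have l3 : l = 3%N.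
  move: e; rewrite (_ : #|_| = 16%N) => [|]; first by lia.
  by rewrite -[RHS]card_ord; apply: eq_card => y; rewrite [LHS]unfold_in /= inE.
apply: etrans l3; rewrite -(cl x) -sum1_card /cover_count -sum1_count big_map big_enum_cond /=.
by apply: eq_bigl => c; rewrite !inE sub1set inE.
Qed.

Lemma only_three x u1 u2 u3 c :
  u1 \in tetrads x -> u2 \in tetrads x -> u3 \in tetrads x ->
  u1 != u2 -> u1 != u3 -> u2 != u3 -> c \in tetrads x -> c \in [:: u1; u2; u3].
Proof.
move=> h1 h2 h3 n12 n13 n23 cx.
have e : [set u1; u2; u3] = tetrads x.
  apply/eqP; rewrite eqEcard card_tetrads; apply/andP; split.
    by apply/subsetP => u /setUP[/set2P[]->|/set1P->].
  by rewrite setUC cardsU1 cards2 !inE negb_or n12 ![u3 == _]eq_sym n13 n23.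
by move: cx; rewrite -e !inE orbA.
Qed.

(** The supports meet in an even number of points, and the sum of the two words
    has weight at least 4. *)
Lemma inter2 c c' p : c \in tetrads p -> c' \in tetrads p -> c != c' ->
  #|supp c :&: supp c'| = 2%N.
Proof.
move=> /tetradsP[cC c4 pc] /tetradsP[c'C c'4 pc'] ne.
have := wt_add c c'; rewrite c4 c'4 => w.
have s0 : c + c' != 0.
  apply: contraNneq ne => e; rewrite -(addvK c c') e add0r //.
have := min4 (rpredD cC c'C) s0.
have : (0 < #|supp c :&: supp c'|)%N by apply/card_gt0P; exists p; rewrite inE pc pc'.
have : ~~ odd #|supp c :&: supp c'|.
  rewrite -F2_nat_eq0 -inner_supp; move: c'C; rewrite -{1}sd => /dualP/(_ c cC).
  by rewrite innerC => ->.
by move: w; move: #|supp c :&: supp c'| (wt (c + c')) => k u; clear; lia.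
Qed.

(** A star is a list of eight points, read as four consecutive pairs, such that
    the first pair together with any other one is the support of a word. *)
Definition star x0 S := [/\ uniq S, size S = 8%N, word x0 S [:: 0; 1; 2; 3]%N \in C,
  word x0 S [:: 0; 1; 4; 5]%N \in C & word x0 S [:: 0; 1; 6; 7]%N \in C].

(** The three tetrads c1, c2, c3 through p meet pairwise in two points.  They
    share the second point as well: otherwise, with x the other point of c1 and
    c2, the words c1, c2, c1 + c3 and c2 + c3 would be four tetrads through x.
    Removing the common pair leaves three disjoint pairs. *)
Lemma star_exists p : exists2 S, star p S & nth p S 0 = p.
Proof.
have : (2 < #|tetrads p|)%N by rewrite card_tetrads.
case/card_gt2P=> c1 [c2 [c3 [[h1 h2 h3] [n12 n23 n31]]]].
have i12 := inter2 h1 h2 n12; have i23 := inter2 h2 h3 n23; have i31 := inter2 h3 h1 n31.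
have /tetradsP[c1C c14 p1] := h1; have /tetradsP[c2C c24 p2] := h2.
have /tetradsP[c3C c34 p3] := h3.
have [|x xp e12] := @set2_with _ (supp c1 :&: supp c2) p _ i12; first by rewrite inE p1.
have : x \in supp c1 :&: supp c2 by rewrite e12 !inE eqxx orbT.
rewrite inE => /andP[x1 x2].
have x3 : x \in supp c3.
  apply/negPn/negP => x3.
  have in_add u v : x \in supp u -> x \notin supp v -> x \in supp (u + v).
    by rewrite !inE mxE negbK => ux /eqP ->; rewrite addr0.
  have wt4 u v : u \in tetrads p -> v \in tetrads p -> u != v -> wt (u + v) = 4%N.
    move=> hu hv uv; have := wt_add u v; rewrite (inter2 hu hv uv).
    case/tetradsP: hu => _ -> _; case/tetradsP: hv => _ -> _.
    by move: (wt (u + v)) => k; clear; lia.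
  have p_out u v : p \in supp u -> p \in supp v -> p \notin supp (u + v).
    rewrite !inE mxE negbK.
    by case: (F2_cases (u ord0 p)) (F2_cases (v ord0 p)) => -> [] ->.
  have hx1 : c1 \in tetrads x by apply/tetradsP.
  have hx2 : c2 \in tetrads x by apply/tetradsP.
  have hx13 : c1 + c3 \in tetrads x.
    by apply/tetradsP; split; [exact: rpredD | rewrite wt4 // eq_sym | exact: in_add].
  have hx23 : c2 + c3 \in tetrads x.
    by apply/tetradsP; split; [exact: rpredD | rewrite wt4 | exact: in_add].
  have ne1 u v w : p \in supp w -> p \in supp u -> p \in supp v -> w != u + v.
    by move=> pw pu pv; apply: contraTneq pw => ->; apply: p_out.
  have n13' : c1 != c1 + c3 by apply: ne1.
  have n23' : c2 != c1 + c3 by apply: ne1.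
  have := only_three hx1 hx2 hx13 n12 n13' n23' hx23.
  rewrite !inE !(eq_sym (c2 + c3)) (negPf (ne1 _ _ _ p1 p2 p3)) (negPf (ne1 _ _ _ p2 p2 p3)).
  by rewrite (inj_eq (addIr c3)) (negPf n12).
have e31 : supp c3 :&: supp c1 = [set p; x].
  apply/esym/eqP; rewrite eqEcard i31 cards2 eq_sym xp andbT.
  by apply/subsetP => y /set2P[]->; rewrite inE ?p3 ?x3.
have e23 : supp c2 :&: supp c3 = [set p; x].
  apply/esym/eqP; rewrite eqEcard i23 cards2 eq_sym xp andbT.
  by apply/subsetP => y /set2P[]->; rewrite inE ?p2 ?x2.
(* The remaining two points of each tetrad; E1, E2, E3 below are the sunflower. *)
have petal c : wt c = 4%N -> p \in supp c -> x \in supp c ->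
    exists a a', a != a' /\ supp c :\: [set p; x] = [set a; a'].
  move=> c4 pc xc; have sub : [set p; x] \subset supp c by apply/subsetP => y /set2P[]->.
  by apply/cards2P; rewrite cardsDS // -/(wt c) c4 cards2 (eq_sym p) xp.
have [a [a' [aa ea]]] := petal c1 c14 p1 x1.
have [b [b' [bb eb]]] := petal c2 c24 p2 x2.
have [d [d' [dd ed]]] := petal c3 c34 p3 x3.
have E1 : supp c1 = [set p; x] :|: [set a; a'].
  by rewrite -ea setUC -e12; apply/setP => y; rewrite !inE; case: (c1 _ _ == 0); case: (c2 _ _ == 0).
have E2 : supp c2 = [set p; x] :|: [set b; b'].
  by rewrite -eb -e12; apply/setP => y; rewrite !inE; case: (c1 _ _ == 0); case: (c2 _ _ == 0).
have E3 : supp c3 = [set p; x] :|: [set d; d'].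
  by rewrite -ed -e31; apply/setP => y; rewrite !inE; case: (c1 _ _ == 0); case: (c3 _ _ == 0).
pose S := [:: p; x; a; a'; b; b'; d; d'].
have US : uniq S.
  have dis u v y z : supp u :&: supp v = [set p; x] -> y \in supp u :\: [set p; x] ->
      z \in supp v :\: [set p; x] -> y != z.
    move=> e; rewrite !inE => /andP[yn yu] /andP[_ zv]; apply: contraNneq yn => yz.
    by have := set2P (_ : y \in [set p; x]); rewrite -e inE [y \in _]inE yu yz inE zv => /(_ isT)[]->; rewrite eqxx ?orbT.
  have ptl c y : y \in supp c :\: [set p; x] -> (p != y) && (x != y).
    by rewrite !inE negb_or ![_ == y]eq_sym => /andP[].
  have A1 : a \in supp c1 :\: [set p; x] by rewrite ea !inE eqxx.
  have A2 : a' \in supp c1 :\: [set p; x] by rewrite ea !inE eqxx orbT.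
  have B1 : b \in supp c2 :\: [set p; x] by rewrite eb !inE eqxx.
  have B2 : b' \in supp c2 :\: [set p; x] by rewrite eb !inE eqxx orbT.
  have D1 : d \in supp c3 :\: [set p; x] by rewrite ed !inE eqxx.
  have D2 : d' \in supp c3 :\: [set p; x] by rewrite ed !inE eqxx orbT.
  rewrite setIC in e31.
  have [pa xa] := andP (ptl _ _ A1).
  have [pa' xa'] := andP (ptl _ _ A2).
  have [pb xb] := andP (ptl _ _ B1).
  have [pb' xb'] := andP (ptl _ _ B2).
  have [pd xd] := andP (ptl _ _ D1).
  have [pd' xd'] := andP (ptl _ _ D2).
  have m1 := dis _ _ _ _ e12 A1 B1.
  have m2 := dis _ _ _ _ e12 A1 B2.
  have m3 := dis _ _ _ _ e12 A2 B1.
  have m4 := dis _ _ _ _ e12 A2 B2.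
  have m5 := dis _ _ _ _ e31 A1 D1.
  have m6 := dis _ _ _ _ e31 A1 D2.
  have m7 := dis _ _ _ _ e31 A2 D1.
  have m8 := dis _ _ _ _ e31 A2 D2.
  have m9 := dis _ _ _ _ e23 B1 D1.
  have m10 := dis _ _ _ _ e23 B1 D2.
  have m11 := dis _ _ _ _ e23 B2 D1.
  have m12 := dis _ _ _ _ e23 B2 D2.
  rewrite /S /= !inE !negb_or (eq_sym p x) xp aa bb dd.
  by rewrite !(pa, xa, pa', xa', pb, xb, pb', xb', pd, xd, pd', xd', m1, m2, m3, m4, m5, m6, m7, m8, m9, m10, m11, m12).
exists S => //; split=> //.
- suff -> : word p S [:: 0; 1; 2; 3]%N = c1 by [].
  by apply: supp_inj; rewrite supp_word // E1; apply/setP => y; rewrite !inE !orbA.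
- suff -> : word p S [:: 0; 1; 4; 5]%N = c2 by [].
  by apply: supp_inj; rewrite supp_word // E2; apply/setP => y; rewrite !inE !orbA.
- suff -> : word p S [:: 0; 1; 6; 7]%N = c3 by [].
  by apply: supp_inj; rewrite supp_word // E3; apply/setP => y; rewrite !inE !orbA.
Qed.

Definition pair_word i j : seq nat := [:: i.*2; i.*2.+1; j.*2; j.*2.+1].

Lemma star_pair_word x0 S i j : star x0 S -> (i < 4)%N -> (j < 4)%N -> i != j ->
  word x0 S (pair_word i j) \in C.
Proof.
case=> _ _ w1 w2 w3 i4 j4 ij.
have w12 := word_combine (N := 8) (K := pair_word 1 2) w1 w2 isT.
have w13 := word_combine (N := 8) (K := pair_word 1 3) w1 w3 isT.
have w23 := word_combine (N := 8) (K := pair_word 2 3) w2 w3 isT.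
have sym a b : (a < 4)%N -> (b < 4)%N -> word x0 S (pair_word a b) = word x0 S (pair_word b a).
  move=> a4 b4; apply: (@same_parity_word _ _ _ 8).
  by move: a b a4 b4 => [|[|[|[|?]]]] [|[|[|[|?]]]].
wlog lt : i j i4 j4 ij / (i < j)%N.
  move=> h; have [lt|lt|e] := ltngtP i j; first exact: h.
    by rewrite sym //; apply: h => //; rewrite eq_sym.
  by rewrite e eqxx in ij.
by move: i j i4 j4 {ij} lt => [|[|[|[|?]]]] [|[|[|[|?]]]].
Qed.

(** Each point of a star is on three words formed by two of its pairs, and there
    is no fourth tetrad through it. *)
Lemma star_tetrads x0 S k c : star x0 S -> (k < 8)%N -> c \in tetrads (nth x0 S k) ->
  exists2 i, (i < 4)%N && (i != k./2) & c = word x0 S (pair_word k./2 i).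
Proof.
move=> st k8 cT; have [US S8 _ _ _] := st.
have tet i : (i < 4)%N -> i != k./2 -> word x0 S (pair_word k./2 i) \in tetrads (nth x0 S k).
  move=> i4 ik; have Uw : uniq (pair_word k./2 i).
    by move: k i k8 i4 ik {cT} => [|[|[|[|[|[|[|[|?]]]]]]]] [|[|[|[|?]]]].
  have lt8 : all (fun l => l < size S)%N (pair_word k./2 i).
    by rewrite S8; move: k i k8 i4 ik {cT Uw} => [|[|[|[|[|[|[|[|?]]]]]]]] [|[|[|[|?]]]].
  apply/tetradsP; split.
  - apply: star_pair_word => //; last by rewrite eq_sym.
    by move: k k8 {i4 ik cT Uw lt8} => [|[|[|[|[|[|[|[|?]]]]]]]].
  - by rewrite wt_word.
  rewrite inE word_coef ?S8 //; last by rewrite -S8.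
  rewrite F2_nat_eq0 negbK.
  by move: k i k8 i4 ik {cT Uw lt8} => [|[|[|[|[|[|[|[|?]]]]]]]] [|[|[|[|?]]]].
have ne i j : (i < 4)%N -> (j < 4)%N -> i != j -> i != k./2 -> j != k./2 ->
    word x0 S (pair_word k./2 i) != word x0 S (pair_word k./2 j).
  move=> i4 j4 ij ik jk; apply/eqP => /word_inj e.
  have lt8 l : (l < 4)%N -> all (fun l => l < size S)%N (pair_word k./2 l).
    by rewrite S8; move: k l k8 {ik jk cT tet e} => [|[|[|[|[|[|[|[|?]]]]]]]] [|[|[|[|?]]]].
  have := e US (lt8 i i4) (lt8 j j4); rewrite S8.
  by move: k k8 i j i4 j4 ij ik jk {e tet lt8 cT} => [|[|[|[|[|[|[|[|?]]]]]]]] // _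
    [|[|[|[|?]]]] // [|[|[|[|?]]]].
(* The three other pairs of the star give all three tetrads. *)
have [i1 [i2 [i3 [/and3P[a1 a2 a3] /and3P[b1 b2 b3] /and3P[d1 d2 d3]]]]] :
    exists i1 i2 i3, [/\ [&& i1 < 4, i2 < 4 & i3 < 4]%N,
     [&& i1 != k./2, i2 != k./2 & i3 != k./2] & [&& i1 != i2, i1 != i3 & i2 != i3]].
  have : (k./2 < 4)%N by lia.
  by case: (k./2) => [|[|[|[|?]]]] // _; [exists 1%N, 2%N, 3%N | exists 0%N, 2%N, 3%N | exists 0%N, 1%N, 3%N | exists 0%N, 1%N, 2%N].
have := only_three (tet _ a1 b1) (tet _ a2 b2) (tet _ a3 b3)
  (ne _ _ a1 a2 d1 b1 b2) (ne _ _ a1 a3 d2 b1 b3) (ne _ _ a2 a3 d3 b2 b3) cT.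
rewrite !inE => /or3P[]/eqP e; [exists i1|exists i2|exists i3] => //; exact/andP.
Qed.

Lemma star_tetrads_sub x0 S k c x : star x0 S -> (k < 8)%N ->
  c \in tetrads (nth x0 S k) -> x \in supp c -> x \in S.
Proof.
move=> st k8 /(star_tetrads st k8)[i /andP[i4 _] ->]; apply: contraTT => xS.
rewrite inE negbK word_coef_out //; have [_ -> _ _ _] := st.
by move: k i k8 i4 => [|[|[|[|[|[|[|[|?]]]]]]]] // [|[|[|[|?]]]].
Qed.

(** A tetrad through a point of the first pair contains the whole pair. *)
Lemma star_partner x0 S c : star x0 S -> c \in tetrads (nth x0 S 0) ->
  c ord0 (nth x0 S 1) != 0.
Proof.
move=> st /(star_tetrads st (isT : 0 < 8)%N)[i /andP[i4 i0] ->].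
have [US S8 _ _ _] := st; rewrite word_coef ?S8 // ?F2_nat_eq0 ?negbK.
  by move: i i4 i0 => [|[|[|[|?]]]].
by move: i i4 i0 => [|[|[|[|?]]]].
Qed.

Definition frame x0 S := [/\ uniq S, size S = 16%N, star x0 (take 8 S) & star x0 (drop 8 S)].

(** Take the star S1 of one point and the star S2 of a point q outside S1.  If S2
    contained a point x of S1, some word of S2 would contain both q and x; being
    a tetrad through x it would lie inside S1 by [star_tetrads_sub], and so
    would q. *)
Lemma frame_exists x0 : exists S, frame x0 S.
Proof.
have change p S : star p S -> star x0 S.
  case=> US S8; have e I : all (fun i => i < 8)%N I -> word p S I = word x0 S I.
    move=> I8; rewrite /word big_seq [RHS]big_seq; apply: eq_bigr => i iI.
    by rewrite (set_nth_default x0) // S8 (allP I8).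
  by rewrite !e //; split.
have [S1 /change st1 _] := star_exists x0.
have [US1 S18 _ _ _] := st1.
have [q qS1] : exists q, q \notin S1.
  apply/existsP; rewrite -negb_forall; apply/negP => /forallP h.
  have := max_card (mem S1); have /card_uniqP := US1; rewrite S18 => e.
  have : #|S1| = #|'I_16| by apply: eq_card => x; rewrite h.
  by rewrite e card_ord.
have [S2 /change st2 qE] := star_exists q.
have [US2 S28 w1 w2 w3] := st2.
have q0 : nth x0 S2 0 = q by rewrite -qE (set_nth_default x0) // S28.
have disj x : x \in S2 -> x \notin S1.
  move=> x2; apply/negP => x1.
  have [I [I8 UI I4 IC /andP[I0 Ix]]] : exists I, [/\ all (fun i => i < 8)%N I, uniq I, size I = 4%N,
      word x0 S2 I \in C & (0%N \in I) && (index x S2 \in I)].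
    have := x2; rewrite -index_mem S28.
    by case: (index x S2) => [|[|[|[|[|[|[|[|?]]]]]]]] // _;
      [exists [:: 0; 1; 2; 3]%N|exists [:: 0; 1; 2; 3]%N|exists [:: 0; 1; 2; 3]%N
      |exists [:: 0; 1; 2; 3]%N|exists [:: 0; 1; 4; 5]%N|exists [:: 0; 1; 4; 5]%N
      |exists [:: 0; 1; 6; 7]%N|exists [:: 0; 1; 6; 7]%N].
  have x2lt : (index x S2 < 8)%N by move: x2; rewrite -index_mem S28.
  have x1lt : (index x S1 < 8)%N by move: x1; rewrite -index_mem S18.
  have I8' : all (fun i => i < size S2)%N I by rewrite S28.
  have inw l : (l < 8)%N -> l \in I -> nth x0 S2 l \in supp (word x0 S2 I).
    by move=> l8 lI; rewrite inE word_coef ?S28 // count_uniq_mem // lI.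
  have xT : word x0 S2 I \in tetrads (nth x0 S1 (index x S1)).
    rewrite nth_index //; apply/tetradsP; split=> //; first by rewrite wt_word.
    by rewrite -(nth_index x0 x2) inw.
  have := star_tetrads_sub st1 _ xT (inw 0%N isT I0).
  by rewrite q0 (negPf qS1) => /(_ x1lt).
exists (S1 ++ S2); split.
- rewrite cat_uniq US1 US2 andbT /=; apply/hasPn => x /disj; by [].
- by rewrite size_cat S18 S28.
- by rewrite take_size_cat.
by rewrite drop_size_cat.
Qed.

Implicit Types (S : seq 'I_16) (I : seq nat).

Lemma frame_mem (x0 : 'I_16) S x : frame x0 S -> x \in S.
Proof.
case=> US S16 _ _; have : #|S| = #|'I_16| by rewrite (card_uniqP US) S16 card_ord.
by move/subset_cardP => h; rewrite (h (subset_predT _)).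
Qed.

Lemma word_take (x0 : 'I_16) S I : size S = 16%N -> all (fun i => i < 8)%N I ->
  word x0 (take 8 S) I = word x0 S I.
Proof.
by move=> S16 I8; rewrite /word big_seq [RHS]big_seq; apply: eq_bigr => i iI;
   rewrite nth_take // (allP I8).
Qed.

Lemma word_drop (x0 : 'I_16) S I : word x0 (drop 8 S) I = word x0 S (map (addn 8) I).
Proof. by rewrite /word big_map; apply: eq_bigr => i _; rewrite nth_drop. Qed.

Definition frame_words : seq (seq nat) :=
  [:: [:: 0; 1; 2; 3]; [:: 0; 1; 4; 5]; [:: 0; 1; 6; 7];
      [:: 8; 9; 10; 11]; [:: 8; 9; 12; 13]; [:: 8; 9; 14; 15]]%N.

Lemma frameP (x0 : 'I_16) S : uniq S -> size S = 16%N ->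
  frame x0 S <-> (forall I, I \in frame_words -> word x0 S I \in C).
Proof.
move=> US S16; split=> [[_ _ [_ _ w1 w2 w3] [_ _ w4 w5 w6]]|h].
  have t I : all (fun i => i < 8)%N I -> word x0 (take 8 S) I \in C -> word x0 S I \in C.
    by move=> I8; rewrite word_take.
  move: w4 w5 w6; rewrite !word_drop => w4 w5 w6.
  move=> I; rewrite !inE => /or4P[|||/or3P[]] /eqP->;
    first [exact: w4 | exact: w5 | exact: w6 | by apply: t].
have hh I : I \in frame_words -> word x0 S I \in C by exact: h.
split=> //; split; rewrite ?take_uniq ?drop_uniq ?size_take ?size_drop ?S16 //;
  rewrite ?word_drop ?word_take //; by apply: hh.
Qed.

Lemma frame_rot (x0 : 'I_16) S : frame x0 S -> frame x0 (drop 8 S ++ take 8 S).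
Proof.
case=> US S16 st1 st2; have d8 : size (drop 8 S) = 8%N by rewrite size_drop S16.
split; first by rewrite uniq_catC cat_take_drop.
- by rewrite size_cat size_drop size_take S16.
- by rewrite take_size_cat.
by rewrite drop_size_cat.
Qed.

Lemma pair_parity (x0 : 'I_16) S c I : frame x0 S -> c \in C -> I \in frame_words ->
  \sum_(i <- I) c ord0 (nth x0 S i) = 0.
Proof.
move=> fr cC IF; have [US S16 _ _] := fr; rewrite -inner_word.
have := (frameP x0 US S16).1 fr I IF; rewrite -{1}sd => /dualP/(_ c cC).
by rewrite innerC.
Qed.

(** Because C is self-dual, a vector outside C has inner product 1 with some word.
    The vector {0, 1} has weight 2, and {0, 1, 8, 9} would be a tetrad leaving
    its star, so neither is in C.  The two resulting words u and v, or their sum,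
    contain one with the required parities. *)
Lemma split_word (x0 : 'I_16) S : frame x0 S -> exists2 c, c \in C &
  c ord0 (nth x0 S 0) + c ord0 (nth x0 S 1) = 1 /\
  c ord0 (nth x0 S 8) + c ord0 (nth x0 S 9) = 0.
Proof.
move=> fr; have [US S16 st1 _] := fr.
have n01 : word x0 S [:: 0; 1]%N \notin C.
  have w2 : wt (word x0 S [:: 0; 1]%N) = 2%N by rewrite wt_word // S16.
  apply/negP => /min4; rewrite -wt_eq0 w2 => /(_ isT); by [].
have n0189 : word x0 S [:: 0; 1; 8; 9]%N \notin C.
  apply/negP => wC; have w4 : wt (word x0 S [:: 0; 1; 8; 9]%N) = 4%N by rewrite wt_word // S16.
  have inw k : k \in [:: 0; 1; 8; 9]%N -> nth x0 S k \in supp (word x0 S [:: 0; 1; 8; 9]%N).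
    by rewrite !inE => /or4P[]/eqP->; rewrite word_coef ?S16.
  have tw : word x0 S [:: 0; 1; 8; 9]%N \in tetrads (nth x0 (take 8 S) 0).
    by rewrite nth_take //; apply/tetradsP; split=> //; exact: inw.
  have := star_tetrads_sub st1 (isT : 0 < 8)%N tw (inw 8%N isT).
  have h1 : nth x0 (drop 8 S) 0 \in drop 8 S by rewrite mem_nth // size_drop S16.
  rewrite nth_drop in h1; move=> h2; move: US; rewrite -(cat_take_drop 8 S) cat_uniq => /and3P[_ /hasPn/(_ _ h1) + _].
  by rewrite /= h2.
have [u uC] := notin_self_dual sd n01; have [v vC] := notin_self_dual sd n0189.
rewrite !(innerC (word _ _ _)) !inner_word !big_cons !big_nil !addr0.
set X := fun c : 'rV['F_2]_16 => c ord0 (nth x0 S 0) + c ord0 (nth x0 S 1).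
set Y := fun c : 'rV['F_2]_16 => c ord0 (nth x0 S 8) + c ord0 (nth x0 S 9).
rewrite addrA -/(X v) -/(Y v) -/(X u) => Yv Xu.
have [u0|u1] := F2_cases (Y u); first by exists u.
have [v0|v1] := F2_cases (Y v); first by exists v; rewrite -/(X v) -/(Y v) // -Yv v0 addr0.
exists (u + v); first exact: rpredD.
have XD : X (u + v) = X u + X v by rewrite /X !mxE addrACA.
have YD : Y (u + v) = Y u + Y v by rewrite /Y !mxE addrACA.
rewrite -/(X (u + v)) -/(Y (u + v)) XD YD Xu u1 v1; split; last exact: F2_addrr.
have -> : X v = 0 by move: Yv; rewrite v1; case: (F2_cases (X v)) => ->.
by rewrite addr0.
Qed.

(** Exchanges the two positions of each pair j with b j. *)
Definition flip_index (b : nat -> bool) i : nat :=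
  if b i./2 then (if odd i then i.-1 else i.+1) else i.

Definition orient (x0 : 'I_16) b (S : seq 'I_16) : seq 'I_16 :=
  [seq nth x0 S (flip_index b i) | i <- iota 0 16].

Lemma flip_index_lt b i : (i < 16)%N -> (flip_index b i < 16)%N.
Proof. by rewrite /flip_index; case: (b i./2) => //; case: ifP; lia. Qed.

Lemma nth_orient (x0 : 'I_16) b S i : (i < 16)%N -> nth x0 (orient x0 b S) i = nth x0 S (flip_index b i).
Proof. by move=> i16; rewrite /orient (nth_map 0%N) ?size_iota // nth_iota. Qed.

Lemma word_orient (x0 : 'I_16) b S I : all (fun i => i < 16)%N I ->
  word x0 (orient x0 b S) I = word x0 S (map (flip_index b) I).
Proof.
move=> I16; rewrite /word big_map big_seq [RHS]big_seq; apply: eq_bigr => i iI.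
by rewrite nth_orient // (allP I16).
Qed.

Lemma flip_indexK b : involutive (flip_index b).
Proof.
move=> k; have half : (flip_index b k)./2 = k./2.
  by rewrite /flip_index; case: (b k./2) => //; case: ifP; lia.
rewrite {1}/flip_index half /flip_index; case: (b k./2) => //.
by case: (boolP (odd k)) => ok; case: ifP; lia.
Qed.

Lemma frame_orient (x0 : 'I_16) b S : frame x0 S -> frame x0 (orient x0 b S).
Proof.
move=> fr; have [US S16 _ _] := fr.
have US1 : uniq (orient x0 b S).
  rewrite map_inj_in_uniq ?iota_uniq // => i j; rewrite !mem_iota !add0n => /andP[_ i16] /andP[_ j16].
  move/eqP; rewrite nth_uniq ?S16 ?flip_index_lt // => /eqP e.
  by rewrite -(flip_indexK b i) e flip_indexK.
have S116 : size (orient x0 b S) = 16%N by rewrite size_map size_iota.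
apply/(frameP x0 US1 S116) => I IF; have FW := (frameP x0 US S16).1 fr.
have I16 : all (fun i => i < 16)%N I by move: I IF {FW}; apply/allP.
rewrite word_orient // (@same_parity_word _ _ _ 16 _ I) ?FW //.
have half k : (flip_index b k) = if b k./2 then (if odd k then k.-1 else k.+1) else k by [].
move: IF; rewrite !inE => /or4P[|||/or3P[]] /eqP-> /=; rewrite !half /=.
- by case: (b 0%N); case: (b 1%N).
- by case: (b 0%N); case: (b 2%N).
- by case: (b 0%N); case: (b 3%N).
- by case: (b 4%N); case: (b 5%N).
- by case: (b 4%N); case: (b 6%N).
- by case: (b 4%N); case: (b 7%N).
Qed.

(** On the second half c is constant on pairs, so up to words of the frame it is
    {0, 2, 4, 6} or {0, 2, 4, 6, 8, 9}.  The former would be a tetrad through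
    point 0 avoiding its partner, against [star_partner]. *)
Lemma oriented_word (x0 : 'I_16) S c : frame x0 S -> c \in C ->
  (forall k, (k < 8)%N -> c ord0 (nth x0 S k) = (~~ odd k)%:R) ->
  c ord0 (nth x0 S 8) + c ord0 (nth x0 S 9) = 0 ->
  word x0 S [:: 0; 2; 4; 6; 8; 9]%N \in C.
Proof.
move=> fr cC odds e89; have [US S16 st1 _] := fr.
have FW := (frameP x0 US S16).1 fr.
pose y k := c ord0 (nth x0 S k) != 0.
have y01 k : (k < 8)%N -> y k = ~~ odd k.
  by move=> k8; rewrite /y odds //; case: (odd k).
have yp I j k : I = [:: 8; 9; j; k]%N -> I \in frame_words -> y j = y k.
  move=> -> /(pair_parity fr cC); rewrite !big_cons big_nil addr0 addrA e89 add0r /y.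
  by case: (F2_cases (c ord0 (nth x0 S j))) (F2_cases (c ord0 (nth x0 S k))) => -> [] ->.
have y9 : y 9%N = y 8%N.
  move: e89; rewrite /y.
  by case: (F2_cases (c ord0 (nth x0 S 8))) (F2_cases (c ord0 (nth x0 S 9))) => -> [] ->.
have yb := yp _ 10%N 11%N erefl isT; have yd := yp _ 12%N 13%N erefl isT.
have yf := yp _ 14%N 15%N erefl isT.
pose bits b8 b10 b12 b14 k :=
  nth false [:: true; false; true; false; true; false; true; false;
    b8; b8; b10; b10; b12; b12; b14; b14] k.
pose J (b : bool) I : seq nat := if b then I else [::].
have cE : c = word x0 S [seq k <- iota 0 16 | bits (y 8) (y 10) (y 12) (y 14) k]%N.
  rewrite {1}(word_expand x0 c US (fun x => frame_mem x fr)) S16; congr word.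
  apply: eq_in_filter => k; rewrite mem_iota add0n -/(y k) => /andP[_ k16].
  have [k8|k8] := ltnP k 8.
    rewrite (y01 _ k8); move: k k8 {k16} => [|[|[|[|[|[|[|[|?]]]]]]]] // _.
  move: k16; rewrite -(subnKC k8); move: (k - 8)%N => l {k8}.
  by move: l => [|[|[|[|[|[|[|[|l]]]]]]]] // _; rewrite /bits /= ?y9 -?yb -?yd -?yf.
have JC b I : I \in frame_words -> word x0 S (J b I) \in C.
  by case: b => IF; [exact: FW | rewrite /word big_nil mem0v].
move: cC; rewrite {}cE; move: (y 8%N) (y 10%N) (y 12%N) (y 14%N) => b8 b10 b12 b14 cC.
(* The three words clear the pairs from position 10 on; what is left at 8, 9
   is the parity of the pairs occupied by c. *)
have := rpredD (rpredD (rpredD cC (JC b10 [:: 8; 9; 10; 11]%N isT))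
  (JC b12 [:: 8; 9; 12; 13]%N isT)) (JC b14 [:: 8; 9; 14; 15]%N isT).
rewrite -!word_cat (@same_parity_word _ _ _ 16 _
  ([:: 0; 2; 4; 6]%N ++ J (b8 (+) b10 (+) b12 (+) b14) [:: 8; 9]%N)); last first.
  by case: b8 {cC}; case: b10; case: b12; case: b14; vm_compute.
case: (_ (+) _) => //; rewrite cats0 => wC; exfalso.
have tw : word x0 S [:: 0; 2; 4; 6]%N \in tetrads (nth x0 (take 8 S) 0).
  rewrite nth_take //; apply/tetradsP; split=> //; first by rewrite wt_word ?S16.
  by rewrite inE word_coef ?S16.
have := star_partner st1 tw; rewrite nth_take // word_coef ?S16 //.
Qed.

Definition swap_halves i : nat := if (i < 8)%N then (8 + i)%N else (i - 8)%N.

Lemma nth_rot8 (x0 : 'I_16) S i : size S = 16%N -> (i < 16)%N ->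
  nth x0 (drop 8 S ++ take 8 S) i = nth x0 S (swap_halves i).
Proof.
move=> S16 i16; rewrite nth_cat size_drop S16 /swap_halves; case: ltnP => i8.
  by rewrite nth_drop.
by rewrite nth_take //; move: i8 i16; clear; lia.
Qed.

Lemma word_rot8 (x0 : 'I_16) S I : size S = 16%N -> all (fun i => i < 16)%N I ->
  word x0 (drop 8 S ++ take 8 S) I = word x0 S (map swap_halves I).
Proof.
move=> S16 I16; rewrite /word big_map big_seq [RHS]big_seq; apply: eq_bigr => i iI.
by rewrite nth_rot8 // (allP I16).
Qed.

Lemma orient_val (x0 : 'I_16) b S (c : 'rV['F_2]_16) j (o : bool) : (j < 8)%N ->
  b j = (c ord0 (nth x0 S j.*2) == 0) ->
  c ord0 (nth x0 S j.*2) + c ord0 (nth x0 S j.*2.+1) = 1 ->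
  c ord0 (nth x0 (orient x0 b S) (o + j.*2)) = (~~ o)%:R.
Proof.
move=> j8 bj e; rewrite nth_orient; last by case: o; move: j8; clear; lia.
rewrite /flip_index half_bit_double oddD odd_double addbF oddb bj.
case: eqP => [e0 | /eqP e0].
  by move: e; rewrite e0 add0r => e; case: o; rewrite ?add1n ?add0n.
have e1 : c ord0 (nth x0 S j.*2) = 1 by case: (F2_cases (c ord0 (nth x0 S j.*2))) e0 => ->.
case: o; rewrite ?add1n ?add0n //.
by move: e; rewrite e1; case: (F2_cases (c ord0 (nth x0 S j.*2.+1))) => ->.
Qed.

Lemma orient_sum (x0 : 'I_16) b S (c : 'rV['F_2]_16) j : (j < 8)%N ->
  c ord0 (nth x0 (orient x0 b S) j.*2) + c ord0 (nth x0 (orient x0 b S) j.*2.+1) =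
  c ord0 (nth x0 S j.*2) + c ord0 (nth x0 S j.*2.+1).
Proof.
move=> j8; rewrite !nth_orient; try by move: j8; clear; lia.
rewrite /flip_index /= odd_double doubleK uphalf_double.
by case: (b j) => //=; rewrite addrC.
Qed.

Lemma pair_odd (x0 : 'I_16) S c j : frame x0 S -> c \in C -> (j < 4)%N ->
  c ord0 (nth x0 S 0) + c ord0 (nth x0 S 1) = 1 ->
  c ord0 (nth x0 S j.*2) + c ord0 (nth x0 S j.*2.+1) = 1.
Proof.
move=> fr cC j4 e; case: j j4 => [//|j] j4.
have IF : [:: 0; 1; j.+1.*2; j.+1.*2.+1]%N \in frame_words by move: j j4 => [|[|[|]]].
have := pair_parity fr cC IF; rewrite !big_cons big_nil addr0 addrA e => h.
have F2_one (z : 'F_2) : 1 + z = 0 -> z = 1 by case: (F2_cases z) => ->.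
exact: F2_one.
Qed.

(** By [split_word] there are words meeting every pair of one half in one point
    and every pair of the other half evenly, for either half.  Each pair is
    oriented so that the word belonging to its half has its point in first
    position; then [oriented_word] applies to both. *)
Lemma standard_frame (x0 : 'I_16) : exists S, [/\ frame x0 S,
  word x0 S [:: 0; 2; 4; 6; 8; 9]%N \in C & word x0 S [:: 8; 10; 12; 14; 0; 1]%N \in C].
Proof.
have [S fr] := frame_exists x0; have [US S16 _ _] := fr.
have frR := frame_rot fr.
have [c1 c1C [c1x c1y]] := split_word fr; have [c2 c2C [c2x c2y]] := split_word frR.
pose b j := if (j < 4)%N then c1 ord0 (nth x0 S j.*2) == 0 else c2 ord0 (nth x0 S j.*2) == 0.
have fr1 := frame_orient b fr; have [US1 S116 _ _] := fr1.
exists (orient x0 b S); split=> //.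
  apply: (oriented_word fr1 c1C) => [k k8|]; last by rewrite (@orient_sum _ _ _ _ 4).
  rewrite -[k in nth _ _ k](odd_double_half k) orient_val //.
  - by move: k8; clear; lia.
  - by rewrite /b; have -> : (k./2 < 4)%N by move: k8; clear; lia.
  - by apply: pair_odd => //; move: k8; clear; lia.
have -> : word x0 (orient x0 b S) [:: 8; 10; 12; 14; 0; 1]%N =
    word x0 (drop 8 (orient x0 b S) ++ take 8 (orient x0 b S)) [:: 0; 2; 4; 6; 8; 9]%N.
  by rewrite word_rot8.
have c2pair j : (j < 4)%N ->
    c2 ord0 (nth x0 S (j + 4).*2) + c2 ord0 (nth x0 S (j + 4).*2.+1) = 1.
  move=> j4; have := pair_odd frR c2C j4 c2x.
  rewrite !nth_rot8 //; try by move: j4; clear; lia.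
  by move: j j4 => [|[|[|[|?]]]].
apply: (oriented_word (frame_rot fr1) c2C) => [k k8|].
  rewrite nth_rot8 //; last by move: k8; clear; lia.
  rewrite /swap_halves k8.
  have -> : (8 + k = odd k + (k./2 + 4).*2)%N by move: (odd_double_half k) k8; clear; lia.
  rewrite orient_val ?c2pair //; try by move: k8; clear; lia.
  by rewrite /b; have -> : (k./2 + 4 < 4)%N = false by lia.
rewrite !nth_rot8 // (@orient_sum _ _ _ _ 0) //.
by move: c2y; rewrite !nth_rot8.
Qed.

Definition generators : seq (seq nat) :=
  frame_words ++ [:: [:: 0; 2; 4; 6; 8; 9]; [:: 8; 10; 12; 14; 0; 1]]%N.

Definition bits8 : finType := (bool * bool * bool * bool * bool * bool * bool * bool)%type.

Definition bits8_seq (b : bits8) : bitseq :=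
  let: (b1, b2, b3, b4, b5, b6, b7, b8) := b in [:: b1; b2; b3; b4; b5; b6; b7; b8].

Definition combination (b : bits8) : seq nat := flatten (mask (bits8_seq b) generators).

(** Positions 3, 5, 7, 11, 13, 15 each lie in a single generator, and each of the
    last two generators splits a pair of its half; this recovers the
    coefficients of a combination. *)
Definition read_off (I : seq nat) : bitseq :=
  let p k := odd (count_mem k I) in
  [:: p 3; p 5; p 7; p 11; p 13; p 15; p 2 (+) p 3; p 10 (+) p 11]%N.

Lemma combination_spec b : all (fun i => i < 16)%N (combination b) &&
  (read_off (combination b) == bits8_seq b).
Proof.
by case: b => [[[[[[[b1 b2] b3] b4] b5] b6] b7] b8];
   case: b1; case: b2; case: b3; case: b4; case: b5; case: b6; case: b7; case: b8.
Qed.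

Lemma same_parity_read_off I J : same_parity 16 I J -> read_off I = read_off J.
Proof.
case/and3P=> _ _ /allP h; have {}h k : (k < 16)%N -> odd (count_mem k I) = odd (count_mem k J).
  by move=> k16; apply/eqP/h; rewrite mem_iota.
by rewrite /read_off !h.
Qed.

(** The eight generators are linearly independent, so their 2^8 combinations
    exhaust C. *)
Lemma standard_code (x0 : 'I_16) S : frame x0 S ->
  word x0 S [:: 0; 2; 4; 6; 8; 9]%N \in C -> word x0 S [:: 8; 10; 12; 14; 0; 1]%N \in C ->
  forall c, (c \in C) = (c \in codom (fun b => word x0 S (combination b))).
Proof.
move=> fr w7 w8; have [US S16 _ _] := fr; have FW := (frameP x0 US S16).1 fr.
pose f b := word x0 S (combination b).
have fC b : f b \in C.
  rewrite /f /combination; have : all (fun I => word x0 S I \in C) (mask (bits8_seq b) generators).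
    apply/allP => I /mem_mask; rewrite mem_cat => /orP[/FW //|].
    by rewrite !inE => /orP[]/eqP->.
  elim: (mask _ _) => [|I Is IH] /=; first by rewrite /word big_nil mem0v.
  by case/andP=> IC /IH; rewrite word_cat; apply: rpredD.
have finj : injective f.
  move=> b b' e; have /andP[lb rb] := combination_spec b; have /andP[lb' rb'] := combination_spec b'.
  have := word_inj US _ _ e; rewrite S16 => /(_ lb lb') /same_parity_read_off.
  rewrite (eqP rb) (eqP rb').
  by move: b b' {e lb rb lb' rb'} => [[[[[[[? ?] ?] ?] ?] ?] ?] ?] [[[[[[[? ?] ?] ?] ?] ?] ?] ?] [-> -> -> -> -> -> -> ->].
have sub : codom f \subset C by apply/subsetP => c /codomP[b ->].
have cd : #|codom f| = #|C|.
  by rewrite card_codom // (typeI_card nE isT neC) /bits8 !card_prod !card_bool.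
by move=> c; have := subset_cardP cd sub c.
Qed.

End Tetrads.

(** The permutation matching two standard frames maps one code to the other. *)
Lemma type_I_16_unique (C D : code 16) :
  near_extremal_type_I C -> near_extremal_type_I D -> equivalent C D.
Proof.
move=> neC neD; pose x0 : 'I_16 := ord0.
have [S [frS w7 w8]] := standard_frame neC x0; have [T [frT v7 v8]] := standard_frame neD x0.
have CE := standard_code neC frS w7 w8; have DE := standard_code neD frT v7 v8.
have aS x : x \in S by apply: frame_mem frS.
have aT x : x \in T by apply: frame_mem frT.
have [US S16 _ _] := frS; have [UT T16 _ _] := frT.
pose f x := nth x0 S (index x T).
have f_inj : injective f.
  move=> x y /eqP; rewrite nth_uniq ?S16 //; last first.
  - by have := aT y; rewrite -index_mem T16.
  - by have := aT x; rewrite -index_mem T16.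
  by move/eqP/(congr1 (nth x0 T)); rewrite !nth_index.
pose s := perm f_inj; exists s => c.
have sw I : all (fun i => i < 16)%N I -> col_perm s (word x0 S I) = word x0 T I.
  move=> I16; apply/rowP => x; rewrite mxE permE /f.
  have xl : (index x T < 16)%N by have := aT x; rewrite -index_mem T16.
  by rewrite word_coef ?S16 // -[x in RHS](nth_index x0 (aT x)) word_coef ?T16.
rewrite CE DE; apply/codomP/codomP => -[b e]; exists b.
  have : col_perm s c = col_perm s (word x0 S (combination b)).
    by rewrite e sw //; case/andP: (combination_spec b).
  by move/(congr1 (col_perm s^-1)); rewrite -!col_permM mulVg !col_perm1.
by rewrite e sw //; case/andP: (combination_spec b).
Qed.

(** * Strengths of the support designs *)

Local Close Scope ring_scope.
Local Open Scope nat_scope.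

Theorem theorem1p2 :
  (forall (n : nat) (C : code n),
     0 < n -> n = 0 %[mod 8] -> near_extremal_type_I C ->
     (design_delta C < design_s C <-> is_the_type_I_16_8_4 C) /\
     (is_the_type_I_16_8_4 C ->
        is_design 2 16 6 8 (support_design C 6) /\
        perm_eq (support_design C 10)
                (complement_design (support_design C 6)))) /\
  (forall C' : code 16, near_extremal_even_fsd C' ->
     t_design 2 (support_design C' 6 ++ support_design (dual C') 6) /\
     t_design 2 (support_design C' 10 ++ support_design (dual C') 10)) /\
  (forall C'' : code 64, near_extremal_even_fsd C'' ->
     t_design 2 (support_design C'' 28 ++ support_design (dual C'') 28) /\
     t_design 2 (support_design C'' 36 ++ support_design (dual C'') 36)).
Proof.
have zero m r : kraw2 m r == 0%R -> kraw2 m r = 0%R by move/eqP.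
split; last first.
  split=> [C neC | C neC].
    have d := @fsd_design2 16 2 C erefl isT neC.
    (* 6 = 2 * 2 + 2 * 1 and 10 = 2 * 2 + 2 * 3 *)
    split; [apply: (d 1) | apply: (d 3)]; by apply: zero; rewrite kraw2_eq0.
  have d := @fsd_design2 64 8 C erefl isT neC.
  (* 28 = 2 * 8 + 2 * 6 and 36 = 2 * 8 + 2 * 10 *)
  by split; [apply: (d 6) | apply: (d 10)]; apply: zero; rewrite kraw2_eq0; vm_compute.
move=> n C n0 n8 neC; have [m nE] : exists m, n = 8 * m.
  by exists (n %/ 8); rewrite mulnC divnK // /dvdn n8.
have m0 : 0 < m by move: n0 nE; clear; lia.
have of16 : is_the_type_I_16_8_4 C -> n = 8 * 2 by case=> [[_ [e _ _]] _]; exact: e.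
split; last by move=> /of16 n16; split; [apply: design_C6 | apply: complement_C10].
split=> [lt | /of16 n16]; last first.
  exact: leq_ltn_trans (design_delta_le1 n16 neC) (design_s_ge2 n16 neC).
have [m5|m4] := leqP 5 m; first by case: (no_near_extremal_type_I nE m5 neC).
have [m2|m2] := eqVneq m 2; last first.
  have m14 : 0 < m <= 4 by rewrite m0 -ltnS.
  have := leq_trans lt (design_s_le1 nE m14 m2 neC).
  by rewrite ltnS leqNgt (design_delta_ge1 nE m0 neC).
subst m; split; first exact: typeI_16_params.
move=> D [neD _]; subst n; exact: type_I_16_unique.
Qed.
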